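(* Let $d\ge3$ and $1\le p\le\infty$, and let the operators $\Lambda_J$, $J\in\mathbb N_0$, and the errors of best approximation $E_m(f)_p$ be as defined in the context, with $\phi\in C^\infty([0,\infty))$. Then there is a constant $c_p>0$ (depending only on $p$, $d$ and $\phi$) such that for all $J\in\mathbb N_0$ $$\|f-\Lambda_Jf\|_{L^p(\mathbb S^{d-1})}\le c_p\,E_{2^{J-1}}(f)_p\qquad\text{for each } f\in L^p(\mathbb S^{d-1}).$$
   Context: Notation. $\mathbb S^{d-1}$ is the unit sphere of $\mathbb R^d$, $e^1,\dots,e^d$ the canonical basis, $\omega_{d-1}$ the rotation-invariant probability measure on $\mathbb S^{d-1}$, $\langle f_1,f_2\rangle_{\mathbb S^{d-1}}=\int f_1\overline{f_2}\,d\omega_{d-1}$; $L^p(\mathbb S^{d-1})$ is taken with respect to $\omega_{d-1}$ for $1\le p<\infty$, while $L^\infty(\mathbb S^{d-1})$ denotes, by convention, the space of continuous functions $\mathbb S^{d-1}\to\mathbb C$ with the supremum norm. For real $m\ge0$, $\Pi_m(\mathbb S^{k})$ is the space of (complex) spherical polynomials of degree at most $m$ on $\mathbb S^k$ (restrictions of polynomials of degree $\le m$), and $E_m(f)_p=\inf_{P\in\Pi_m(\mathbb S^{d-1})}\|f-P\|_{L^p(\mathbb S^{d-1})}$. For $g\in SO(d)$, $T^d(g)f=f(g^{-1}\cdot)$. $SO(d-1)$ is identified with $\{h\in SO(d): he^d=e^d\}$. For $\nu\in\mathbb S^{d-1}$, $g_\nu$ is an arbitrary element of $SO(d)$ with $g_\nu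 e^d=\nu$; for $\nu'\in\mathbb S^{d-2}$, $h_{\nu'}$ is an arbitrary element of $SO(d-1)$ with $h_{\nu'}e^{d-1}=(\nu',0)$. Curvelets. Let $\phi\in C^\infty([0,\infty))$ be real-valued, non-increasing, with $\phi(t)=1$ for $t\in[0,1/2]$ and $\phi(t)=0$ for $t\ge1$. Put $\kappa(t)=\sqrt{\phi^2(t/2)-\phi^2(t)}$, so $\operatorname{supp}\kappa\subset[1/2,2]$. Let $\dim\mathcal H_n^d=\frac{(2n+d-2)(n+d-3)!}{(d-2)!\,n!}$ and $$A_n=\frac{2^{(2-d)/2}}{\sqrt{\Gamma(d/2)}}\prod_{i=0}^{d-3}\sqrt{\frac{(2n+d-i-2)\,\Gamma(n+\frac{d-i-2}{2})}{\Gamma(n+\frac{d-i-1}{2})}},$$ the positive constant such that $x\mapsto A_n(x_d+\mathrm i x_{d-1})^n$ has $L^2(\mathbb S^{d-1})$-norm $1$. The polynomial curvelets are $\Psi_{\mathrm C}^0\equiv1$ and, for $j\in\mathbb N$, $$\Psi_{\mathrm C}^j(x)=\sqrt2\sum_{n=0}^\infty\sqrt{\dim\mathcal H_n^d}\;\kappa\!\left(\tfrac{n}{2^{j-1}}\right)A_n\,\Re\{(x_d+\mathrm i x_{d-1})^n\},\qquad x\in\mathbb S^{d-1}.$$ Frame and operators. For each $j\in\mathbb N$ let points $\eta_{j,r}\in\mathbb S^{d-1}$, $\eta'_{j,s}\in\mathbb S^{d-2}$ and weights $\omega_{j,r},\omega'_{j,s}>0$ ($r=1,\dots,r_j$, $s=1,\dots,s_j$)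 be such that $\int_{\mathbb S^{d-1}}f\,d\omega_{d-1}=\sum_{r}\omega_{j,r}f(\eta_{j,r})$ for all $f\in\Pi_{2^{j+1}}(\mathbb S^{d-1})$ and $\int_{\mathbb S^{d-2}}f\,d\omega_{d-2}=\sum_s\omega'_{j,s}f(\eta'_{j,s})$ for all $f\in\Pi_{2^{j+1}}(\mathbb S^{d-2})$. For $j=0$ put $r_0=s_0=1$, $\omega_{0,1}=\omega'_{0,1}=1$, with $\eta_{0,1},\eta'_{0,1}$ arbitrary. Then $\Psi_{\mathrm C}^{j,r,s}=\sqrt{\omega_{j,r}\omega'_{j,s}}\;T^d(g_{\eta_{j,r}}h_{\eta'_{j,s}})\Psi_{\mathrm C}^j$, and for $J\in\mathbb N_0$ the operator $\Lambda_J:L^1(\mathbb S^{d-1})\to\Pi_{2^J}(\mathbb S^{d-1})$ is $$\Lambda_Jf=\sum_{j=0}^J\sum_{r=1}^{r_j}\sum_{s=1}^{s_j}\langle f,\Psi_{\mathrm C}^{j,r,s}\rangle_{\mathbb S^{d-1}}\Psi_{\mathrm C}^{j,r,s}.$$ *)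

(* Defs.v *)
From HB Require Import structures.
From mathcomp Require Import all_boot all_order all_algebra.
From mathcomp Require Import complex.
(* mpoly's notations clash with MathComp-Analysis. *)
From mathcomp Require Import -(notations) mpoly.
From mathcomp Require Import all_classical all_reals all_analysis.

Set Implicit Arguments.
Unset Strict Implicit.
Unset Printing Implicit Defensive.

Import Order.TTheory GRing.Theory Num.Theory.
Import numFieldNormedType.Exports.

Local Open Scope classical_set_scope.
Local Open Scope ring_scope.

(* R^d is 'cV[R]_d, so that SO(d) acts by left multiplication.  Functions on
   the sphere are total functions on 'cV[R]_d of which only the values on the
   sphere are ever used.  Coordinates are numbered from 0: the canonical basis
   vectors written e^d and e^(d-1) are basis_vec d d.-1 and basis_vec d d.-2. *)

Definition modc (R : realType) (z : R[i]) : R := ComplexField.Normc.normc z.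

Definition sphere (R : realType) (d : nat) : set 'cV[R]_d :=
  [set x | Num.sqrt (\sum_i x i 0 ^+ 2) = 1].

Definition basis_vec (R : realType) (d k : nat) : 'cV[R]_d :=
  \col_i (i == k :> nat)%:R.

(* 0 when k is out of range *)
Definition nth_coord (R : realType) (d : nat) (x : 'cV[R]_d) (k : nat) : R :=
  if insub k is Some i then x i 0 else 0.

(* (v, 0) for v in R^(d-1) *)
Definition extend0 (R : realType) (d : nat) (v : 'cV[R]_d.-1) : 'cV[R]_d :=
  \col_i nth_coord v i.

Definition SO (R : realType) (d : nat) : set 'M[R]_d :=
  [set g | g *m g^T = 1%:M /\ \det g = 1].

(* SO(d-1), identified with the stabiliser of e^d in SO(d) *)
Definition SO_stab (R : realType) (d : nat) : set 'M[R]_d :=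
  [set h | SO h /\ h *m basis_vec R d d.-1 = basis_vec R d d.-1].

Definition translate (R : realType) (d : nat) (g : 'M[R]_d) (f : 'cV[R]_d -> R[i])
    : 'cV[R]_d -> R[i] :=
  fun x => f (invmx g *m x).

(* R^d with its Borel sigma-algebra *)
Definition borelRd (R : realType) (d : nat) :=
  g_sigma_algebraType (@open 'cV[R]_d).

(* The measure on the sphere is represented as a Borel probability on R^d
   carried by the sphere; rotation invariance characterises it. *)
Definition rotation_invariant_on_sphere (R : realType) (d : nat)
    (mu : probability (borelRd R d) R) : Prop :=
  mu (@sphere R d : set (borelRd R d)) = 1%E /\
  forall (g : 'M[R]_d) (A : set (borelRd R d)), SO g -> measurable A ->
    mu ((fun x : 'cV[R]_d => g *m x) @` A : set (borelRd R d)) = mu A.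

Section Integration.
Context (R : realType) (d : nat) (mu : probability (borelRd R d) R).
Implicit Types (f : 'cV[R]_d -> R[i]) (p : \bar R).

Definition sphere_integral f : R[i] :=
  Complex (\int[mu]_(x in (@sphere R d : set (borelRd R d))) complex.Re (f x))
          (\int[mu]_(x in (@sphere R d : set (borelRd R d))) complex.Im (f x)).

Definition sphere_dot (f1 f2 : 'cV[R]_d -> R[i]) : R[i] :=
  sphere_integral (fun x => f1 x * conjc (f2 x)).

(* for p = +oo: the supremum norm, not the essential supremum *)
Definition Lp_norm p f : \bar R :=
  if p is +oo%E then ereal_sup [set (modc (f x))%:E | x in @sphere R d]
  else Lnorm mu p ((fun x : borelRd R d => (modc (f x))%:E)
                     \_ (@sphere R d : set (borelRd R d))).

(* for p = +oo: the continuous functions, by convention *)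
Definition in_Lp p f : Prop :=
  if p is +oo%E then
    {within @sphere R d, continuous (fun x => complex.Re (f x))} /\
    {within @sphere R d, continuous (fun x => complex.Im (f x))}
  else
    [/\ measurable_fun (@sphere R d : set (borelRd R d))
          (fun x : borelRd R d => complex.Re (f x)),
        measurable_fun (@sphere R d : set (borelRd R d))
          (fun x : borelRd R d => complex.Im (f x))
      & (Lp_norm p f < +oo)%E].

(* msize P is the degree of P plus one, and 0 for P = 0. *)
Definition spherical_poly (m : R) f : Prop :=
  exists P : mpoly.mpoly d R[i],
    (mpoly.msize P).-1%:R <= m /\
    forall x, @sphere R d x ->
      f x = mpoly.meval (fun i => real_complex R (x i 0)) P.

Definition best_error (m : R) p f : \bar R :=
  ereal_inf [set Lp_norm p (fun x => f x - P x) | P in spherical_poly m].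

(* Positive weights and nodes of one rule for each level j, with N j nodes
   numbered 0, ..., N j - 1; the rule of level j >= 1 is exact up to degree
   2^(j+1), and level 0 has a single arbitrary node of weight 1. *)
Definition quadrature_rules (N : nat -> nat) (eta : nat -> nat -> 'cV[R]_d)
    (w : nat -> nat -> R) : Prop :=
  [/\ N 0 = 1%N /\ w 0 0 = 1,
      forall j r, (r < N j)%N -> sphere (eta j r),
      forall j r, (0 < j)%N -> (r < N j)%N -> 0 < w j r
    & forall j f, (0 < j)%N -> spherical_poly (2 ^+ j.+1) f ->
        sphere_integral f =
          \sum_(r < N j) real_complex R (w j r) * f (eta j r)].

End Integration.

Section Curvelets.
Context (R : realType) (d : nat).
Implicit Types (phi : R -> R) (x : 'cV[R]_d).

(* phi in C^infty([0, oo)): smooth on ]0, oo[, all derivatives having a finite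
   limit at 0, and phi continuous at 0.  The values of phi on ]-oo, 0[ are
   irrelevant. *)
Definition smooth_halfline phi : Prop :=
  [/\ forall n t, 0 < t -> derivable (derive1n n phi) t 1,
      forall n, cvg (derive1n n phi t @[t --> 0^'+])
    & phi t @[t --> 0^'+] --> phi 0].

Definition cutoff phi : Prop :=
  [/\ smooth_halfline phi,
      forall s t, 0 <= s -> s <= t -> phi t <= phi s,
      forall t, 0 <= t <= 2^-1 -> phi t = 1
    & forall t, 1 <= t -> phi t = 0].

Definition kappa phi (t : R) : R :=
  Num.sqrt (phi (t / 2) ^+ 2 - phi t ^+ 2).

Definition Gamma (s : R) : R :=
  \int[lebesgue_measure]_(t in `]0, +oo[) (t `^ (s - 1) * expR (- t)).

Definition dimH (n : nat) : R :=
  ((2 * n + d - 2) * (n + d - 3)`!)%N%:R / ((d - 2)`! * n`!)%N%:R.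

Definition A_ (n : nat) : R :=
  2 `^ ((2 - d%:R) / 2) / Num.sqrt (Gamma (d%:R / 2)) *
  \prod_(0 <= i < (d - 2)%N)
    Num.sqrt ((2 * n%:R + d%:R - i%:R - 2)
              * Gamma (n%:R + (d%:R - i%:R - 2) / 2)
              / Gamma (n%:R + (d%:R - i%:R - 1) / 2)).

(* The series has finitely many nonzero terms. *)
Definition curvelet phi (j : nat) x : R[i] :=
  if j == 0%N then 1 else
  real_complex R
    (Num.sqrt 2 *
     limn (series (fun n =>
       Num.sqrt (dimH n) * kappa phi (n%:R / 2 ^ (j%:Z - 1)) * A_ n *
       complex.Re (Complex (nth_coord x d.-1) (nth_coord x d.-2) ^+ n)))).

(* g nu is any element of SO(d) mapping e^d to nu *)
Definition pole_rotation (g : 'cV[R]_d -> 'M[R]_d) : Prop :=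
  forall nu, sphere nu -> SO (g nu) /\ g nu *m basis_vec R d d.-1 = nu.

(* h nu is any element of SO(d-1) mapping e^(d-1) to (nu, 0) *)
Definition equator_rotation (h : 'cV[R]_d.-1 -> 'M[R]_d) : Prop :=
  forall nu, sphere nu ->
    SO_stab (h nu) /\ h nu *m basis_vec R d d.-2 = extend0 nu.

Definition frame_curvelet phi (g : 'cV[R]_d -> 'M[R]_d)
    (h : 'cV[R]_d.-1 -> 'M[R]_d)
    (eta : nat -> nat -> 'cV[R]_d) (w : nat -> nat -> R)
    (eta' : nat -> nat -> 'cV[R]_d.-1) (w' : nat -> nat -> R)
    (j r s : nat) : 'cV[R]_d -> R[i] :=
  fun x => real_complex R (Num.sqrt (w j r * w' j s)) *
           translate (g (eta j r) *m h (eta' j s)) (curvelet phi j) x.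

Definition Lambda (mu : probability (borelRd R d) R) phi
    (g : 'cV[R]_d -> 'M[R]_d) (h : 'cV[R]_d.-1 -> 'M[R]_d)
    (N : nat -> nat) (eta : nat -> nat -> 'cV[R]_d) (w : nat -> nat -> R)
    (N' : nat -> nat) (eta' : nat -> nat -> 'cV[R]_d.-1)
    (w' : nat -> nat -> R)
    (J : nat) (f : 'cV[R]_d -> R[i]) : 'cV[R]_d -> R[i] :=
  fun x =>
    \sum_(0 <= j < J.+1) \sum_(0 <= r < N j) \sum_(0 <= s < N' j)
      sphere_dot mu f (frame_curvelet phi g h eta w eta' w' j r s) *
      frame_curvelet phi g h eta w eta' w' j r s x.

End Curvelets.

(* Main.v *)
Require Import Defs.
From HB Require Import structures.
From mathcomp Require Import all_boot all_order all_algebra.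
From mathcomp Require Import ring lra zify.
From mathcomp Require Import complex.
From mathcomp Require Import -(notations) mpoly.
From mathcomp Require Import all_classical all_reals all_analysis.
From mathcomp Require Import measurable_realfun.

Set Implicit Arguments.
Unset Strict Implicit.
Unset Printing Implicit Defensive.

Import Order.TTheory GRing.Theory Num.Theory.
Import numFieldNormedType.Exports.

Local Open Scope classical_set_scope.
Local Open Scope ring_scope.

Local Notation Re := complex.Re.
Local Notation Im := complex.Im.

(** Write [Z n] for the zonal polynomial [zonal d n], so that [Z n (x.y)] is
    the kernel of the orthogonal projection onto the harmonics of degree [n].
    The proof identifies the frame operator of level [J] with the integral
    operator whose kernel is
    [V_J (x.y) = \sum_n phi(n / 2^J)^2 Z n (x.y)] ([kernel], [Lambda_kernel]).
    Since [phi = 1] on [[0, 1/2]], this operator reproduces the spherical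
    polynomials [P] of degree at most [2^(J-1)] ([kernel_reproduces]), so that
    [f - Lambda_J f = (f - P) - V_J (f - P)]; and it is bounded on every [L^p]
    with a bound that does not depend on [J] ([exists_mass],
    [operator_power_integral]).  Taking the infimum over [P] ends the proof.

    The kernel.  The curvelet rotated by [g_eta h_eta'] is a combination of the
    functions [Re (z.x)^n], where [z = eta + i b] is a null vector, [z.z = 0],
    made of the node [eta] and of a unit tangent vector [b] at [eta] given by
    [eta'].  Hence the sum of [Psi(x) Psi(y)] over the nodes of one level is
    governed by the averages of [(z.x)^n (z.y)^m] and of
    [(z.x)^n (zc.y)^m], where [zc] is the conjugate of [z].  Integrating first
    over the tangent directions and then over the nodes, the exactness of the
    two rules turns these averages into rotation-invariant forms in [x] and
    [y], that is, polynomials in [x.x], [x.y] and [y.y] ([frame_avg_form]).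
    Invariance leaves little room.  Averages of [(z.x)^n (z.y)^m] vanish
    unless [n = m = 0] ([avg_zz_eq0]); averages of [(z.x)^n (zc.y)^m] vanish for [n <> m]
    ([avg_orth]); and for [n = m] the average is harmonic in [y], hence a
    multiple of [Z n (x.y)] ([avg_zonal]).  The multiple is fixed by the value
    at [x = y], which is a moment of the invariant measure, and it cancels the
    constants [A_n] and [dim H_n] of the curvelets.  What remains is
    [kappa^2], and [kappa^2] telescopes over the levels.  The same averages show
    that the zonal polynomials reproduce themselves under convolution
    ([zonal_convolution]).

    The bound.  Summation by parts [d + 1] times writes [V_J] through the
    differences of order [d + 1] of the multiplier [phi(n / 2^J)^2], which are
    of size [2^(-J (d+1))] because [phi] is smooth ([cutoff_fdiff]), and the
    iterated partial sums of [Z n (t)].  The latter are nonnegative on [[-1, 1]]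
    ([iter_psum_zonal_ge0]), so their integrals are computed rather than
    estimated: only the constant term [Z 0] contributes, and there are at most
    [(n+1)^d] copies of it.  This gives a positive majorant of [|V_J|] whose
    integral is bounded independently of [J]; a positive symmetric kernel of
    bounded mass acts boundedly on [L^p] by convexity and Tonelli's theorem. *)

(** * Partial sums and summation by parts *)

Section PartialSums.
Context {R : realType}.
Implicit Types (a b c : nat -> R) (M n : nat).

Definition psum c n : R := \sum_(i < n.+1) c i.

Definition fdiff a n : R := a n - a n.+1.

Lemma psum0 c : psum c 0 = c 0%N.
Proof. by rewrite /psum big_ord_recr big_ord0 /= add0r. Qed.

Lemma psumS c n : psum c n.+1 = psum c n + c n.+1.
Proof. by rewrite /psum big_ord_recr. Qed.

Lemma psum_ge0 c : (forall n, 0 <= c n) -> forall n, 0 <= psum c n.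
Proof. by move=> c0 n; apply: sumr_ge0 => i _. Qed.

Lemma iter_psum_ge0 M c : (forall n, 0 <= c n) -> forall n, 0 <= iter M psum c n.
Proof. by move=> c0; elim: M => //= M IH; exact: psum_ge0. Qed.

Lemma iter_fdiff_zero M a N : (forall n, (N <= n)%N -> a n = 0) ->
  forall n, (N <= n)%N -> iter M fdiff a n = 0.
Proof.
elim: M => //= M IH a0 n Nn; rewrite /fdiff !IH ?subrr //.
exact: leq_trans Nn (leqnSn _).
Qed.

Lemma abel_step a b N : (forall n, (N <= n)%N -> a n = 0) ->
  \sum_(n < N) a n * b n = \sum_(n < N) fdiff a n * psum b n.
Proof.
move=> a0.
have -> : \sum_(n < N) fdiff a n * psum b n =
    \sum_(n < N) a n * b n - a N * psum b N + a N * b N.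
  elim: N {a0} => [|N IH]; first by rewrite !big_ord0 psum0; ring.
  rewrite big_ord_recr IH [X in _ = X - _ + _]big_ord_recr /= psumS /fdiff; ring.
by rewrite a0 //; ring.
Qed.

(** Iterated summation by parts: it rewrites a multiplier sum through the
    Cesaro-type sums of [b], whose sign can be controlled. *)
Lemma abel_iter M a b N : (forall n, (N <= n)%N -> a n = 0) ->
  \sum_(n < N) a n * b n = \sum_(n < N) iter M fdiff a n * iter M psum b n.
Proof.
move=> a0; elim: M => // M ->.
by rewrite abel_step //; exact: iter_fdiff_zero.
Qed.

Definition delta0 n : R := (n == 0%N)%:R.

Lemma iter_psum_delta0 M n : iter M.+1 psum delta0 n <= n.+1%:R ^+ M.
Proof.
elim: M n => [|M IH] n.
  by rewrite /= /psum big_ord_recl big1 ?addr0 ?expr0.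
rewrite [iter M.+2 _ _]/= /psum.
apply: (@le_trans _ _ (\sum_(i < n.+1) n.+1%:R ^+ M)).
  apply: ler_sum => i _; apply: le_trans (IH _) _.
  by apply: lerXn2r; rewrite ?nnegrE ?ler0n // ler_nat.
by rewrite sumr_const card_ord -[X in X <= _]mulr_natl exprS.
Qed.

(** If [c] is the coefficient sequence of a power series F, the hypothesis says
    that F'/F has the coefficients [l]; partial sums multiply F by 1/(1-r),
    hence add 1/(1-r) to F'/F. *)
Lemma psum_log_deriv (l c : nat -> R) :
  (forall n, n%:R * c n = \sum_(k < n) l k * c (n.-1 - k)%N) ->
  forall n, n%:R * psum c n = \sum_(k < n) (l k + 1) * psum c (n.-1 - k)%N.
Proof.
move=> cE; elim=> [|n IH]; first by rewrite mul0r big_ord0.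
rewrite psumS mulrDr cE /= -[in X in X * psum _ _]natr1 mulrDl mul1r IH.
rewrite [in RHS]big_ord_recr /= subnn.
have -> : \sum_(i < n) (l i + 1) * psum c (n - i) =
    \sum_(i < n) (l i + 1) * psum c (n.-1 - i) + \sum_(i < n) (l i + 1) * c (n - i)%N.
  rewrite -big_split; apply: eq_bigr => i _ /=.
  have -> : (n - i)%N = (n.-1 - i).+1 by have := ltn_ord i; lia.
  by rewrite -mulrDr -psumS.
have -> : \sum_(i < n) (l i + 1) * c (n - i)%N =
    \sum_(i < n) l i * c (n - i)%N + \sum_(i < n) c (n - i)%N.
  by rewrite -big_split; apply: eq_bigr => i _; rewrite mulrDl mul1r.
have -> : psum c n = c 0%N + \sum_(i < n) c (n - i)%N.
  rewrite /psum big_ord_recl; congr (_ + _).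
  rewrite (reindex_inj rev_ord_inj) /=.
  by apply: eq_bigr => i _; congr c; rewrite /bump /=; have := ltn_ord i; lia.
by rewrite big_ord_recr /= subnn psum0; ring.
Qed.

Lemma iter_psum_log_deriv M (l c : nat -> R) :
  (forall n, n%:R * c n = \sum_(k < n) l k * c (n.-1 - k)%N) ->
  forall n, n%:R * iter M psum c n =
    \sum_(k < n) (l k + M%:R) * iter M psum c (n.-1 - k)%N.
Proof.
move=> cE; elim: M => [|M IH] n.
  by under eq_bigr do rewrite addr0; exact: cE.
rewrite [iter _ _ _]/= (psum_log_deriv (l := fun k => l k + M%:R) IH); apply: eq_bigr => k _.
by rewrite -addrA natr1.
Qed.

(** The relation determines the coefficients one after the other, by sums of
    products of nonnegative numbers. *)
Lemma log_deriv_ge0 (l c : nat -> R) : 0 <= c 0%N -> (forall k, 0 <= l k) ->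
  (forall n, n%:R * c n = \sum_(k < n) l k * c (n.-1 - k)%N) ->
  forall n, 0 <= c n.
Proof.
move=> c0 l0 cE; elim/ltn_ind => -[//|n] IH.
have : 0 <= n.+1%:R * c n.+1.
  rewrite cE; apply: sumr_ge0 => k _; apply: mulr_ge0 => //.
  by apply: IH => /=; have := ltn_ord k; lia.
by rewrite pmulr_rge0 // ltr0n.
Qed.

Lemma iter_psum_0 M c : iter M psum c 0%N = c 0%N.
Proof. by elim: M => //= M IH; rewrite psum0. Qed.

Lemma psum_shift c n :
  psum (fun m => if m is m'.+1 then c m' else 0) n = if n is n'.+1 then psum c n' else 0.
Proof.
case: n => [|n]; first by rewrite psum0.
by rewrite /psum big_ord_recl add0r; apply: eq_bigr.
Qed.

Lemma psumD a b n : psum (fun m => a m + b m) n = psum a n + psum b n.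
Proof. by rewrite /psum big_split. Qed.

Lemma iter_psumD M a b n :
  iter M psum (fun m => a m + b m) n = iter M psum a n + iter M psum b n.
Proof.
elim: M n => //= M IH n.
by rewrite -psumD; congr (psum _ n); apply: funext => m.
Qed.

Lemma iter_psum_shift M c n :
  iter M psum (fun m => if m is m'.+1 then c m' else 0) n =
  if n is n'.+1 then iter M psum c n' else 0.
Proof.
elim: M n => [|M IH] n /=; first by [].
by rewrite -psum_shift; congr (psum _ n); apply: funext => m.
Qed.

End PartialSums.

(** * Gegenbauer polynomials *)

Section Gegenbauer.
Context {R : realType} (d : nat).
Implicit Types (t D : R) (k i n : nat).

Definition poch n : R := \prod_(j < n) (d%:R / 2 + j%:R).

Lemma poch0 : poch 0 = 1. Proof. by rewrite /poch big_ord0. Qed.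

Lemma pochS n : poch n.+1 = poch n * (d%:R / 2 + n%:R).
Proof. by rewrite /poch big_ord_recr. Qed.

Lemma factSr n : (n.+1)`!%:R = n.+1%:R * n`!%:R :> R.
Proof. by rewrite factS natrM. Qed.

Lemma fact_neq0 n : n`!%:R != 0 :> R.
Proof. by rewrite pnatr_eq0 -lt0n fact_gt0. Qed.

(** The coefficient of [r^(2k+i) t^i] in [(1 - 2rt + r^2)^(-d/2)], the
    generating function of the Gegenbauer polynomials of index [d/2]. *)
Definition geg_coef k i : R := (-1) ^+ k * poch (k + i) * 2 ^+ i / (k`!%:R * i`!%:R).

Lemma geg_coef_rec k i :
  (2 * k%:R + i%:R + 3) * geg_coef k.+1 i.+1 =
  2 * (2 * k%:R + i%:R + 2 + d%:R / 2) * geg_coef k.+1 i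
  - (2 * k%:R + i%:R + 1 + d%:R) * geg_coef k i.+1.
Proof.
rewrite /geg_coef addSnnS !addnS !pochS !exprS !factSr.
have := fact_neq0 k; have := fact_neq0 i.
have := pnatr_eq0 R k.+1; have := pnatr_eq0 R i.+1.
rewrite -[k.+1%:R]natr1 -[i.+1%:R]natr1 -[(k+i).+1%:R]natr1 natrD /=.
move: (poch _) (k`!%:R) (i`!%:R) ((-1)^+k) (2^+i) (d%:R) => P a b c e m /negbT i0 /negbT k0 b0 a0.
field.
by rewrite a0 b0 k0 i0.
Qed.

Lemma geg_coef_rec0 i :
  i.+1%:R * geg_coef 0 i.+1 = 2 * (i%:R + d%:R / 2) * geg_coef 0 i.
Proof.
rewrite /geg_coef !add0n !pochS !exprS !factSr fact0.
have := fact_neq0 i; have := pnatr_eq0 R i.+1.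
rewrite -[i.+1%:R]natr1 /=.
move: (poch _) (i`!%:R) (2^+i) (d%:R) => P b e m /negbT i0 b0.
by field; rewrite b0 i0.
Qed.

Lemma geg_coef_reck k :
  (2 * k%:R + 2) * geg_coef k.+1 0 = - (2 * k%:R + d%:R) * geg_coef k 0.
Proof.
rewrite /geg_coef !addn0 !pochS !exprS !factSr fact0.
have := fact_neq0 k; have := pnatr_eq0 R k.+1.
rewrite -[k.+1%:R]natr1 /=.
move: (poch _) (k`!%:R) ((-1)^+k) (d%:R) => P b e m /negbT i0 b0.
by field; rewrite b0 i0.
Qed.

Definition geg_term t n k : R :=
  if (2 * k <= n)%N then geg_coef k (n - 2 * k) * t ^+ (n - 2 * k) else 0.

Definition geg t n : R := \sum_(k < n.+1) geg_term t n k.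

Lemma geg_term_rec0 t n :
  n.+2%:R * geg_term t n.+2 0 = (2 * n.+1%:R + d%:R) * t * geg_term t n.+1 0.
Proof.
rewrite /geg_term !muln0 /= !subn0 mulrA geg_coef_rec0 exprS; field=> //.
Qed.

Lemma geg_term_rec t n k :
  n.+2%:R * geg_term t n.+2 k.+1 =
  (2 * n.+1%:R + d%:R) * t * geg_term t n.+1 k.+1 - (n%:R + d%:R) * geg_term t n k.
Proof.
rewrite /geg_term mulnS !addSn add0n ltnS ltnS.
have [le_kn|gt_kn] := leqP (2 * k) n; last first.
  have -> : ((2 * k).+1 < n.+1)%N = false by apply/negbTE; lia.
  by rewrite !mulr0 subr0.
have [[i ->]|->] : (exists i, n = 2 * k + i.+1)%N \/ n = (2 * k)%N.
  have [->|nk] := eqVneq n (2 * k)%N; first by right.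
  by left; exists (n - 2 * k).-1; lia.
- have -> : ((2 * k).+1 < (2 * k + i.+1).+1)%N by lia.
  have -> : ((2 * k + i.+1).+2 - (2 * k).+2 = i.+1)%N by lia.
  have -> : ((2 * k + i.+1).+1 - (2 * k).+2 = i)%N by lia.
  have -> : (2 * k + i.+1 - 2 * k = i.+1)%N by lia.
  have E := geg_coef_rec k i.
  have -> : (2 * k + i.+1).+2%:R * (geg_coef k.+1 i.+1 * t ^+ i.+1) =
      ((2 * k%:R + i%:R + 3) * geg_coef k.+1 i.+1) * t ^+ i.+1.
    by rewrite -[(2 * k + i.+1).+2%:R]natr1 -[(2 * k + i.+1).+1%:R]natr1 natrD natrM -[i.+1%:R]natr1; ring.
  by rewrite E -[(2 * k + i.+1).+1%:R]natr1 natrD natrM -[i.+1%:R]natr1 exprS; field.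
- rewrite ltnn mulr0 sub0r !subnn !expr0 !mulr1.
  have E := geg_coef_reck k.
  have -> : (2 * k).+2%:R = 2 * k%:R + 2 :> R.
    by rewrite -[(2 * k).+2%:R]natr1 -[(2 * k).+1%:R]natr1 natrM; ring.
  by rewrite E natrM; ring.
Qed.

Lemma geg_ext t n N : (n < N)%N -> geg t n = \sum_(k < N) geg_term t n k.
Proof.
move=> nN; rewrite /geg (big_ord_widen N (geg_term t n)) // big_mkcond /=.
apply: eq_bigr => k _; case: ifPn => //; rewrite -leqNgt /geg_term => nk.
by case: ifPn => // ?; exfalso; lia.
Qed.

Lemma geg0 t : geg t 0 = 1.
Proof.
rewrite /geg big_ord_recr big_ord0 /= add0r /geg_term /= /geg_coef /=.
by rewrite poch0 !fact0 !expr0; field.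
Qed.

Lemma geg1 t : geg t 1 = d%:R * t.
Proof.
rewrite /geg 2!big_ord_recr big_ord0 /= add0r /geg_term /= /geg_coef /=.
by rewrite /= muln0 subn0 add0n addr0 pochS poch0 factS !fact0 expr0 !expr1 /=; field.
Qed.

Lemma geg_rec t n :
  n.+2%:R * geg t n.+2 =
  (2 * n.+1%:R + d%:R) * t * geg t n.+1 - (n%:R + d%:R) * geg t n.
Proof.
have E1 : geg t n.+1 = \sum_(k < n.+4) geg_term t n.+1 k by apply: geg_ext; lia.
have E2 : geg t n.+2 = \sum_(k < n.+4) geg_term t n.+2 k by apply: geg_ext.
rewrite E1 E2.
rewrite big_ord_recl [in RHS]big_ord_recl !mulrDr geg_term_rec0 -addrA.
congr (_ + _).
have E3 : geg t n = \sum_(k < n.+3) geg_term t n k by apply: geg_ext; lia.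
rewrite E3 !mulr_sumr -sumrB.
by apply: eq_bigr => k _; rewrite lift0 geg_term_rec.
Qed.

(** The logarithmic derivative of [(1 - 2rt + r^2)^(-d/2)] in [r] has the
    coefficients [d T_{k+1}(t)], where [T_k(cos u) = cos (k u)]. *)
Lemma geg_log_deriv t : -1 <= t <= 1 -> forall n,
  n%:R * geg t n = \sum_(k < n) d%:R * cos (k.+1%:R * acos t) * geg t (n.-1 - k).
Proof.
move=> t1.
pose T k : R := cos (k%:R * acos t).
have T0 : T 0%N = 1 by rewrite /T mul0r cos0.
have T1 : T 1%N = t by rewrite /T mul1r acosK // in_itv.
have TS k : T k.+2 = 2 * t * T k.+1 - T k.
  have -> : T k = cos (k.+1%:R * acos t - acos t) by rewrite /T -natr1; congr cos; ring.
  have -> : T k.+2 = cos (k.+1%:R * acos t + acos t) by rewrite /T -!natr1; congr cos; ring.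
  have -> : 2 * t = 2 * cos (acos t) by rewrite acosK // in_itv.
  by rewrite cosD cosB /T; ring.
pose S n := \sum_(k < n) T k.+1 * geg t (n.-1 - k).
have SS n : S n.+2 = 2 * t * S n.+1 - S n + t * geg t n.+1 - geg t n.
  rewrite /S big_ord_recl [X in _ + X]big_ord_recl [in 2 * t * _]big_ord_recl /=.
  rewrite subn0 subn1 /= T1 TS T1 T0.
  have -> : \sum_(i < n) T (bump 0 (bump 0 i)).+1 * geg t (n.+1 - bump 0 (bump 0 i)) =
      2 * t * (\sum_(i < n) T (bump 0 i).+1 * geg t (n - bump 0 i)) -
      \sum_(i < n) T i.+1 * geg t (n.-1 - i).
    rewrite mulr_sumr -sumrB; apply: eq_bigr => i _.
    rewrite /bump /= !add1n TS.
    have -> : (n.+1 - i.+2 = n.-1 - i)%N by lia.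
    have -> : (n - i.+1 = n.-1 - i)%N by lia.
    ring.
  rewrite subn0; ring.
have main n : n%:R * geg t n = d%:R * S n.
  elim/ltn_ind: n => -[_|[_|n IH]].
  - by rewrite mul0r /S big_ord0 mulr0.
  - by rewrite geg1 /S big_ord_recr big_ord0 /= geg0 T1; ring.
  rewrite geg_rec SS.
  have := IH n.+1 (ltnSn _); have := IH n (leqnSn _).
  rewrite -!natr1 => E0 E1.
  have E0' : n%:R * geg t n = d%:R * S n by [].
  transitivity (2 * t * ((n%:R + 1) * geg t n.+1) - n%:R * geg t n
    + d%:R * (t * geg t n.+1 - geg t n)); first by ring.
  rewrite E0 E1; ring.
move=> n; rewrite main /S mulr_sumr; apply: eq_bigr => k _.
by rewrite mulrA.
Qed.

(** Positivity of the Cesaro sums: multiplying [(1 - 2rt + r^2)^(-d/2)] by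
    [(1 - r)^(-d)] turns [d cos(k u)] into [d (1 + cos(k u)) >= 0]. *)
Lemma iter_psum_geg_ge0 t n : -1 <= t <= 1 -> 0 <= iter d psum (geg t) n.
Proof.
move=> t1.
have E := iter_psum_log_deriv d (l := fun k => d%:R * cos (k.+1%:R * acos t))
  (geg_log_deriv t1).
apply: (log_deriv_ge0 (l := fun k => d%:R * cos (k.+1%:R * acos t) + d%:R)) E _.
- by rewrite iter_psum_0 geg0.
- move=> k; rewrite -[X in _ + X]mulr1 -mulrDr mulr_ge0 ?ler0n //.
Qed.

(** Coefficient of [t^i] in the zonal harmonic of degree [2k+i]; the zonal
    harmonics have the generating function
    [(1 - r^2) (1 - 2rt + r^2)^(-d/2)], the Poisson kernel. *)
Definition zonal_coef k i : R :=
  geg_coef k i - (if k is k'.+1 then geg_coef k' i else 0).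

Definition zonal n t : R :=
  \sum_(k < n.+1 | (2 * k <= n)%N) zonal_coef k (n - 2 * k) * t ^+ (n - 2 * k).

Lemma zonal_geg n t :
  zonal n t = geg t n - (if n is m.+2 then geg t m else 0).
Proof.
rewrite /zonal big_mkcond /=.
have E : \sum_(k < n.+1) geg_term t n k = geg t n by [].
case: n E => [|[|n]] E.
- rewrite subr0 -E; apply: eq_bigr => -[[|k] hk] _ //=.
  by rewrite /geg_term /= /zonal_coef subr0.
- rewrite subr0 -E; apply: eq_bigr => -[[|[|k]] hk] _ //=.
  by rewrite /geg_term /= /zonal_coef subr0.
rewrite (@geg_ext t n n.+2) // -E big_ord_recl [in RHS]big_ord_recl.
rewrite -addrA -sumrB; congr (_ + _).
  by rewrite /geg_term /= /zonal_coef subr0.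
apply: eq_bigr => k _; rewrite /geg_term /= /bump /= add1n.
rewrite mulnS !addSn add0n !ltnS subSS subSS.
by case: ifP => _; rewrite ?subrr //= mulrBl.
Qed.

Lemma zonal_coef_lead n : zonal_coef 0 n = poch n * 2 ^+ n / n`!%:R.
Proof. by rewrite /zonal_coef subr0 /geg_coef fact0 expr0 mul1r !mul1r. Qed.

Lemma zonal_coefE k i : zonal_coef k.+1 i =
  (-1) ^+ k.+1 * poch (k + i) * (d%:R / 2 + 2 * k%:R + i%:R + 1) * 2 ^+ i
  / (k.+1`!%:R * i`!%:R).
Proof.
rewrite /zonal_coef /geg_coef addSn pochS exprS !factSr.
have := fact_neq0 k; have := fact_neq0 i; have := pnatr_eq0 R k.+1.
rewrite -[k.+1%:R]natr1 natrD /=.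
move: (poch _) (k`!%:R) (i`!%:R) ((-1)^+k) (2^+i) (d%:R) => P b b' e e' m /negbT i0 b0 b0'.
by field; rewrite b0 b0' i0.
Qed.

(** The recursion that makes the homogeneous extension harmonic. *)
Lemma zonal_coef_rec k i :
  zonal_coef k.+1 i * ((2 * k%:R + 2) * (2 * k%:R + 2 * i%:R + d%:R)) =
  - ((i%:R + 2) * (i%:R + 1)) * zonal_coef k i.+2.
Proof.
case: k => [|k].
  rewrite zonal_coefE zonal_coef_lead /= !add0n !pochS expr1 !exprS !factSr fact0.
  have := fact_neq0 i; have := pnatr_eq0 R i.+1; have := pnatr_eq0 R i.+2.
  rewrite -[i.+2%:R]natr1 -[i.+1%:R]natr1 /=.
  move: (poch _) (i`!%:R) (2^+i) (d%:R) => P b e m /negbT i1 /negbT i0 b0.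
  by field; rewrite ?b0 ?i0 // -addrA.
rewrite !zonal_coefE !addnS !addSn !pochS !exprS !factSr.
have := fact_neq0 k; have := fact_neq0 i; have := pnatr_eq0 R k.+1; have := pnatr_eq0 R k.+2.
have := pnatr_eq0 R i.+1; have := pnatr_eq0 R i.+2.
rewrite -[k.+2%:R]natr1 -[k.+1%:R]natr1 -[i.+2%:R]natr1 -[i.+1%:R]natr1 -[(k + i).+1%:R]natr1 natrD /=.
move: (poch _) (k`!%:R) (i`!%:R) ((-1)^+k) (2^+i) (d%:R) => P b b' e e' m.
move=> /negbT i1 /negbT i0 /negbT k1 /negbT k0 b0 b0'.
field.
rewrite b0 b0' i0 k0 /=; move: i1 k1; by rewrite -!addrA => -> ->.
Qed.

Lemma geg_at1 n : (0 < d)%N ->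
  geg 1 n * (n`!%:R * d.-1`!%:R) = (n + d.-1)`!%:R.
Proof.
move=> d0; set e := d.-1.
have de : d%:R = e%:R + 1 :> R by rewrite natr1 /e prednK.
elim/ltn_ind: n => -[_|[_|n IH]].
- by rewrite geg0 fact0 !mul1r.
- by rewrite geg1 mulr1 add1n !factSr fact0 de -natr1; ring.
have G := geg_rec 1 n.
have I1 := IH n.+1 (ltnSn _); have I0 := IH n (leqnSn _).
rewrite [n.+2`!%:R]factSr.
transitivity ((n.+2%:R * geg 1 n.+2) * (n.+1`!%:R * e`!%:R)); first by ring.
rewrite G mulr1 mulrBl.
have -> : (n%:R + d%:R) * geg 1 n * (n.+1`!%:R * e`!%:R) =
  (n%:R + d%:R) * n.+1%:R * (geg 1 n * (n`!%:R * e`!%:R)) by rewrite factSr; ring.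
have -> : (2 * n.+1%:R + d%:R) * geg 1 n.+1 * (n.+1`!%:R * e`!%:R) =
  (2 * n.+1%:R + d%:R) * (geg 1 n.+1 * (n.+1`!%:R * e`!%:R)) by ring.
rewrite I0 I1 !addSn !factSr -[(n+e).+2%:R]natr1 -[(n+e).+1%:R]natr1 natrD -[n.+1%:R]natr1 de.
ring.
Qed.

(** At [t = 1] the generating function is [(1 - r^2) (1 - r)^(-d)], so the
    values are differences of two binomial coefficients. *)
Lemma zonal_at1 n : (3 <= d)%N -> zonal n 1 = dimH R d n.
Proof.
move=> d3; rewrite zonal_geg /dimH.
have d0 : (0 < d)%N by lia.
have fE m : geg 1 m = (m + d.-1)`!%:R / (m`!%:R * d.-1`!%:R).
  by rewrite -(geg_at1 m d0) mulfK // mulf_neq0 // fact_neq0.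
case: n => [|[|n]].
- rewrite subr0 geg0 muln0 !add0n fact0 muln1.
  have -> : (d - 2)`! = ((d - 2) * (d - 3)`!)%N.
    by have -> : (d - 2 = (d - 3).+1)%N by lia; rewrite factS.
  rewrite divff // pnatr_eq0 -lt0n muln_gt0 fact_gt0 andbT; lia.
- rewrite subr0 geg1 mulr1 muln1 factS fact0 muln1.
  have -> : (1 + d - 3 = d - 2)%N by lia.
  have -> : (2 + d - 2 = d)%N by lia.
  by rewrite muln1 natrM mulfK // fact_neq0.
rewrite !fE.
have [e de] : exists e, d = e.+3 by exists (d - 3)%N; lia.
rewrite de /=.
have -> : (2 * n.+2 + e.+3 - 2 = 2 * n.+2 + e.+1)%N by lia.
have -> : (n.+2 + e.+3 - 3 = (n + e).+2)%N by lia.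
have -> : (e.+3 - 2 = e.+1)%N by lia.
rewrite (natrM R (2 * n.+2 + e.+1)) (natrM R e.+1`!) natrD natrM.
rewrite !addSn !addnS !factSr.
have := fact_neq0 n; have := fact_neq0 e.
have := pnatr_eq0 R e.+2; have := pnatr_eq0 R e.+1.
have := pnatr_eq0 R n.+1; have := pnatr_eq0 R n.+2.
rewrite -[(n + e).+4%:R]natr1 -[(n + e).+3%:R]natr1 -[(n+e).+2%:R]natr1 -[(n+e).+1%:R]natr1 natrD.
rewrite -[n.+2%:R]natr1 -[n.+1%:R]natr1 -[e.+2%:R]natr1 -[e.+1%:R]natr1 /=.
move: (n`!%:R) (e`!%:R) ((n+e)`!%:R) => a b c /negbT n2 /negbT n1 /negbT e1 /negbT e2 b0 a0.
by field; rewrite a0 b0 n1 e1 /=; move: n2 e2; rewrite -!addrA => ->.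
Qed.

(** One more partial sum than for [geg] absorbs the factor [1 - r^2]. *)
Lemma iter_psum_zonal_ge0 t n : -1 <= t <= 1 ->
  0 <= iter d.+1 psum (zonal^~ t) n.
Proof.
move=> t1.
pose b m : R := geg t m + (if m is m'.+1 then geg t m' else 0).
have E m : psum (zonal^~ t) m = b m.
  elim: m => [|m IH]; first by rewrite psum0 zonal_geg /b subr0 addr0.
  by rewrite psumS IH zonal_geg /b; case: m {IH} => [|m]; ring.
rewrite iterSr (_ : psum _ = b); last exact/funext.
rewrite iter_psumD (iter_psum_shift d (geg t)) addr_ge0 //.
  exact: iter_psum_geg_ge0.
by case: n => // n; exact: iter_psum_geg_ge0.
Qed.

End Gegenbauer.

(** * Finite differences of the cutoff *)

Section CutoffDifferences.
Context {R : realType}.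
Implicit Types (f g : R -> R) (n m : nat) (t h : R).

Lemma near_derive1n f g t : (\forall x \near t, f x = g x) ->
  forall n, \forall x \near t, derive1n n f x = derive1n n g x.
Proof.
move=> fg; elim=> [//|n IH].
have : \forall x \near t, \forall y \near x, derive1n n f y = derive1n n g y.
  by move/nbhs_interior : IH.
apply: filterS => x fgx; rewrite !derive1nS !derive1E.
exact: near_eq_derive.
Qed.

Lemma near_derivable f g t : (\forall x \near t, f x = g x) ->
  derivable f t 1 -> derivable g t 1.
Proof.
by move=> fg df; have := near_eq_is_derive fg (derivableP df) => -[].
Qed.

Definition smooth_upto n f :=
  forall k t, (k <= n)%N -> 0 < t -> derivable (derive1n k f) t 1.

Lemma pos_near t (P : R -> Prop) : 0 < t -> (forall x, 0 < x -> P x) ->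
  \forall x \near t, P x.
Proof. by move=> t0 Px; near=> x; apply: Px; near: x; exact: lt_nbhsr. Unshelve. all: by end_near. Qed.

Lemma smooth_upto_deriv n f : smooth_upto n.+1 f -> smooth_upto n (derive1 f).
Proof. by move=> sf k t kn t0; have := sf k.+1 t kn t0; rewrite /derive1n iterSr. Qed.

Lemma smooth_uptoW n f : smooth_upto n.+1 f -> smooth_upto n f.
Proof. by move=> sf k t kn t0; apply: sf => //; exact: leqW. Qed.

Lemma smooth_upto_ext n f g : (forall t, 0 < t -> f t = g t) ->
  smooth_upto n f -> smooth_upto n g.
Proof.
move=> fg sf k t kn t0; apply: near_derivable (sf k t kn t0).
by apply: near_derive1n; exact: pos_near.
Qed.

Lemma smooth_uptoS n f (f' : R -> R) :
  (forall t, 0 < t -> is_derive t 1 f (f' t)) -> smooth_upto n f' -> smooth_upto n.+1 f.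
Proof.
move=> df sf' [|k] t kn t0; first by have [] := df t t0.
rewrite /derive1n iterSr; apply: (smooth_upto_ext _ sf') => // x x0.
by rewrite derive1E; have [_ ->] := df x x0.
Qed.

Lemma smooth_upto_is_derive n f t : smooth_upto n f -> 0 < t ->
  is_derive t 1 f (derive1 f t).
Proof. by move=> sf t0; rewrite derive1E; apply: derivableP; exact: (sf 0%N). Qed.

Lemma smooth_uptoD n f g : smooth_upto n f -> smooth_upto n g -> smooth_upto n (f + g).
Proof.
elim: n f g => [|n IH] f g sf sg.
  by case=> // t _ t0; apply: derivableD; [exact: (sf 0%N)|exact: (sg 0%N)].
apply: (@smooth_uptoS _ _ (derive1 f + derive1 g)) => [t t0|].
  exact: is_deriveD (smooth_upto_is_derive sf t0) (smooth_upto_is_derive sg t0).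
by apply: IH; exact: smooth_upto_deriv.
Qed.

Lemma smooth_uptoM n f g : smooth_upto n f -> smooth_upto n g -> smooth_upto n (f * g).
Proof.
elim: n f g => [|n IH] f g sf sg.
  by case=> // t _ t0; apply: derivableM; [exact: (sf 0%N)|exact: (sg 0%N)].
apply: (@smooth_uptoS _ _ (f * derive1 g + g * derive1 f)) => [t t0|].
  exact: is_deriveM (smooth_upto_is_derive sf t0) (smooth_upto_is_derive sg t0).
apply: smooth_uptoD.
  exact: IH (smooth_uptoW sf) (smooth_upto_deriv sg).
exact: IH (smooth_uptoW sg) (smooth_upto_deriv sf).
Qed.

Lemma derive1n_cst n (c : R) : derive1n n.+1 (cst c) = cst 0 :> (R -> R).
Proof.
elim: n => [|n IH]; first by apply/funext => x; rewrite derive1nS /= derive1_cst.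
by rewrite derive1nS IH; apply/funext => x; rewrite derive1_cst.
Qed.

Lemma derivable_derive1n_cst n (c : R) t : derivable (derive1n n (cst c)) t 1.
Proof. by case: n => [|n]; rewrite ?derive1n_cst; exact: derivable_cst. Qed.

Definition fwd_diff h g : R -> R := fun t => g t - g (t + h).

Lemma iter_fdiff_sample M h g k :
  iter M fdiff (fun n => g (n%:R * h)) k = iter M (fwd_diff h) g (k%:R * h).
Proof.
elim: M k => [//|M IH] k; rewrite !iterS {1}/fdiff !IH.
by rewrite [RHS]/fwd_diff -natr1 mulrDl mul1r.
Qed.

Lemma is_derive_fwd_diff h g : (forall t, derivable g t 1) ->
  forall t, is_derive t 1 (fwd_diff h g) (fwd_diff h (derive1 g) t).
Proof.
move=> dg t; rewrite /fwd_diff !derive1E.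
have D1 : is_derive t 1 g ('D_1 g t) by exact/derivableP.
have D2 : is_derive t 1 (fun x => g (x + h)) ('D_1 g (t + h)).
  have ds : is_derive t 1 (fun x : R => x + h) 1.
    by rewrite -[X in is_derive _ _ _ X]addr0; exact: is_deriveD.
  have := @is_derive1_comp R g (fun x => x + h) t ('D_1 g (t + h)) 1.
  by rewrite mulr1; apply=> //; exact/derivableP.
exact: is_deriveB.
Qed.

Definition smooth_everywhere g := forall n t, derivable (derive1n n g) t 1.

Lemma derive1n_fwd_diff h g : smooth_everywhere g ->
  forall n, derive1n n (fwd_diff h g) = fwd_diff h (derive1n n g).
Proof.
move=> sg; elim=> [//|n IH]; rewrite !derive1nS IH; apply/funext => t.
by rewrite derive1E; have [_ ->] := is_derive_fwd_diff h (sg n) t.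
Qed.

Lemma smooth_fwd_diff h g : smooth_everywhere g -> smooth_everywhere (fwd_diff h g).
Proof.
move=> sg n t; rewrite derive1n_fwd_diff //.
by have [] := is_derive_fwd_diff h (sg n) t.
Qed.

Lemma fwd_diff_bound h g (B : R) : 0 < h -> (forall t, derivable g t 1) ->
  (forall t, `|derive1 g t| <= B) -> forall t, `|fwd_diff h g t| <= B * h.
Proof.
move=> h0 dg gB t; rewrite /fwd_diff distrC.
have [|x _||c _ ->] := @MVT R g (derive1 g) t (t + h).
- by rewrite ltrDl.
- by rewrite derive1E; exact/derivableP.
- by apply: derivable_within_continuous => x _; exact: dg.
by rewrite addrAC subrr add0r normrM (gtr0_norm h0) ler_wpM2r // ltW.
Qed.

Lemma iter_fwd_diff_bound M h g (B : R) : 0 < h -> smooth_everywhere g ->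
  (forall t, `|derive1n M g t| <= B) ->
  forall t, `|iter M (fwd_diff h) g t| <= B * h ^+ M.
Proof.
move=> h0; elim: M g B => [|M IH] g B sg gB t; first by rewrite expr0 mulr1; exact: gB.
rewrite iterSr exprS mulrA; apply: IH; first exact: smooth_fwd_diff.
move=> x; rewrite derive1n_fwd_diff //; apply: fwd_diff_bound => // y.
Qed.

(** [phi^2] continued by 1 to the left of [0, 1/2], where it is 1; the values
    at [t >= 0] are unchanged and the function is smooth on the whole line. *)
Definition sqr_ext (phi : R -> R) : R -> R :=
  fun t => if t <= 4^-1 then 1 else phi t ^+ 2.

Lemma sqr_extE phi t : cutoff phi -> 0 <= t -> sqr_ext phi t = phi t ^+ 2.
Proof.
move=> [_ _ phi1 _] t0; rewrite /sqr_ext; case: ifPn => // t4.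
by rewrite phi1 ?expr1n // t0 /=; lra.
Qed.

Lemma near_sqr_ext_left phi t : cutoff phi -> t < 2^-1 ->
  \forall x \near t, cst (1 : R) x = sqr_ext phi x.
Proof.
move=> [_ _ phi1 _] t2; near=> x.
rewrite /sqr_ext; case: ifPn => //; rewrite -ltNge => x4.
rewrite phi1 ?expr1n //; apply/andP; split; first by lra.
by apply/ltW; near: x; exact: lt_nbhsl.
Unshelve. all: by end_near. Qed.

Lemma near_sqr_ext_right phi t : cutoff phi -> 1 < t ->
  \forall x \near t, cst (0 : R) x = sqr_ext phi x.
Proof.
move=> [_ _ _ phi0] t1; near=> x.
have x1 : 1 < x by near: x; exact: lt_nbhsr.
rewrite /sqr_ext ifF; last by apply/negbTE; rewrite -ltNge; lra.
by rewrite phi0 ?expr0n // ltW.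
Unshelve. all: by end_near. Qed.

Lemma smooth_sqr_ext phi : cutoff phi -> smooth_everywhere (sqr_ext phi).
Proof.
move=> cphi n t; have [t0|t0] := ltP 0 t; last first.
  have t2 : t < 2^-1 by lra.
  have H := near_derive1n (near_sqr_ext_left cphi t2) n.
  exact: near_derivable H (@derivable_derive1n_cst n 1 t).
have sphi : smooth_upto n phi.
  by move=> k x _ x0; have [[+ _ _] _ _ _] := cphi; exact.
apply: (@smooth_upto_ext n (phi * phi)) (leqnn n) t0; last exact: smooth_uptoM.
by move=> x x0; rewrite sqr_extE ?ltW // expr2.
Qed.

(** The derivatives vanish outside the compact interval [[1/2, 1]]. *)
Lemma derive1n_sqr_ext_bounded phi n : cutoff phi ->
  exists2 B : R, 0 < B & forall t, `|derive1n n.+1 (sqr_ext phi) t| <= B.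
Proof.
move=> cphi; set g := derive1n _ _.
have cg : {within `[0, 2], continuous (fun t => `|g t|)}.
  apply: continuous_in_subspaceT => t _.
  apply: (@continuous_comp _ _ _ g (fun x : R => `|x|)); last exact: norm_continuous.
  by apply/differentiable_continuous/derivable1_diffP; exact: smooth_sqr_ext.
have [|c _ gc] := EVT_max _ cg; first by rewrite ler0n.
exists (`|g c| + 1); first by rewrite ltr_wpDl.
move=> t; have [t2|t2] := ltP t 2^-1.
  have := nbhs_singleton (near_derive1n (near_sqr_ext_left cphi t2) n.+1).
  by rewrite derive1n_cst /g => <-; rewrite normr0 addr_ge0.
have [t1|t1] := ltP 1 t.
  have := nbhs_singleton (near_derive1n (near_sqr_ext_right cphi t1) n.+1).
  by rewrite derive1n_cst /g => <-; rewrite normr0 addr_ge0.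
rewrite (le_trans (gc t _)) ?lerDl // in_itv /=; lra.
Qed.

(** Each difference with step [1/N] costs one derivative and gains a factor
    [1/N], by the mean value theorem. *)
Lemma cutoff_fdiff phi M : cutoff phi -> exists2 B : R, 0 < B &
  forall (N : nat) k, (0 < N)%N ->
    `|iter M.+1 fdiff (fun n => phi (n%:R / N%:R) ^+ 2) k| <= B / N%:R ^+ M.+1.
Proof.
move=> cphi; have [B B0 gB] := derive1n_sqr_ext_bounded M cphi.
exists B => // N k N0.
have -> : (fun n : nat => phi (n%:R / N%:R) ^+ 2) =
    (fun n : nat => sqr_ext phi (n%:R * N%:R^-1)).
  by apply/funext => n; rewrite sqr_extE // divr_ge0.
rewrite iter_fdiff_sample -exprVn; apply: iter_fwd_diff_bound => //.
  by rewrite invr_gt0 ltr0n.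
exact: smooth_sqr_ext.
Qed.

End CutoffDifferences.

(** * The Gamma function at half-integers *)

Section GammaFunction.
Context {R : realType}.
Implicit Types (a t : R).
Notation leb := (@lebesgue_measure R).

Definition gam_integrand a t : R := t `^ a * expR (- t).

(** The value of Gamma at [a + 1], as an extended real. *)
Definition egamma a : \bar R := (\int[leb]_(t in `]0%R, +oo[) (gam_integrand a t)%:E)%E.

Lemma gam_integrand_ge0 a t : 0 <= gam_integrand a t.
Proof. by rewrite mulr_ge0 ?powR_ge0 ?expR_ge0. Qed.

Lemma egamma_ge0 a : (0 <= egamma a)%E.
Proof. by apply: integral_ge0 => t _; rewrite lee_fin gam_integrand_ge0. Qed.

Lemma GammaE a : Gamma (a + 1) = fine (egamma a).
Proof.
rewrite /Gamma /Rintegral; congr fine; apply: eq_integral => t _.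
by rewrite addrK.
Qed.

Lemma is_derive_expRN t : is_derive t 1 (fun x : R => expR (- x)) (- expR (- t)).
Proof.
have dn : is_derive t 1 (fun x : R => - x) (-1) by exact: is_deriveN.
have := @is_derive1_comp R expR (fun x => - x) t (expR (- t)) (-1).
by rewrite mulrN1; apply => //; exact: is_derive_expR.
Qed.

Lemma is_derive_gam a t : 0 < t ->
  is_derive t 1 (gam_integrand a)
    (a * gam_integrand (a - 1) t - gam_integrand a t).
Proof.
move=> t0.
have := is_deriveM (is_derive1_powR a t0) (is_derive_expRN t).
have -> : t `^ a *: - expR (- t) + expR (- t) *: (a * t `^ (a - 1)) =
  a * gam_integrand (a - 1) t - gam_integrand a t.
  by rewrite /gam_integrand /GRing.scale /=; ring.
by [].
Qed.

Lemma cvg_powR0r a : 0 <= a -> (t `^ a @[t --> 0^'+]) --> (0 `^ a : R).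
Proof.
rewrite le_eqVlt => /orP[/eqP <-|a0].
  rewrite powRr0; apply: cvg_near_cst.
  by near=> t; rewrite powRr0.
by rewrite powR0 ?gt_eqF //; exact: powR_cvg0.
Unshelve. all: by end_near. Qed.

Lemma cvg_gam0 a : 0 <= a ->
  gam_integrand a t @[t --> 0^'+] --> gam_integrand a 0.
Proof.
move=> a0; apply: cvgM; first exact: cvg_powR0r.
apply: cvg_at_right_filter.
apply: (@continuous_comp _ _ _ (fun x : R => - x) expR).
  exact: oppr_continuous.
exact: continuous_expR.
Qed.

Lemma within_continuous_gam a : 0 <= a ->
  {within `[0, +oo[, continuous (gam_integrand a)}.
Proof.
move=> a0; apply/continuous_within_itvcyP; split; last exact: cvg_gam0.
move=> t; rewrite in_itv /= andbT => t0.
apply/differentiable_continuous/derivable1_diffP.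
by have [] := is_derive_gam a t0.
Qed.

Lemma cvg_gam_pinfty a : gam_integrand a t @[t --> +oo%R] --> (0 : R).
Proof.
pose n := (Num.truncn `|a|).+1.
have an : a <= n%:R.
  by rewrite (le_trans (ler_norm a)) // ltW // truncnS_gt.
have cinv : n.+1`!%:R * t^-1 @[t --> +oo%R] --> (0 : R).
  rewrite -[X in _ --> X](mulr0 (n.+1`!%:R)); apply: cvgM; first exact: cvg_cst.
  by apply/gtr0_cvgV0; [exact: nbhs_pinfty_gt|exact: cvg_id].
apply: (squeeze_cvgr _ (cvg_cst 0) cinv).
near=> t; rewrite gam_integrand_ge0 /=.
have t1 : 1 <= t by near: t; exact: nbhs_pinfty_ge.
have t0 : 0 < t by exact: lt_le_trans t1.
apply: (@le_trans _ _ (t ^+ n * expR (- t))).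
  by rewrite ler_wpM2r ?expR_ge0 // -powR_mulrn ?(ltW t0) // ler_powR.
rewrite expRN ler_pdivrMr ?expR_gt0 // mulrAC ler_pdivlMr // -exprSr.
have := expR_ge1Dxn n (ltW t0).
rewrite -(@ler_pM2l _ (n.+1`!%:R)); last by rewrite ltr0n fact_gt0.
apply: le_trans; rewrite mulrDr mulrCA mulfV ?mulr1 ?pnatr_eq0 -?lt0n ?fact_gt0 //.
by rewrite lerDr.
Unshelve. all: by end_near. Qed.

Lemma measurable_gam a : measurable_fun [set: R] (gam_integrand a).
Proof.
apply: measurable_funM; first exact: measurable_powR.
by apply: measurableT_comp; [exact: measurable_expR|exact: oppr_measurable].
Qed.

Lemma egamma_closed a : egamma a = (\int[leb]_(t in `[0%R, +oo[) (gam_integrand a t)%:E)%E.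
Proof.
rewrite /egamma integral_itv_obnd_cbnd //.
apply/measurable_EFinP; apply: measurable_funTS; exact: measurable_gam.
Qed.

Lemma egamma0 : egamma 0 = 1%E.
Proof.
rewrite egamma_closed.
rewrite (@ge0_continuous_FTC2y _ _ (fun t => - gam_integrand 0 t) 0 0).
- by rewrite sub0e /gam_integrand powRr0 oppr0 expR0 mul1r -EFinN opprK.
- by move=> t _; exact: gam_integrand_ge0.
- exact: within_continuous_gam.
- by rewrite -oppr0; apply: cvgN; exact: cvg_gam_pinfty.
- move=> t t0; apply: derivableN; by have [] := is_derive_gam 0 t0.
- by apply: cvgN; exact: cvg_gam0.
- move=> t; rewrite in_itv /= andbT => t0; rewrite derive1E.
  have D := is_derive_gam 0 t0; rewrite deriveN; last by case: D.
  by case: D => _ ->; rewrite mul0r sub0r opprK.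
Qed.

(** Integration by parts.  The constant multiple of [expR (- t)] makes the
    derivative of the boundary term nonnegative, so that everything takes
    place among integrals of nonnegative functions. *)
Lemma egamma_rec a : 0 <= a -> egamma (a + 1) = ((a + 1)%:E * egamma a)%E.
Proof.
move=> a0; set s := a + 1; have s0 : 0 < s by rewrite ltr_wpDl.
pose K : R := s * s `^ a.
have K0 : 0 <= K by rewrite mulr_ge0 ?powR_ge0 // ltW.
pose f t : R := gam_integrand s t - s * gam_integrand a t + K * gam_integrand 0 t.
have f0 t : 0 <= t -> 0 <= f t.
  move=> t0; rewrite /f /gam_integrand powRr0 mul1r !mulrA -mulrBl -mulrDl.
  rewrite mulr_ge0 ?expR_ge0 //.
  have -> : t `^ s = t * t `^ a.
    by rewrite -[a](addrK 1) -/s mulr_powRB1.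
  rewrite -mulrBl; have [st|/ltW ts] := leP s t.
    by rewrite addr_ge0 // mulr_ge0 ?powR_ge0 // subr_ge0.
  rewrite addrC -opprB mulNr subr_ge0 /K.
  apply: ler_pM; rewrite ?powR_ge0 ?subr_ge0 //; first by rewrite lerBlDr lerDl.
  by apply: ge0_ler_powR => //; rewrite nnegrE // ltW.
have If : (\int[leb]_(t in `[0%R, +oo[) (f t)%:E = K%:E)%E.
  rewrite (@ge0_continuous_FTC2y _ _ (fun t => - gam_integrand s t - K * gam_integrand 0 t) 0 0).
  - rewrite sub0e /gam_integrand powRr0 powR0 ?gt_eqF // mul0r oppr0 expR0 !mulr1.
    by rewrite sub0r -EFinN opprK.
  - exact: f0.
  - apply/continuous_within_itvcyP; split; last first.
      apply: cvgD; [apply: cvgB|]; [|apply: cvgM; [exact: cvg_cst|]..];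
        by apply: cvg_gam0; rewrite // ltW.
    move=> t; rewrite in_itv /= andbT => t0.
    have c b : {for t, continuous (gam_integrand b)}.
      by apply/differentiable_continuous/derivable1_diffP; have [] := is_derive_gam b t0.
    apply: cvgD; [apply: cvgB|]; [|apply: cvgM; [exact: cvg_cst|]..]; exact: c.
  - have -> : 0 = - 0 - K * 0 :> R by rewrite mulr0 subr0 oppr0.
    apply: cvgB; first by apply: cvgN; exact: cvg_gam_pinfty.
    by apply: cvgM; [exact: cvg_cst|exact: cvg_gam_pinfty].
  - move=> t t0; apply: derivableB.
      by apply: derivableN; have [] := is_derive_gam s t0.
    by apply: derivableM; [exact: derivable_cst|have [] := is_derive_gam 0 t0].
  - apply: cvgB; first by apply: cvgN; apply: cvg_gam0; rewrite ltW.
    by apply: cvgM; [exact: cvg_cst|exact: cvg_gam0].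
  - move=> t; rewrite in_itv /= andbT => t0; rewrite derive1E.
    have Ds : is_derive t 1 (- gam_integrand s) (- (s * gam_integrand a t - gam_integrand s t)).
      by have := is_deriveN (is_derive_gam s t0); rewrite /s addrK.
    have D0 : is_derive t 1 (cst K * gam_integrand 0) (- (K * gam_integrand 0 t)).
      have := is_deriveM (is_derive_cst K t 1) (is_derive_gam 0 t0).
      have -> : cst K t *: (0 * gam_integrand (0 - 1) t - gam_integrand 0 t) +
          gam_integrand 0 t *: (0 : R) = - (K * gam_integrand 0 t).
        by rewrite /GRing.scale /=; ring.
      by [].
    have [_ E] := is_deriveB Ds D0.
    by rewrite [LHS]E /f; ring.
have mg b : measurable_fun (`[0, +oo[ : set R) (fun t => (gam_integrand b t)%:E).
  by apply/measurable_EFinP; apply: measurable_funTS; exact: measurable_gam.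
have mg' b c : measurable_fun (`[0, +oo[ : set R) (fun t => (c * gam_integrand b t)%:E).
  by apply/measurable_EFinP; apply: measurable_funM => //; apply: measurable_funTS; exact: measurable_gam.
have ge0 (c b : R) (D : set R) : 0 <= c -> forall t, D t -> (0 <= (c * gam_integrand b t)%:E)%E.
  by move=> c0 t _; rewrite lee_fin mulr_ge0 // gam_integrand_ge0.
have E1 : (\int[leb]_(t in `[0%R, +oo[) (gam_integrand s t + K * gam_integrand 0 t)%:E
    = egamma s + K%:E)%E.
  under eq_integral do rewrite EFinD.
  rewrite ge0_integralD //; last first.
  - exact: mg'.
  - exact: ge0.
  - exact: mg.
  - by move=> t _; rewrite lee_fin gam_integrand_ge0.
  under [X in (_ + X)%E]eq_integral do rewrite EFinM.
  rewrite ge0_integralZl_EFin //; last first.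
  - exact: mg.
  - by move=> t _; rewrite lee_fin gam_integrand_ge0.
  by rewrite -!egamma_closed egamma0 mule1.
have E2 : (\int[leb]_(t in `[0%R, +oo[) (gam_integrand s t + K * gam_integrand 0 t)%:E
    = K%:E + s%:E * egamma a)%E.
  have -> : (\int[leb]_(t in `[0%R, +oo[) (gam_integrand s t + K * gam_integrand 0 t)%:E =
    \int[leb]_(t in `[0%R, +oo[) ((f t)%:E + (s * gam_integrand a t)%:E))%E.
    by apply: eq_integral => t _; rewrite -EFinD; congr EFin; rewrite /f; ring.
  rewrite ge0_integralD //; last first.
  - exact: mg'.
  - by apply: ge0; rewrite ltW.
  - apply/measurable_EFinP; apply: measurable_funD; last first.
      by apply/measurable_EFinP; exact: mg'.
    by apply: measurable_funB; apply/measurable_EFinP; [exact: mg|exact: mg'].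
  - by move=> t; rewrite /= in_itv /= andbT lee_fin; exact: f0.
  under [X in (_ + X)%E]eq_integral do rewrite EFinM.
  rewrite ge0_integralZl_EFin ?(ltW s0) //; last first.
  - exact: mg.
  - by move=> t _; rewrite lee_fin gam_integrand_ge0.
  by rewrite If -egamma_closed.
move: E2; rewrite E1 addeC => /(congr1 (fun x => x - K%:E)%E).
by rewrite addeAC subee // add0e addeAC subee // add0e.
Qed.

Lemma le_egamma (k a b c : R) : 0 <= k ->
  (forall t, 0 < t -> k * gam_integrand a t <= gam_integrand b t + gam_integrand c t) ->
  (k%:E * egamma a <= egamma b + egamma c)%E.
Proof.
move=> k0 le_abc.
have mg x : measurable_fun (`]0, +oo[ : set R) (fun t => (gam_integrand x t)%:E).
  by apply/measurable_EFinP; apply: measurable_funTS; exact: measurable_gam.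
have g0 x (D : set R) t : D t -> (0 <= (gam_integrand x t)%:E)%E.
  by move=> _; rewrite lee_fin gam_integrand_ge0.
rewrite /egamma -ge0_integralZl_EFin //; last first.
- exact: mg.
- exact: g0.
rewrite -ge0_integralD //; last first.
- exact: mg.
- exact: g0.
- exact: mg.
- exact: g0.
apply: ge0_le_integral => //.
- by move=> t _; rewrite -EFinM lee_fin mulr_ge0 // gam_integrand_ge0.
- by apply: measurable_funeM; exact: mg.
- by apply: emeasurable_funD; exact: mg.
by move=> t /= t0; rewrite -EFinD -EFinM lee_fin; apply: le_abc; move: t0; rewrite in_itv /= andbT.
Qed.

(** Since [t^(1/2) <= 1 + t]. *)
Lemma egamma_half_lty : (egamma (2^-1) < +oo)%E.
Proof.
apply: (@le_lt_trans _ _ (egamma 0 + egamma 1)%E); last first.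
  by have := @egamma_rec 0 (lexx _); rewrite add0r => ->; rewrite egamma0 mule1 -EFinD ltry.
rewrite -[X in (X <= _)%E]mul1e; apply: le_egamma => // t t0.
rewrite mul1r /gam_integrand -mulrDl.
rewrite ler_wpM2r ?expR_ge0 // powRr0 powRr1 ?(ltW t0) //.
rewrite powR12_sqrt ?(ltW t0) //.
have := sqr_sqrtr (ltW t0); have := sqrtr_ge0 t.
set q := Num.sqrt t; nra.
Qed.

(** A lower bound by the inequality of the arithmetic and geometric means:
    [2 t <= t^(1/2) + t^(3/2)], whose right-hand side integrates to
    [(1 + 3/2)] times the value in question. *)
Lemma egamma_half_gt0 : (0 < egamma (2^-1))%E.
Proof.
have h0 : 0 <= 2^-1 :> R by rewrite invr_ge0.
have : (2%:E * egamma 1 <= egamma (2^-1) + egamma (2^-1 + 1))%E.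
  apply: le_egamma => // t t0; rewrite /gam_integrand -mulrDl mulrA.
  rewrite ler_wpM2r ?expR_ge0 // powRr1 ?(ltW t0) //.
  rewrite powRD; last by apply/implyP => _; rewrite gt_eqF.
  rewrite powRr1 ?(ltW t0) // powR12_sqrt ?(ltW t0) //.
  have := sqr_sqrtr (ltW t0); have := sqrtr_ge0 t.
  set q := Num.sqrt t => q0 <-; rewrite -subr_ge0.
  have -> : q + q * q ^+ 2 - 2 * q ^+ 2 = q * (q - 1) ^+ 2 by ring.
  by rewrite mulr_ge0 // sqr_ge0.
have := @egamma_rec 0 (lexx _); rewrite add0r egamma0 mule1 => ->.
rewrite egamma_rec // mule1 lt_def egamma_ge0 andbT.
by apply: contraL => /eqP ->; rewrite mule0 adde0 -ltNge lte_fin.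
Qed.

Lemma egamma_halves n : exists2 r : R, 0 < r & egamma (n%:R / 2) = r%:E.
Proof.
elim/ltn_ind: n => -[_|[_|n IH]].
- by exists 1; rewrite // mul0r egamma0.
- rewrite div1r; case E : (egamma 2^-1) egamma_half_gt0 egamma_half_lty => [r| |] //.
  by rewrite lte_fin => r0 _; exists r.
have [r r0 Er] := IH n (leqnSn _).
have E : n.+2%:R / 2 = n%:R / 2 + 1 :> R by rewrite -!natr1; field.
have p0 : 0 < n%:R / 2 + 1 :> R by rewrite ltr_wpDl // divr_ge0.
exists ((n%:R / 2 + 1) * r); first by rewrite mulr_gt0.
by rewrite E egamma_rec ?divr_ge0 // Er EFinM.
Qed.

Lemma Gamma_half_gt0 n : 0 < Gamma (n.+2%:R / 2 : R).
Proof.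
have [r r0 E] := egamma_halves n.
have -> : n.+2%:R / 2 = n%:R / 2 + 1 :> R by rewrite -!natr1; field.
by rewrite GammaE E.
Qed.

Lemma Gamma_half_rec n : Gamma (n.+4%:R / 2 : R) = n.+2%:R / 2 * Gamma (n.+2%:R / 2).
Proof.
have [r r0 E] := egamma_halves n.
have E1 : n.+2%:R / 2 = n%:R / 2 + 1 :> R by rewrite -!natr1; field.
have -> : n.+4%:R / 2 = n%:R / 2 + 1 + 1 :> R by rewrite -!natr1; field.
rewrite GammaE egamma_rec ?divr_ge0 // E1 GammaE E.
by rewrite -EFinM.
Qed.

Lemma Gamma1 : Gamma (1 : R) = 1.
Proof. by rewrite -[X in Gamma X]add0r GammaE egamma0. Qed.

Lemma Gamma_natS n : Gamma (n.+1%:R : R) = n`!%:R.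
Proof.
elim: n => [|n IH]; first by rewrite Gamma1 fact0.
have := Gamma_half_rec (2 * n)%N.
have -> : (2 * n).+4%:R / 2 = n.+2%:R :> R by rewrite -!natr1 natrM; field.
have -> : (2 * n).+2%:R / 2 = n.+1%:R :> R by rewrite -!natr1 natrM; field.
by move=> ->; rewrite IH factS natrM.
Qed.

Lemma Gamma_poch d n : (2 <= d)%N ->
  Gamma (n%:R + d%:R / 2 : R) = poch d n * Gamma (d%:R / 2).
Proof.
move=> d2; elim: n => [|n IH]; first by rewrite add0r poch0 mul1r.
have [e de] : exists e, d = e.+2 by exists (d - 2)%N; lia.
have := Gamma_half_rec (2 * n + e)%N.
have -> : (2 * n + e).+4%:R / 2 = n.+1%:R + d%:R / 2 :> R.
  by rewrite de -!natr1 natrD natrM; field.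
have -> : (2 * n + e).+2%:R / 2 = n%:R + d%:R / 2 :> R.
  by rewrite de -!natr1 natrD natrM; field.
by move=> ->; rewrite IH pochS; ring.
Qed.

(** The constants telescope by [Gamma (s + 1) = s Gamma s]. *)
Lemma A_sqr d n : (3 <= d)%N -> (0 < n)%N ->
  A_ R d n ^+ 2 = poch d n / n`!%:R.
Proof.
move=> d3 n0.
pose G (k : nat) : R := Gamma (n%:R + k%:R / 2).
have GE k : G k = Gamma ((2 * n + k)%:R / 2).
  by rewrite /G natrD natrM; congr Gamma; field.
have G0 k : 0 < G k.
  rewrite GE; have -> : (2 * n + k = (2 * n + k - 2).+2)%N by lia.
  exact: Gamma_half_gt0.
have Grec k : G k.+2 = (n%:R + k%:R / 2) * G k.
  rewrite !GE.
  have -> : (2 * n + k.+2 = (2 * n + k - 2).+4)%N by lia.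
  have {2}-> : (2 * n + k = (2 * n + k - 2).+2)%N by lia.
  rewrite Gamma_half_rec; congr (_ * _).
  have -> : ((2 * n + k - 2).+2 = 2 * n + k)%N by lia.
  by rewrite natrD natrM; field.
have prod m : \prod_(0 <= k < m) (2 * (n%:R + k.+1%:R / 2) * G k.+1 / G k.+2) =
    2 ^+ m * G m.+2 / G 2%N.
  elim: m => [|m IH]; first by rewrite big_geq // expr0 mul1r divff // gt_eqF.
  rewrite big_nat_recr //= IH exprS (Grec m.+1).
  have := G0 m.+1; have := G0 m.+2; have := G0 2%N.
  move: (G 2%N) (G m.+1) (G m.+2) => a b c a0 c0 b0.
  by field; rewrite !gt_eqF.
have [e de] : exists e, d = e.+3 by exists (d - 3)%N; lia.
have d20 : 0 < Gamma (d%:R / 2 : R) by rewrite de; exact: Gamma_half_gt0.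
rewrite /A_ exprMn expr_div_n sqr_sqrtr ?(ltW d20) //.
have -> : (2 `^ ((2 - d%:R) / 2) : R) ^+ 2 = (2 ^+ (d - 2)%N)^-1.
  rewrite -powR_mulrn ?powR_ge0 // -powRrM -powR_invn //; congr (_ `^ _).
  by rewrite natrB; [field|lia].
rewrite -prodrXl big_nat_rev /=.
have -> : \prod_(0 <= i < (d - 2)%N)
    Num.sqrt ((2 * n%:R + d%:R - (0 + (d - 2) - i.+1)%N%:R - 2) *
      Gamma (n%:R + (d%:R - (0 + (d - 2) - i.+1)%N%:R - 2) / 2) /
      Gamma (n%:R + (d%:R - (0 + (d - 2) - i.+1)%N%:R - 1) / 2)) ^+ 2 =
    \prod_(0 <= k < (d - 2)%N) (2 * (n%:R + k.+1%:R / 2) * G k.+1 / G k.+2).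
  apply: eq_big_nat => i /andP[_ id].
  have -> : (0 + (d - 2) - i.+1)%N%:R = d%:R - 3 - i%:R :> R.
    by rewrite add0n natrB // natrB; [rewrite -natr1; ring|lia].
  have -> : n%:R + (d%:R - (d%:R - 3 - i%:R) - 2) / 2 = n%:R + i.+1%:R / 2 :> R.
    by rewrite -natr1; field.
  have -> : n%:R + (d%:R - (d%:R - 3 - i%:R) - 1) / 2 = n%:R + i.+2%:R / 2 :> R.
    by rewrite -[i.+2%:R]natr1 -natr1; field.
  rewrite -/(G _) -/(G _) sqr_sqrtr.
    by congr (_ * _ / _); rewrite -natr1; field.
  rewrite divr_ge0 ?mulr_ge0 ?(ltW (G0 _)) //.
  have -> : 2 * n%:R + d%:R - (d%:R - 3 - i%:R) - 2 = 2 * n%:R + i%:R + 1 :> R by ring.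
  by rewrite !addr_ge0 ?mulr_ge0.
rewrite prod.
have -> : (d - 2).+2 = d by lia.
have -> : G 2%N = n`!%:R by rewrite -Gamma_natS /G -natr1; congr Gamma; field.
rewrite /G Gamma_poch; last by lia.
field.
by rewrite expf_neq0 // fact_neq0 gt_eqF.
Qed.

End GammaFunction.

(** * Invariant forms in two vectors *)

Section PolyLemmas.
Context {F : numFieldType}.
Implicit Types (p q : {poly F}).

Lemma poly_inj_eq0 (f : nat -> F) p : injective f -> (forall n, p.[f n] = 0) -> p = 0.
Proof.
move=> f_inj p0; apply/eqP; apply: contraT => pn0.
pose s := [seq f n | n <- iota 0 (size p)].
have us : uniq s by rewrite map_inj_uniq ?iota_uniq.
have rs : all (root p) s by apply/allP => x /mapP[n _ ->]; apply/eqP.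
have := max_poly_roots pn0 rs us.
by rewrite size_map size_iota ltnn.
Qed.

Lemma poly_nat_eq0 p : (forall n : nat, p.[n%:R] = 0) -> p = 0.
Proof. by apply: poly_inj_eq0 => i j /eqP; rewrite eqr_nat => /eqP. Qed.

Lemma poly_nat_ext p q : (forall n : nat, p.[n%:R] = q.[n%:R]) -> p = q.
Proof.
move=> pq; apply/eqP; rewrite -subr_eq0; apply/eqP/poly_nat_eq0 => n.
by rewrite hornerD hornerN pq subrr.
Qed.

Lemma coef1M p q : (p * q)`_1 = p`_0 * q`_1 + p`_1 * q`_0.
Proof. by rewrite coefM !big_ord_recr big_ord0 /= add0r. Qed.

Lemma coef2M p q : (p * q)`_2 = p`_0 * q`_2 + p`_1 * q`_1 + p`_2 * q`_0.
Proof. by rewrite coefM !big_ord_recr big_ord0 /= add0r. Qed.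

Lemma coef0X p n : (p ^+ n)`_0 = p`_0 ^+ n.
Proof. by rewrite -!horner_coef0 hornerE. Qed.

Lemma coef1X p n : (p ^+ n)`_1 = n%:R * p`_0 ^+ n.-1 * p`_1.
Proof.
case: n => [|n]; first by rewrite expr0 coef1 !mul0r.
elim: n => [|n IH]; first by rewrite !expr1 expr0 !mul1r.
rewrite exprS coef1M IH coef0X -[n.+2%:R]natr1 /= !exprS; ring.
Qed.

Lemma coef2X p n : (p ^+ n)`_2 =
  n%:R * p`_0 ^+ n.-1 * p`_2 + 'C(n, 2)%:R * p`_0 ^+ n.-2 * p`_1 ^+ 2.
Proof.
case: n => [|[|n]]; first by rewrite expr0 coef1 !mul0r addr0.
  by rewrite expr0 expr1 /= !mul1r bin_small // !mul0r addr0.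
elim: n => [|n IH].
  by rewrite expr2 coef2M binn expr0 expr1; ring.
rewrite exprS coef2M IH coef0X coef1X -[n.+3%:R]natr1 (binS n.+2 1) bin1 natrD /= !exprS; ring.
Qed.

End PolyLemmas.

Section Forms.
Context {F : numFieldType}.
Implicit Types (n m k l : nat) (A B D c : F).

(** Polynomials in [A = x.x], [B = x.y], [D = y.y] of degree [n] in [x] and
    degree [m] in [y]: the rotation-invariant forms of two vectors. *)
Inductive form : nat -> nat -> (F -> F -> F -> F) -> Prop :=
| form_zero n m : form n m (fun _ _ _ => 0)
| form_mono c i j k : form (2 * i + j) (j + 2 * k)
    (fun A B D => c * A ^+ i * B ^+ j * D ^+ k)
| form_add n m G H : form n m G -> form n m H ->
    form n m (fun A B D => G A B D + H A B D).

Lemma form_ext n m G H : (forall A B D, G A B D = H A B D) -> form n m G -> form n m H.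
Proof.
by move=> GH; have -> : H = G by apply/funext => A; apply/funext => B; apply/funext => D.
Qed.

Lemma form_mono_eq c i j k n m : (n = 2 * i + j)%N -> (m = j + 2 * k)%N ->
  form n m (fun A B D => c * A ^+ i * B ^+ j * D ^+ k).
Proof. by move=> -> ->; exact: form_mono. Qed.

Lemma form_scale n m G c : form n m G -> form n m (fun A B D => c * G A B D).
Proof.
elim=> [{}n {}m|c' i j k|{}n {}m {}G H _ IG _ IH].
- by apply: form_ext (form_zero n m) => *; rewrite mulr0.
- by apply: form_ext (form_mono (c * c') i j k) => *; rewrite !mulrA.
- by apply: form_ext (form_add IG IH) => *; rewrite mulrDr.
Qed.

Lemma form_mul n m n' m' G H : form n m G -> form n' m' H ->
  form (n + n') (m + m') (fun A B D => G A B D * H A B D).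
Proof.
move=> fG fH; elim: fG => [{}n {}m|c i j k|{}n {}m {}G G' _ IG _ IG'].
- by apply: form_ext (form_zero _ _) => *; rewrite mul0r.
- elim: fH => [{}n' {}m'|c' i' j' k'|{}n' {}m' {}H H' _ IH _ IH'].
  + by apply: form_ext (form_zero _ _) => *; rewrite mulr0.
  + apply: (@form_ext _ _ (fun A B D => c * c' * A ^+ (i + i') * B ^+ (j + j') * D ^+ (k + k'))).
      by move=> A B D; rewrite !exprD; ring.
    by apply: form_mono_eq; lia.
  + by apply: form_ext (form_add IH IH') => *; rewrite mulrDr.
- by apply: form_ext (form_add IG IG') => *; rewrite mulrDl.
Qed.

(** Every monomial of larger degree in [y] than in [x] contains [y.y]. *)
Lemma form_null_lt n m G : form n m G -> (n < m)%N -> forall A B, G A B 0 = 0.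
Proof.
elim=> [//|c i j k lt_nm A B|{}n {}m {}G H _ IG _ IH lt_nm A B].
  by rewrite expr0n (_ : (k == 0%N) = false) ?mulr0 //; apply/negbTE; lia.
by rewrite IG // IH // addr0.
Qed.

Lemma form_single n m G : form n m G -> m = 0%N ->
  exists c, forall A B D, G A B D = c * A ^+ (n./2).
Proof.
elim=> [{}n {}m _|c i j k m0|{}n {}m {}G H _ IG _ IH m0].
- by exists 0 => A B D; rewrite mul0r.
- have [-> ->] : j = 0%N /\ k = 0%N by lia.
  by exists c => A B D; rewrite addn0 !expr0 !mulr1 mul2n doubleK.
- have [[c1 E1] [c2 E2]] := (IG m0, IH m0).
  by exists (c1 + c2) => A B D; rewrite E1 E2 mulrDl.
Qed.

(** Equal degrees force equal powers of [x.x] and [y.y]. *)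
Lemma form_diag n m G : form n m G -> n = m ->
  exists q : nat -> F, forall A B D,
    G A B D = \sum_(k < n.+1 | (2 * k <= n)%N) q k * B ^+ (n - 2 * k) * (A * D) ^+ k.
Proof.
elim=> [{}n {}m _|c i j k nm|{}n {}m {}G H _ IG _ IH nm].
- by exists (fun _ => 0) => A B D; rewrite big1 // => k _; rewrite !mul0r.
- have ik : i = k by lia.
  rewrite ik; exists (fun k' => if k' == k then c else 0) => A B D.
  have hk : (k < (2 * k + j).+1)%N by lia.
  rewrite (bigD1 (Ordinal hk)) /=; last by lia.
  rewrite eqxx big1 => [|k' /andP[_ nk]]; last first.
    by rewrite ifF ?mul0r //; apply: contraNF nk => /eqP nk; apply/eqP/val_inj.
  by rewrite addr0 addKn exprMn; ring.
- have [[q1 E1] [q2 E2]] := (IG nm, IH nm).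
  exists (fun k => q1 k + q2 k) => A B D; rewrite E1 E2 -big_split.
  by apply: eq_bigr => k _; rewrite !mulrDl.
Qed.

(** [(x + sy).(x + sy)] as a polynomial in [s].  The coefficients of its powers
    are the forms to which mixed moments reduce by polarization. *)
Definition polar_poly A B D : {poly F} := A%:P + (2 * B)%:P * 'X + D%:P * 'X^2.

Lemma polar_poly_horner A B D s : (polar_poly A B D).[s] = A + 2 * B * s + D * s ^+ 2.
Proof. by rewrite /polar_poly !hornerE. Qed.

Lemma coef_polar_mul A B D (p : {poly F}) l : (polar_poly A B D * p)`_l =
  A * p`_l + (if l is l'.+1 then 2 * B * p`_l' else 0)
  + (if l is l'.+2 then D * p`_l' else 0).
Proof.
rewrite /polar_poly !mulrDl !coefD -(mulrA _ 'X p) -(mulrA _ 'X^2 p) !coefCM coefXM coefXnM.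
by case: l => [|[|l]] /=; rewrite ?subSS ?subn0 ?mulr0 ?mulrA.
Qed.

Lemma polar_coef_gt m l A B D : (2 * m < l)%N -> (polar_poly A B D ^+ m)`_l = 0.
Proof.
elim: m l => [|m IH] l lm; first by rewrite expr0 coef1; case: l lm.
rewrite exprS coef_polar_mul IH; last by lia.
case: l lm => [|[|l]] lm; rewrite ?(mulr0, addr0) //.
by rewrite !IH ?mulr0 ?addr0 //; lia.
Qed.

Lemma polar_coef_form m k l : (k + l = 2 * m)%N ->
  form k l (fun A B D => (polar_poly A B D ^+ m)`_l).
Proof.
elim: m k l => [|m IH] k l kl.
  have [-> ->] : k = 0%N /\ l = 0%N by lia.
  by apply: form_ext (form_mono 1 0 0 0) => A B D; rewrite expr0 coef1 !expr0 !mulr1.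
have fA : form k l (fun A B D => A * (polar_poly A B D ^+ m)`_l).
  case: k kl => [|[|k]] kl.
  - by apply: form_ext (form_zero _ _) => A B D; rewrite polar_coef_gt ?mulr0 //; lia.
  - by apply: form_ext (form_zero _ _) => A B D; rewrite polar_coef_gt ?mulr0 //; lia.
  - have f1 : form k l (fun A B D => (polar_poly A B D ^+ m)`_l) by apply: IH; lia.
    by apply: form_ext (form_mul (form_mono 1 1 0 0) f1) => A B D; rewrite !expr0 expr1 !mulr1 mul1r.
have fB : form k l (fun A B D => if l is l'.+1 then 2 * B * (polar_poly A B D ^+ m)`_l' else 0).
  case: l kl {fA} => [|l] kl; first exact: form_zero.
  case: k kl => [|k] kl.
    by apply: form_ext (form_zero _ _) => A B D; rewrite polar_coef_gt ?mulr0 //; lia.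
  have f1 : form k l (fun A B D => (polar_poly A B D ^+ m)`_l) by apply: IH; lia.
  by apply: form_ext (form_mul (form_mono 2 0 1 0) f1) => A B D; rewrite !expr0 expr1 !mulr1.
have fD : form k l (fun A B D => if l is l'.+2 then D * (polar_poly A B D ^+ m)`_l' else 0).
  case: l kl {fA fB} => [|[|l]] kl; [exact: form_zero|exact: form_zero|].
  have f1 : form k l (fun A B D => (polar_poly A B D ^+ m)`_l) by apply: IH; lia.
  by apply: form_ext (form_mul (form_mono 1 0 0 1) f1) => A B D; rewrite !expr0 expr1 !mulr1 mul1r.
apply: form_ext (form_add (form_add fA fB) fD) => A B D.
by rewrite exprS coef_polar_mul.
Qed.

Lemma polar_coef0 A B D : (polar_poly A B D)`_0 = A.
Proof. by rewrite -[polar_poly _ _ _]mulr1 coef_polar_mul coef1 mulr1 !addr0. Qed.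

Lemma polar_coef1 A B D : (polar_poly A B D)`_1 = 2 * B.
Proof.
by rewrite -[polar_poly _ _ _]mulr1 coef_polar_mul !coef1 !mulr0 mulr1 add0r addr0.
Qed.

Lemma polar_coef2 A B D : (polar_poly A B D)`_2 = D.
Proof.
by rewrite -[polar_poly _ _ _]mulr1 coef_polar_mul !coef1 !mulr0 mulr1 !add0r.
Qed.

Lemma polar_coef_null m l B : (polar_poly 0 B 0 ^+ m)`_l = (2 * B) ^+ m *+ (l == m).
Proof.
rewrite /polar_poly mul0r addr0 add0r exprMn -polyC_exp coefCM coefXn.
by case: eqP; rewrite ?mulr1 ?mulr0.
Qed.

End Forms.

(** * Integration over the sphere *)

Section ComplexParts.
Context {R : realType}.
Implicit Types (a b : R[i]).

Lemma complexReD a b : Re (a + b) = Re a + Re b. Proof. by case: a b => [? ?] [? ?]. Qed.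
Lemma complexImD a b : Im (a + b) = Im a + Im b. Proof. by case: a b => [? ?] [? ?]. Qed.
Lemma complexReM a b : Re (a * b) = Re a * Re b - Im a * Im b.
Proof. by case: a b => [? ?] [? ?]. Qed.
Lemma complexImM a b : Im (a * b) = Re a * Im b + Im a * Re b.
Proof. by case: a b => [? ?] [? ?]. Qed.

Lemma complex_ext a b : Re a = Re b -> Im a = Im b -> a = b.
Proof. by case: a b => [? ?] [? ?] /= -> ->. Qed.

End ComplexParts.

Section SphereIntegral.
Context {R : realType} {d : nat} (mu : probability (borelRd R d) R).
Hypothesis mu_sphere : mu (@sphere R d : set (borelRd R d)) = 1%E.

Local Notation sph := (@sphere R d : set (borelRd R d)).
Implicit Types (f g : 'cV[R]_d -> R[i]) (u : 'cV[R]_d -> R).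

Lemma continuous_measurable_borel u :
  continuous u -> measurable_fun [set: borelRd R d] (u : borelRd R d -> R).
Proof.
move=> cu; apply: (measurability _ (RGenOInfty.measurableE R)) => //.
move=> _ [_ [a ->] <-]; rewrite setTI; apply: sub_sigma_algebra.
apply: open_comp; first by move=> x _; exact: cu.
exact: interval_open.
Qed.

Lemma measurable_coord (i : 'I_d) :
  measurable_fun [set: borelRd R d] (fun x : borelRd R d => (x : 'cV[R]_d) i 0).
Proof. by apply: continuous_measurable_borel; exact: coord_continuous. Qed.

Lemma sphere_sumsq (x : 'cV[R]_d) : sphere x <-> \sum_i x i 0 ^+ 2 = 1.
Proof.
rewrite /sphere /=; split=> [E|->]; last by rewrite sqrtr1.
by rewrite -[LHS]sqr_sqrtr ?E ?expr1n // sumr_ge0 // => i _; rewrite sqr_ge0.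
Qed.

Lemma measurable_sphere : measurable sph.
Proof.
have -> : sph = (fun x : borelRd R d => \sum_i (x : 'cV[R]_d) i 0 ^+ 2) @^-1` [set 1].
  by apply/seteqP; split => x /= /sphere_sumsq.
rewrite -[X in measurable X]setTI; apply: (_ : measurable_fun setT _) => //.
by apply: measurable_sum => i; apply: measurable_funX; exact: measurable_coord.
Qed.

Definition cintegrable f :=
  mu.-integrable sph (EFin \o (fun x => Re (f x))) /\
  mu.-integrable sph (EFin \o (fun x => Im (f x))).

(** An algebra of functions, containing the polynomials, that multiplies
    integrable functions into integrable ones. *)
Definition bounded_borel f :=
  [/\ measurable_fun [set: borelRd R d] (fun x : borelRd R d => Re (f x)),
      measurable_fun [set: borelRd R d] (fun x : borelRd R d => Im (f x)) &
      exists M, forall x, sphere x -> `|Re (f x)| <= M /\ `|Im (f x)| <= M].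

Lemma bounded_borel_cst (c : R[i]) : bounded_borel (fun _ => c).
Proof.
split=> //; exists (Num.max `|Re c| `|Im c|) => x _.
by rewrite !le_max !lexx orbT.
Qed.

Lemma bounded_borelD f g : bounded_borel f -> bounded_borel g ->
  bounded_borel (fun x => f x + g x).
Proof.
move=> [mf1 mf2 [M fM]] [mg1 mg2 [N gN]]; split.
- by under eq_fun do rewrite complexReD; exact: measurable_funD.
- by under eq_fun do rewrite complexImD; exact: measurable_funD.
- exists (M + N) => x sx; have [f1 f2] := fM x sx; have [g1 g2] := gN x sx.
  by rewrite complexReD complexImD; split; rewrite (le_trans (ler_normD _ _)) // lerD.
Qed.

Lemma bounded_borelM f g : bounded_borel f -> bounded_borel g ->
  bounded_borel (fun x => f x * g x).
Proof.
move=> [mf1 mf2 [M fM]] [mg1 mg2 [N gN]]; split.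
- by under eq_fun do rewrite complexReM; apply: measurable_funB; exact: measurable_funM.
- by under eq_fun do rewrite complexImM; apply: measurable_funD; exact: measurable_funM.
- exists (M * N + M * N) => x sx; have [f1 f2] := fM x sx; have [g1 g2] := gN x sx.
  rewrite complexReM complexImM; split.
    by rewrite (le_trans (ler_normB _ _)) // lerD // normrM ler_pM.
  by rewrite (le_trans (ler_normD _ _)) // lerD // normrM ler_pM.
Qed.

Lemma bounded_borel_sum (I : Type) (r : seq I) (P : pred I) (F : I -> 'cV[R]_d -> R[i]) :
  (forall i, P i -> bounded_borel (F i)) ->
  bounded_borel (fun x => \sum_(i <- r | P i) F i x).
Proof.
move=> bF; elim: r => [|i r IH].
  by under eq_fun do rewrite big_nil; exact: bounded_borel_cst.
have [Pi|nPi] := boolP (P i).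
  by under eq_fun do rewrite big_cons Pi; apply: bounded_borelD => //; exact: bF.
by under eq_fun do rewrite big_cons (negbTE nPi).
Qed.

Lemma bounded_borelX f n : bounded_borel f -> bounded_borel (fun x => f x ^+ n).
Proof.
move=> bf; elim: n => [|n IH]; first exact: bounded_borel_cst.
by under eq_fun do rewrite exprS; exact: bounded_borelM.
Qed.

Lemma bounded_borel_coord (i : 'I_d) :
  bounded_borel (fun x => real_complex R (x i 0)).
Proof.
split; [exact: measurable_coord|exact: measurable_cst|].
exists 1 => x /sphere_sumsq sx /=; rewrite normr0 ler01; split=> //.
rewrite -[leLHS]sqrtr_sqr -sqrtr1 ler_wsqrtr // -sx (bigD1 i) //= lerDl.
by rewrite sumr_ge0 // => j _; rewrite sqr_ge0.
Qed.

Lemma bounded_real_integrable u (M : R) :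
  measurable_fun sph (u : borelRd R d -> R) -> (forall x, sphere x -> `|u x| <= M) ->
  mu.-integrable sph (EFin \o (u : borelRd R d -> R)).
Proof.
move=> mu' uM; apply: measurable_bounded_integrable => //.
- exact: measurable_sphere.
- by apply: (le_lt_trans (probability_le1 mu measurable_sphere)); rewrite ltry.
- exists M; split; first exact: num_real.
  by move=> y My x sx /=; rewrite (le_trans (uM x sx)) // ltW.
Qed.

Lemma bounded_borel_cintegrable f : bounded_borel f -> cintegrable f.
Proof.
move=> [m1 m2 [M fM]]; split; apply: (@bounded_real_integrable _ M).
- exact: measurable_funTS.
- by move=> x /fM[].
- exact: measurable_funTS.
- by move=> x /fM[].
Qed.

Lemma integrable_mul_bounded u v (M : R) :
  mu.-integrable sph (EFin \o (u : borelRd R d -> R)) ->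
  measurable_fun sph (v : borelRd R d -> R) -> (forall x, sphere x -> `|v x| <= M) ->
  mu.-integrable sph (EFin \o (fun x : borelRd R d => u x * v x)).
Proof.
move=> iu mv vM.
have := @integrableMl _ _ _ mu sph measurable_sphere _ v iu mv.
apply; exists M; split; first exact: num_real.
by move=> y My x sx /=; rewrite (le_trans (vM x sx)) // ltW.
Qed.

Lemma cintegrableM f g : cintegrable f -> bounded_borel g ->
  cintegrable (fun x => f x * g x).
Proof.
move=> [i1 i2] [m1 m2 [M gM]].
have mg1 : measurable_fun sph (fun x : borelRd R d => Re (g x)) by exact: measurable_funTS.
have mg2 : measurable_fun sph (fun x : borelRd R d => Im (g x)) by exact: measurable_funTS.
have b1 x : sphere x -> `|Re (g x)| <= M by move=> /gM[].
have b2 x : sphere x -> `|Im (g x)| <= M by move=> /gM[].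
have ms := measurable_sphere.
split.
- have := integrableB ms (integrable_mul_bounded i1 mg1 b1) (integrable_mul_bounded i2 mg2 b2).
  by apply: eq_integrable => // x _ /=; rewrite complexReM EFinB.
- have := integrableD ms (integrable_mul_bounded i1 mg2 b2) (integrable_mul_bounded i2 mg1 b1).
  by apply: eq_integrable => // x _ /=; rewrite complexImM EFinD.
Qed.

Lemma sphere_integral_ext f g : (forall x, sphere x -> f x = g x) ->
  sphere_integral mu f = sphere_integral mu g.
Proof.
by move=> fg; rewrite /sphere_integral; congr Complex; apply: eq_Rintegral => x;
  rewrite inE => sx; rewrite fg.
Qed.

Lemma cintegrable_ext f g : (forall x, sphere x -> f x = g x) ->
  cintegrable f -> cintegrable g.
Proof.
move=> fg [i1 i2]; split; [move: i1|move: i2]; apply: eq_integrable => //;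
  by [exact: measurable_sphere|move=> x; rewrite inE => sx /=; rewrite fg].
Qed.

Lemma cintegrableD f g : cintegrable f -> cintegrable g ->
  cintegrable (fun x => f x + g x).
Proof.
have ms := measurable_sphere.
move=> [f1 f2] [g1 g2]; split.
- by have := integrableD ms f1 g1; apply: eq_integrable => // x _ /=; rewrite complexReD EFinD.
- by have := integrableD ms f2 g2; apply: eq_integrable => // x _ /=; rewrite complexImD EFinD.
Qed.

Lemma sphere_integralD f g : cintegrable f -> cintegrable g ->
  sphere_integral mu (fun x => f x + g x) = sphere_integral mu f + sphere_integral mu g.
Proof.
move=> [f1 f2] [g1 g2]; rewrite /sphere_integral; congr Complex.
- under eq_Rintegral do rewrite complexReD.
  by rewrite RintegralD //; exact: measurable_sphere.
- under eq_Rintegral do rewrite complexImD.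
  by rewrite RintegralD //; exact: measurable_sphere.
Qed.

Lemma sphere_integralZ (c : R[i]) f : cintegrable f ->
  sphere_integral mu (fun x => c * f x) = c * sphere_integral mu f.
Proof.
move=> [f1 f2]; have ms := measurable_sphere.
have Z (k : R) u : mu.-integrable sph (EFin \o (u : borelRd R d -> R)) ->
    mu.-integrable sph (EFin \o (fun x : borelRd R d => k * u x)).
  by move=> iu; exact: (integrableZl ms k iu).
case: c => a b; rewrite /sphere_integral; apply: complex_ext; rewrite ?complexReM ?complexImM /=.
- under eq_Rintegral do rewrite complexReM /=.
  by rewrite RintegralB ?RintegralZl //; exact: Z.
- under eq_Rintegral do rewrite complexImM /=.
  by rewrite RintegralD ?RintegralZl //; exact: Z.
Qed.

Lemma sphere_integral_cst (c : R[i]) : sphere_integral mu (fun _ => c) = c.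
Proof.
have E : fine (mu sph) = 1 by rewrite mu_sphere.
apply: complex_ext; rewrite /= (Rintegral_cst mu measurable_sphere) -[RHS]mulr1;
  by congr (_ * _).
Qed.

Lemma sphere_integral_sum (I : Type) (r : seq I) (P : pred I) (F : I -> 'cV[R]_d -> R[i]) :
  (forall i, P i -> cintegrable (F i)) ->
  sphere_integral mu (fun x => \sum_(i <- r | P i) F i x) =
  \sum_(i <- r | P i) sphere_integral mu (F i).
Proof.
move=> iF.
suff [] : sphere_integral mu (fun x => \sum_(i <- r | P i) F i x) =
  \sum_(i <- r | P i) sphere_integral mu (F i) /\
  cintegrable (fun x => \sum_(i <- r | P i) F i x) by [].
elim: r => [|i r [IH IHi]].
  rewrite big_nil; under eq_fun do rewrite big_nil; split.
    exact: sphere_integral_cst.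
  by apply: bounded_borel_cintegrable; exact: bounded_borel_cst.
rewrite big_cons; case: ifPn => [Pi|nPi].
  have E : (fun x : 'cV[R]_d => \sum_(j <- i :: r | P j) F j x) =
    (fun x => F i x + \sum_(j <- r | P j) F j x).
    by apply/funext => x; rewrite big_cons Pi.
  rewrite E; split; last by apply: cintegrableD => //; exact: iF.
  by rewrite sphere_integralD ?IH //; exact: iF.
by under eq_fun do rewrite big_cons (negbTE nPi).
Qed.

Lemma mx_continuous (T : topologicalType) m n (f : T -> 'M[R]_(m, n)) :
  (forall i j, continuous (fun x => f x i j)) -> continuous f.
Proof.
move=> cf x A [P nP sPA]; apply: (filterS sPA).
by apply: filter_forall => i; apply: filter_forall => j; exact: cf.
Qed.

Lemma measurable_mulmx (g : 'M[R]_d) :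
  measurable_fun [set: borelRd R d] (fun x : borelRd R d => (g *m (x : 'cV[R]_d) : borelRd R d)).
Proof.
apply: (@measurability _ _ _ (borelRd R d) setT _ (@open 'cV[R]_d)) => // _ [B oB <-].
rewrite setTI; apply: sub_sigma_algebra; apply: open_comp oB => x _.
apply: mx_continuous => i j; under eq_fun do rewrite mxE.
have cs (r : seq 'I_d) : continuous (fun y : 'cV[R]_d => \sum_(k <- r) g i k * y k j).
  elim: r => [|k r IH].
    have -> : (fun y : 'cV[R]_d => \sum_(k <- [::]) g i k * y k j) = cst 0.
      by apply/funext => z; rewrite big_nil.
    exact: cst_continuous.
  have -> : (fun y : 'cV[R]_d => \sum_(k <- k :: r) g i k * y k j) =
      (fun y => g i k * y k j + \sum_(k <- r) g i k * y k j).
    by apply/funext => z; rewrite big_cons.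
  have ck : continuous (fun y : 'cV[R]_d => g i k * y k j).
    by move=> y; apply: continuousM; [exact: cst_continuous|exact: coord_continuous].
  by move=> y; exact: (cvgD (ck y) (IH y)).
exact: cs.
Qed.

Lemma SO_trmx (g : 'M[R]_d) : SO g -> SO g^T.
Proof.
by move=> [gT dg]; split; rewrite ?trmxK ?det_tr // (mulmx1C gT).
Qed.

Lemma sphere_mulmx (g : 'M[R]_d) x : SO g -> sphere x -> sphere (g *m x).
Proof.
move=> sg; rewrite !sphere_sumsq.
have E (y : 'cV[R]_d) : \sum_i y i 0 ^+ 2 = (y^T *m y) 0 0.
  by rewrite mxE; apply: eq_bigr => i _; rewrite mxE expr2.
have [gg _] := SO_trmx sg.
by rewrite !E trmx_mul mulmxA -(mulmxA x^T) -{2}[g]trmxK gg mulmx1.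
Qed.

Hypothesis mu_invariant : forall (g : 'M[R]_d) (A : set (borelRd R d)), SO g ->
  measurable A -> mu ((fun x : 'cV[R]_d => g *m x) @` A : set (borelRd R d)) = mu A.

Lemma preimage_mulmx (g : 'M[R]_d) (A : set 'cV[R]_d) : SO g ->
  (fun x => g *m x) @^-1` A = (fun x => g^T *m x) @` A.
Proof.
move=> sg; have [gg _] := SO_trmx sg; have [gg' _] := sg.
rewrite trmxK in gg; apply/seteqP; split => [x /= Agx|x [y Ay <-] /=].
  by exists (g *m x) => //; rewrite mulmxA gg mul1mx.
by rewrite mulmxA gg' mul1mx.
Qed.

Lemma Rintegral_SO (g : 'M[R]_d) u : SO g ->
  measurable_fun [set: borelRd R d] (u : borelRd R d -> R) ->
  (exists M, forall x, sphere x -> `|u x| <= M) ->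
  \int[mu]_(x in sph) u (g *m x) = \int[mu]_(x in sph) u x.
Proof.
move=> sg mu' [M uM].
have mg := measurable_mulmx g.
pose T : borelRd R d -> borelRd R d := fun x : borelRd R d => (g *m (x : 'cV[R]_d) : borelRd R d).
have preS : T @^-1` sph = sph.
  apply/seteqP; split => x /= sx; last exact: sphere_mulmx.
  have [gg _] := SO_trmx sg; rewrite trmxK in gg.
  rewrite -[x : 'cV[R]_d]mul1mx -gg -mulmxA; apply: sphere_mulmx => //.
  exact: SO_trmx.
have iT : mu.-integrable (T @^-1` sph) ((EFin \o (u : borelRd R d -> R)) \o T).
  rewrite preS; apply: (@bounded_real_integrable _ M).
    apply: measurable_funTS; exact: measurableT_comp mu' mg.
  by move=> x sx; apply: uM; exact: sphere_mulmx.
have mu'' : measurable_fun [set: borelRd R d] (EFin \o (u : borelRd R d -> R)).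
  exact/measurable_EFinP.
have := integral_pushforward mg mu'' iT measurable_sphere.
rewrite preS /Rintegral => <-; congr fine.
apply: eq_measure_integral => A mA _.
transitivity (mu ((fun x => g^T *m x) @` (A : set 'cV[R]_d) : set (borelRd R d))).
  by rewrite -preimage_mulmx.
by apply: mu_invariant => //; exact: SO_trmx.
Qed.

Lemma sphere_integral_SO (g : 'M[R]_d) f : SO g -> bounded_borel f ->
  sphere_integral mu (fun x => f (g *m x)) = sphere_integral mu f.
Proof.
move=> sg [m1 m2 [M fM]]; rewrite /sphere_integral; congr Complex.
  by apply: (@Rintegral_SO g (fun x => Re (f x))) => //; exists M => x /fM[].
by apply: (@Rintegral_SO g (fun x => Im (f x))) => //; exists M => x /fM[].
Qed.

End SphereIntegral.

(** * Moments of the invariant measure *)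

Definition dot {F : comNzRingType} {d : nat} (x y : 'cV[F]_d) : F :=
  \sum_i x i 0 * y i 0.

Definition emb {R : realType} {d : nat} (x : 'cV[R]_d) : 'cV[R[i]]_d :=
  map_mx (real_complex R) x.

Section Dot.
Context {F : comNzRingType} {d : nat}.
Implicit Types (x y z : 'cV[F]_d) (s : F).

Lemma dotC x y : dot x y = dot y x.
Proof. by apply: eq_bigr => i _; rewrite mulrC. Qed.

Lemma dotDl x y z : dot (x + y) z = dot x z + dot y z.
Proof. by rewrite /dot -big_split; apply: eq_bigr => i _; rewrite mxE mulrDl. Qed.

Lemma dotZl s x z : dot (s *: x) z = s * dot x z.
Proof. by rewrite /dot mulr_sumr; apply: eq_bigr => i _; rewrite mxE mulrA. Qed.

Lemma dotDr x y z : dot z (x + y) = dot z x + dot z y.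
Proof. by rewrite dotC dotDl !(dotC z). Qed.

Lemma dotZr s x z : dot z (s *: x) = s * dot z x.
Proof. by rewrite dotC dotZl (dotC z). Qed.

Lemma dot_mulmx (g : 'M[F]_d) x y : dot (g *m x) y = dot x (g^T *m y).
Proof.
have E (a b : 'cV[F]_d) : dot a b = (a^T *m b) 0 0.
  by rewrite mxE; apply: eq_bigr => i _; rewrite mxE.
by rewrite !E trmx_mul mulmxA.
Qed.

Lemma dot_polar x y s :
  dot (x + s *: y) (x + s *: y) = dot x x + 2 * dot x y * s + dot y y * s ^+ 2.
Proof. rewrite !(dotDl, dotDr, dotZl, dotZr) (dotC y x); ring. Qed.

Lemma dot_delta x (i : 'I_d) : dot x (delta_mx i 0) = x i 0.
Proof.
rewrite /dot (bigD1 i) //= big1 => [|j ji]; first by rewrite mxE !eqxx mulr1 addr0.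
by rewrite mxE (negbTE ji) mulr0.
Qed.

End Dot.

Section DotReal.
Context {R : realType} {d : nat}.
Implicit Types (x y : 'cV[R]_d).

Lemma dot_emb x y : dot (emb x) (emb y) = real_complex R (dot x y).
Proof. by rewrite /dot rmorph_sum /=; apply: eq_bigr => i _; rewrite !mxE -rmorphM. Qed.

Lemma emb_mulmx (g : 'M[R]_d) x : emb (g *m x) = map_mx (real_complex R) g *m emb x.
Proof. by rewrite /emb map_mxM. Qed.

Lemma sphere_dot1 x : sphere x <-> dot x x = 1.
Proof. by rewrite sphere_sumsq /dot; under [in X in _ <-> X]eq_bigr do rewrite -expr2. Qed.

Lemma dot_ge0 x : 0 <= dot x x.
Proof. by apply: sumr_ge0 => i _; rewrite -expr2 sqr_ge0. Qed.

Lemma dot_eq0 x : dot x x = 0 -> x = 0.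
Proof.
move/eqP; rewrite psumr_eq0 => [/allP x0|i _]; last by rewrite -expr2 sqr_ge0.
apply/colP => i; have := x0 i (mem_index_enum i).
by rewrite /= -expr2 sqrf_eq0 mxE => /eqP.
Qed.

End DotReal.

Section Moments.
Context {R : realType} {d : nat} (mu : probability (borelRd R d) R).
Hypothesis mu_sphere : mu (@sphere R d : set (borelRd R d)) = 1%E.
Hypothesis mu_invariant : forall (g : 'M[R]_d) (A : set (borelRd R d)), SO g ->
  measurable A -> mu ((fun x : 'cV[R]_d => g *m x) @` A : set (borelRd R d)) = mu A.
(** Transitivity of the rotations on the sphere, with [pole] as base point. *)
Variable pole : 'cV[R]_d.
Hypothesis sphere_pole : sphere pole.
Hypothesis rotations : forall nu, sphere nu -> exists2 g, SO g & g *m pole = nu.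

Implicit Types (x y z w : 'cV[R[i]]_d).
Local Notation C := R[i].

Lemma bounded_borel_dot x : bounded_borel (fun v => dot x (emb v)).
Proof.
apply: bounded_borel_sum => i _; apply: bounded_borelM; first exact: bounded_borel_cst.
by under eq_fun do rewrite mxE; exact: bounded_borel_coord.
Qed.

Definition moment n x : C := sphere_integral mu (fun v => dot x (emb v) ^+ n).

Definition mixed_moment k l x y : C :=
  sphere_integral mu (fun v => dot x (emb v) ^+ k * dot y (emb v) ^+ l).

Lemma bounded_borel_mixed k l x y :
  bounded_borel (fun v => dot x (emb v) ^+ k * dot y (emb v) ^+ l).
Proof. by apply: bounded_borelM; apply: bounded_borelX; exact: bounded_borel_dot. Qed.

Lemma moment_SO n (g : 'M[R]_d) (v : 'cV[R]_d) : SO g ->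
  moment n (emb (g *m v)) = moment n (emb v).
Proof.
move=> sg; rewrite /moment.
under eq_fun => y.
  rewrite emb_mulmx dot_mulmx map_trmx -emb_mulmx; over.
have b : bounded_borel (fun y : 'cV[R]_d => dot (emb v) (emb y) ^+ n).
  by apply: bounded_borelX; exact: bounded_borel_dot.
have E := sphere_integral_SO mu_invariant (SO_trmx sg) b.
exact: E.
Qed.

Lemma moment_sphere n (nu : 'cV[R]_d) : sphere nu -> moment n (emb nu) = moment n (emb pole).
Proof. by move=> /rotations[g sg <-]; exact: moment_SO. Qed.

Lemma momentZ n s x : moment n (s *: x) = s ^+ n * moment n x.
Proof.
rewrite /moment -sphere_integralZ //.
  by apply: sphere_integral_ext => v _; rewrite dotZl exprMn.
by apply: bounded_borel_cintegrable => //; apply: bounded_borelX; exact: bounded_borel_dot.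
Qed.

(** A rotation taking [pole] to [- pole] changes the sign. *)
Lemma moment_odd n : odd n -> moment n (emb pole) = 0.
Proof.
move=> on; have sN : sphere (- pole).
  by apply/sphere_dot1; rewrite -scaleN1r dotZl dotZr mulrA mulrNN mul1r mul1r; apply/sphere_dot1.
have := moment_sphere n sN.
rewrite -scaleN1r /emb map_mxZ -/(emb _) rmorphN1 momentZ -signr_odd on expr1 mulN1r => /eqP.
by rewrite eq_sym -subr_eq0 opprK -mulr2n mulrn_eq0 /= => /eqP.
Qed.

(** Polarization: an identity for all [x + s y] is one between coefficients. *)
Lemma moment_polarize n m (c : C) x y :
  (forall k : nat, moment n (x + k%:R *: y) = c * dot (x + k%:R *: y) (x + k%:R *: y) ^+ m) ->
  (forall l, (l <= n)%N -> 'C(n, l)%:R * mixed_moment (n - l) l x y =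
     c * (polar_poly (dot x x) (dot x y) (dot y y) ^+ m)`_l) /\
  (forall s, moment n (x + s *: y) = c * dot (x + s *: y) (x + s *: y) ^+ m).
Proof.
move=> H.
pose P : {poly C} := \poly_(l < n.+1) ('C(n, l)%:R * mixed_moment (n - l) l x y).
have PE s : moment n (x + s *: y) = P.[s].
  rewrite /moment horner_poly.
  under eq_fun do rewrite dotDl dotZl exprDn.
  rewrite sphere_integral_sum //; last first.
    move=> i _; apply: bounded_borel_cintegrable => //.
    under eq_fun do rewrite exprMn -mulr_natl (mulrCA _ (s ^+ i)).
    do 2 (apply: bounded_borelM; first exact: bounded_borel_cst).
    exact: bounded_borel_mixed.
  apply: eq_bigr => l _.
  have -> : (fun v : 'cV[R]_d => dot x (emb v) ^+ (n - l) * (s * dot y (emb v)) ^+ l *+ 'C(n, l)) =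
      (fun v => 'C(n, l)%:R * s ^+ l * (dot x (emb v) ^+ (n - l) * dot y (emb v) ^+ l)).
    by apply/funext => v; rewrite exprMn -mulr_natl; ring.
  rewrite sphere_integralZ -/(mixed_moment _ _ _ _); first by ring.
  by apply: bounded_borel_cintegrable => //; exact: bounded_borel_mixed.
have E : P = c *: polar_poly (dot x x) (dot x y) (dot y y) ^+ m.
  apply: poly_nat_ext => k; rewrite -PE H dot_polar hornerZ horner_exp polar_poly_horner.
  by [].
split=> [l ln|s]; last first.
  by rewrite PE E hornerZ horner_exp polar_poly_horner dot_polar.
have := congr1 (fun p : {poly C} => p`_l) E.
by rewrite coef_poly ltnS ln coefZ.
Qed.

Lemma moment_real n (v : 'cV[R]_d) :
  moment n (emb v) = moment n (emb pole) * dot (emb v) (emb v) ^+ n./2.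
Proof.
have [v0|vn0] := eqVneq v 0.
  rewrite v0 /emb map_mx0 -(scale0r 0) momentZ -[0 *: 0]/(0 *: 0) dotZl mul0r.
  case: n => [|n].
    rewrite !expr0 mul1r mulr1 /moment.
    by apply: sphere_integral_ext => w _; rewrite !expr0.
  rewrite expr0n mul0r; have [on|] := boolP (odd n.+1); first by rewrite moment_odd // mul0r.
  by case: n => // n _; rewrite /= expr0n mulr0.
have nv : 0 < dot v v.
  by rewrite lt_def dot_ge0 andbT; apply: contra vn0 => /eqP /dot_eq0 ->.
pose r := Num.sqrt (dot v v); have r0 : 0 < r by rewrite sqrtr_gt0.
have sv : sphere (r^-1 *: v).
  apply/sphere_dot1; rewrite dotZl dotZr -(sqr_sqrtr (ltW nv)) -/r.
  by field; rewrite gt_eqF.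
have -> : v = r *: (r^-1 *: v) by rewrite scalerA mulfV ?scale1r // gt_eqF.
rewrite /emb map_mxZ momentZ -/(emb _) moment_sphere // dotZl dotZr dot_emb.
have -> : dot (r^-1 *: v) (r^-1 *: v) = 1 by apply/sphere_dot1.
rewrite mulr1 -expr2 mulrC; have [on|en] := boolP (odd n); first by rewrite moment_odd // !mul0r.
by congr (_ * _); rewrite -exprM mul2n even_halfK.
Qed.

(** For real [x] this is invariance and homogeneity.  For [x = a + i b] the real
    case gives the identity at all [a + k b], [k] a natural number, hence for
    the polynomial in [k], whose value at [i] is then known. *)
Lemma momentE n x : moment n x = moment n (emb pole) * dot x x ^+ n./2.
Proof.
pose a : 'cV[R]_d := \col_i Re (x i 0); pose b : 'cV[R]_d := \col_i Im (x i 0).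
have -> : x = emb a + Complex 0 1 *: emb b.
  by apply/colP => i; rewrite !mxE {1}[x i 0]complexE.
apply: (moment_polarize (x := emb a) (y := emb b) _).2 => k.
have -> : emb a + k%:R *: emb b = emb (a + k%:R *: b).
  by rewrite /emb map_mxD map_mxZ rmorph_nat.
exact: moment_real.
Qed.

Lemma mixed_momentE k l x y :
  'C(k + l, l)%:R * mixed_moment k l x y =
  moment (k + l) (emb pole) *
  (polar_poly (dot x x) (dot x y) (dot y y) ^+ (k + l)./2)`_l.
Proof.
have H (j : nat) := momentE (k + l) (x + j%:R *: y).
by have [/(_ l (leq_addl _ _)) + _] := moment_polarize H; rewrite addnK.
Qed.

Lemma binom_neq0 (F : numFieldType) n l : (l <= n)%N -> 'C(n, l)%:R != 0 :> F.
Proof. by move=> ln; rewrite pnatr_eq0 -lt0n bin_gt0. Qed.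

Lemma mixed_moment_form k l : exists2 G, form k l G &
  forall x y, mixed_moment k l x y = G (dot x x) (dot x y) (dot y y).
Proof.
have bn := @binom_neq0 C (k + l) l (leq_addl _ _).
exists (fun A B D => 'C(k + l, l)%:R^-1 * moment (k + l) (emb pole) *
    (polar_poly A B D ^+ (k + l)./2)`_l); last first.
  by move=> x y; rewrite -mulrA -mixed_momentE mulKf.
have [on|en] := boolP (odd (k + l)).
  by apply: form_ext (form_zero _ _) => A B D; rewrite moment_odd // mulr0 mul0r.
by apply: form_scale; apply: polar_coef_form; rewrite mul2n even_halfK.
Qed.

Lemma moment0 x : moment 0 x = 1.
Proof. by rewrite /moment; under eq_fun do rewrite expr0; exact: sphere_integral_cst. Qed.

(** Applying the Laplacian in [x] to [x |-> moment (2m+2) x] lowers the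
    degree by two, because [v.v = 1] on the sphere. *)
Lemma moment_even_rec m :
  (2 * m%:R + d%:R) * moment (2 * m.+1) (emb pole) =
  (2 * m%:R + 1) * moment (2 * m) (emb pole).
Proof.
have pp : dot (emb pole) (emb pole) = 1.
  by rewrite dot_emb; have /sphere_dot1 -> := sphere_pole; rewrite rmorph1.
have S (i : 'I_d) := mixed_momentE (2 * m) 2 (emb pole) (delta_mx i 0).
have -> : (2 * m.+1 = 2 * m + 2)%N by lia.
have dd (i : 'I_d) : dot (delta_mx i 0 : 'cV[C]_d) (delta_mx i 0) = 1.
  by rewrite dot_delta mxE !eqxx.
have halfE : ((2 * m + 2)./2 = m.+1)%N by rewrite addn2 /= mul2n doubleK.
have sumM : \sum_(i < d) mixed_moment (2 * m) 2 (emb pole) (delta_mx i 0) = moment (2 * m) (emb pole).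
  rewrite /mixed_moment -sphere_integral_sum //; last first.
    by move=> i _; apply: bounded_borel_cintegrable => //; exact: bounded_borel_mixed.
  apply: sphere_integral_ext => v sv; rewrite -mulr_sumr.
  rewrite [X in _ * X](_ : _ = dot (emb v) (emb v)).
    by rewrite (dot_emb v v); move/sphere_dot1 : sv => ->; rewrite rmorph1 mulr1.
  by apply: eq_bigr => i _; rewrite dotC dot_delta expr2.
have sumP : \sum_(i < d) (polar_poly (dot (emb pole) (emb pole))
     (dot (emb pole) (delta_mx i 0)) (dot (delta_mx i 0) (delta_mx i 0)) ^+ m.+1)`_2 =
   m.+1%:R * (d%:R + 2 * m%:R) :> C.
  have sq : \sum_(i < d) (dot (emb pole) (delta_mx i 0)) ^+ 2 = 1.
    rewrite -pp; apply: eq_bigr => i _; by rewrite dot_delta expr2.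
  case: m {S halfE sumM} => [|m].
    under eq_bigr do rewrite expr1 polar_coef2 dd.
    by rewrite sumr_const card_ord mulr0 addr0 mul1r.
  under eq_bigr do rewrite coef2X /= polar_coef0 polar_coef1 polar_coef2 dd pp !expr1n !mulr1 exprMn.
  rewrite big_split /= sumr_const card_ord -!mulr_sumr sq mulr1 -mulr_natr.
  have -> : 'C(m.+2, 2)%:R * 2 ^+ 2 = m.+2%:R * (2 * m.+1%:R) :> C.
    have := mul_bin_diag m.+2 1; rewrite bin1 => /(congr1 (fun n => n%:R : C)).
    by rewrite /= !natrM => E; rewrite expr2 mulrA -[X in X * _]mulrC -E; ring.
  by rewrite -mulr_natr; ring.
have : \sum_(i < d) 'C(2 * m + 2, 2)%:R * mixed_moment (2 * m) 2 (emb pole) (delta_mx i 0) =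
    moment (2 * m + 2) (emb pole) * (m.+1%:R * (d%:R + 2 * m%:R)).
  rewrite -sumP mulr_sumr; apply: eq_bigr => i _.
  by rewrite S halfE.
rewrite -mulr_sumr sumM => E.
have binE : 'C(2 * m + 2, 2)%:R = m.+1%:R * (2 * m%:R + 1) :> C.
  have := mul_bin_diag (2 * m + 2) 1; rewrite bin1 => /(congr1 (fun n => n%:R : C)).
  rewrite !natrM addn2 /= => E'.
  apply: (@mulfI _ 2); first by rewrite pnatr_eq0.
  by rewrite -E' -!natr1 natrM; ring.
apply: (@mulfI _ m.+1%:R); first by rewrite pnatr_eq0.
by rewrite [RHS]mulrA -binE E; ring.
Qed.

(** For null vectors [z] and [w], the integral of [(z.v)^n (w.v)^n] over the
    unit vectors [v] is this multiple of [(z.w)^n]. *)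
Definition null_const n : R := n`!%:R / (2 ^+ n * poch d n).

Lemma poch_gt0 n : (0 < d)%N -> 0 < poch d n :> R.
Proof.
move=> d0; apply: prodr_gt0 => i _.
by rewrite ltr_wpDr // divr_gt0 // ltr0n.
Qed.

Lemma moment_even n : (0 < d)%N ->
  moment (2 * n) (emb pole) * 2 ^+ n = 'C(2 * n, n)%:R * real_complex R (null_const n).
Proof.
move=> d0; elim: n => [|n IH].
  by rewrite muln0 moment0 bin0 /null_const poch0 fact0 expr0 !mulr1 divr1 rmorph1 mulr1.
have dn : 2 * n%:R + d%:R != 0 :> C.
  by rewrite -natrM -natrD pnatr_eq0; lia.
apply: (mulfI dn); rewrite mulrA moment_even_rec -mulrA exprS [_ * (2 * _)]mulrCA IH.
have binS2 : 'C(2 * n.+1, n.+1)%:R * n.+1%:R = 2 * (2 * n%:R + 1) * 'C(2 * n, n)%:R :> C.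
  have E1 := mul_bin_diag (2 * n + 1).+1 n; have E2 := mul_bin_down (2 * n + 1) n.
  have := congr1 (fun k => k%:R : C) E1; have := congr1 (fun k => k%:R : C) E2.
  have -> : (2 * n.+1 = (2 * n + 1).+1)%N by lia.
  have -> : (2 * n + 1 - n = n.+1)%N by lia.
  rewrite /= !natrM; have -> : ((2 * n + 1).-1 = 2 * n)%N by lia.
  move=> F2 F1.
  have nn : n.+1%:R != 0 :> C by rewrite pnatr_eq0.
  apply: (mulfI nn).
  transitivity ((2 * n + 1).+1%:R * (n.+1%:R * 'C(2 * n + 1, n)%:R) : C).
    by rewrite [_ * n.+1%:R]mulrC -F1; ring.
  by rewrite -F2 -[(2 * n + 1).+1%:R]natr1 natrD natrM -natr1; ring.
have cS : real_complex R (null_const n.+1) * (2 * n%:R + d%:R) =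
    n.+1%:R * real_complex R (null_const n).
  have -> : 2 * n%:R + d%:R = real_complex R (2 * n%:R + d%:R) :> C.
    by rewrite rmorphD rmorphM /= !rmorph_nat.
  have -> : n.+1%:R = real_complex R n.+1%:R :> C by rewrite rmorph_nat.
  rewrite -!(rmorphM (real_complex R)); congr (real_complex R _).
  rewrite /null_const pochS exprS factSr.
  have p0 := poch_gt0 n d0.
  have q0 : (d%:R / 2 + n%:R : R) != 0.
    by rewrite gt_eqF // ltr_wpDr // divr_gt0 // ltr0n.
  move: p0 q0; move: (poch d n) => P p0 q0.
  have q1 : d%:R + 2 * n%:R != 0 :> R by rewrite -natrM -natrD pnatr_eq0; lia.
  by field; rewrite (gt_eqF p0) /= expf_neq0 //= mulrC.
have nn : n.+1%:R != 0 :> C by rewrite pnatr_eq0.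
apply: (mulfI nn).
transitivity ('C(2 * n.+1, n.+1)%:R * n.+1%:R * (real_complex R (null_const n.+1) * (2 * n%:R + d%:R)));
  last by ring.
by rewrite binS2 cS; ring.
Qed.

(** For null vectors [(z + sw).(z + sw) = 2 s z.w], whose powers are monomials
    in [s]; this forces the two degrees to agree. *)
Lemma mixed_moment_null k l z w : (0 < d)%N -> dot z z = 0 -> dot w w = 0 ->
  mixed_moment k l z w = (real_complex R (null_const k) * dot z w ^+ k) *+ (k == l).
Proof.
move=> d0 z0 w0.
have bn := @binom_neq0 C (k + l) l (leq_addl _ _).
apply: (mulfI bn); rewrite mixed_momentE z0 w0 polar_coef_null.
have [->|kl] := eqVneq k l; last first.
  have [on|en] := boolP (odd (k + l)); first by rewrite moment_odd // mul0r mulr0.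
  rewrite mulr0n mulr0 (_ : (l == _) = false) ?mulr0n ?mulr0 //.
  by apply: contraNF kl => /eqP E; apply/eqP; have := even_halfK en; rewrite -E; lia.
rewrite addnn doubleK eqxx !mulr1n -mul2n exprMn mulrA moment_even //.
by rewrite mulrA.
Qed.

End Moments.

(** * Averages over null vectors *)

Section FrameAverage.
Context {R : realType} {d : nat} (mu : probability (borelRd R d) R).
Hypothesis d3 : (3 <= d)%N.
Hypothesis mu_sphere : mu (@sphere R d : set (borelRd R d)) = 1%E.
Hypothesis mu_invariant : forall (g : 'M[R]_d) (A : set (borelRd R d)), SO g ->
  measurable A -> mu ((fun x : 'cV[R]_d => g *m x) @` A : set (borelRd R d)) = mu A.
Variable pole : 'cV[R]_d.
Hypothesis sphere_pole : sphere pole.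
Hypothesis rotations : forall nu, sphere nu -> exists2 g, SO g & g *m pole = nu.

Local Notation C := R[i].
Local Notation toC := (real_complex R).
Local Notation nc := (@null_const R d).
Implicit Types (x y v w : 'cV[C]_d) (n m k : nat).

(** A weighted finite family of null vectors [z i], with conjugates [zc i], as
    given by a quadrature rule on orthonormal pairs.  Up to degree [L] its
    averages are rotation-invariant. *)
Variables (I : finType) (z zc : I -> 'cV[C]_d) (wt : I -> R) (L : nat).
Hypothesis z_null : forall i, dot (z i) (z i) = 0.
Hypothesis zc_null : forall i, dot (zc i) (zc i) = 0.
Hypothesis z_zc : forall i, dot (z i) (zc i) = 2.
Hypothesis z_conj : forall i (x : 'cV[R]_d), conjc (dot (z i) (emb x)) = dot (zc i) (emb x).
Hypothesis sum_wt : \sum_i wt i = 1.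

Definition avg n m x y : C := \sum_i toC (wt i) * (dot (z i) x ^+ n * dot (zc i) y ^+ m).

Hypothesis avg_form : forall n m, (n + m <= L)%N ->
  exists2 G, form n m G & forall x y, avg n m x y = G (dot x x) (dot x y) (dot y y).

Lemma d_gt0 : (0 < d)%N. Proof. lia. Qed.

Lemma dot_sphere (x : 'cV[R]_d) : sphere x -> dot (emb x) (emb x) = 1.
Proof. by move=> /sphere_dot1 E; rewrite dot_emb E rmorph1. Qed.

(** By invariance the average is a multiple [c (v.v)^(n/2)]; integrating over
    real unit [v] gives [c = 0], since each [v |-> (z.v)^n] is harmonic. *)
Lemma avg_single_eq0 n v : (0 < n <= L)%N -> \sum_i toC (wt i) * dot (z i) v ^+ n = 0.
Proof.
move=> /andP[n0 nL]; have [|G fG GE] := @avg_form n 0; first by rewrite addn0.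
have [c cE] := form_single fG erefl.
have E x : \sum_i toC (wt i) * dot (z i) x ^+ n = c * dot x x ^+ n./2.
  have := GE x 0; rewrite cE => <-.
  by apply: eq_bigr => i _; rewrite expr0 mulr1.
suff c0 : c = 0 by rewrite E c0 mul0r.
have <- : sphere_integral mu (fun x : 'cV[R]_d => \sum_i toC (wt i) * dot (z i) (emb x) ^+ n) = c.
  rewrite -[RHS](sphere_integral_cst mu_sphere); apply: sphere_integral_ext => x sx.
  by rewrite E dot_sphere // expr1n mulr1.
have bz i := bounded_borelX n (bounded_borel_dot (z i)).
rewrite sphere_integral_sum //; last first.
  move=> i _; apply: bounded_borel_cintegrable => //.
  by apply: bounded_borelM => //; exact: bounded_borel_cst.
rewrite big1 // => i _; rewrite sphere_integralZ; last exact: bounded_borel_cintegrable.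
rewrite -/(moment mu n (z i)) (momentE mu_sphere mu_invariant sphere_pole rotations) z_null.
case: n n0 {nL fG cE E bz GE} => [//|[|n]] _; last by rewrite /= expr0n !mulr0.
by rewrite (moment_odd mu_invariant sphere_pole rotations) // mul0r mulr0.
Qed.

(** Polarization of the case of a single vector. *)
Lemma avg_zz_eq0 n m x y : (0 < n + m <= L)%N ->
  \sum_i toC (wt i) * (dot (z i) x ^+ n * dot (z i) y ^+ m) = 0.
Proof.
move=> nmL; set N := (n + m)%N in nmL *.
pose a l := \sum_i toC (wt i) * (dot (z i) x ^+ (N - l) * dot (z i) y ^+ l).
pose P : {poly C} := \poly_(l < N.+1) ('C(N, l)%:R * a l).
have P0 : P = 0.
  apply: poly_nat_eq0 => k; rewrite horner_poly -[RHS](avg_single_eq0 (x + k%:R *: y) nmL).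
  transitivity (\sum_(l < N.+1) \sum_i toC (wt i) *
      (dot (z i) x ^+ (N - l) * (k%:R * dot (z i) y) ^+ l *+ 'C(N, l))).
    apply: eq_bigr => l _; rewrite /a mulr_sumr mulr_suml; apply: eq_bigr => i _.
    by rewrite exprMn -mulr_natl; ring.
  rewrite exchange_big; apply: eq_bigr => i _.
  by rewrite -mulr_sumr dotDr dotZr exprDn.
have := congr1 (fun p : {poly C} => p`_m) P0.
rewrite coef_poly ltnS leq_addl coef0 => /eqP; rewrite mulf_eq0.
by rewrite (negbTE (binom_neq0 _ (leq_addl _ _))) /= /a addnK => /eqP.
Qed.

Lemma avg_conj n m (x y : 'cV[R]_d) :
  avg n m (emb x) (emb y) = conjc (avg m n (emb y) (emb x)).
Proof.
have z_conj' i (u : 'cV[R]_d) : conjc (dot (zc i) (emb u)) = dot (z i) (emb u).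
  by rewrite -z_conj conjcK.
have cM (a b : C) : conjc (a * b) = conjc a * conjc b := rmorphM (@conjc R) a b.
have cX (a : C) k : conjc (a ^+ k) = conjc a ^+ k := rmorphXn (@conjc R) k a.
have cS (F : I -> C) : conjc (\sum_i F i) = \sum_i conjc (F i) := rmorph_sum (@conjc R) _ _ F.
rewrite /avg cS; apply: eq_bigr => i _.
by rewrite !cM !cX z_conj z_conj' conjc_real [_ ^+ n * _]mulrC.
Qed.

(** The diagonal is constant on the sphere, hence equal to its mean, which is a
    moment of the null vectors [z] and [zc]. *)
Lemma avg_diag_value n (x : 'cV[R]_d) : (2 * n <= L)%N -> sphere x ->
  avg n n (emb x) (emb x) = toC (nc n * 2 ^+ n).
Proof.
move=> nL sx; have [|G fG GE] := @avg_form n n; first by lia.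
have E (y : 'cV[R]_d) : sphere y -> avg n n (emb y) (emb y) = G 1 1 1.
  by move=> sy; rewrite GE dot_sphere.
rewrite E // -[LHS](sphere_integral_cst mu_sphere).
rewrite -(@sphere_integral_ext _ _ mu (fun y : 'cV[R]_d => avg n n (emb y) (emb y))); last exact: E.
have bz i := bounded_borel_mixed n n (z i) (zc i).
rewrite sphere_integral_sum //; last first.
  move=> i _; apply: bounded_borel_cintegrable => //.
  by apply: bounded_borelM => //; exact: bounded_borel_cst.
under eq_bigr => i _.
  rewrite sphere_integralZ; last exact: bounded_borel_cintegrable.
  rewrite -/(mixed_moment mu n n (z i) (zc i)).
  rewrite (mixed_moment_null mu_sphere mu_invariant sphere_pole rotations) ?d_gt0 //.
  rewrite eqxx mulr1n z_zc; over.
rewrite -mulr_suml -rmorph_sum sum_wt rmorph1 mul1r.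
by rewrite [RHS]rmorphM rmorphXn /= rmorph_nat.
Qed.

(** The coefficient of [s^2] after [y := y + s e], summed over the basis: the
    Laplacian in [y], which kills [y |-> (zc.y)^n]. *)
Lemma avg_harmonic n (q : nat -> C) :
  (forall x y, avg n n x y = \sum_(k < n.+1 | (2 * k <= n)%N)
     q k * dot x y ^+ (n - 2 * k) * (dot x x * dot y y) ^+ k) ->
  forall k, (2 * k.+1 <= n)%N ->
    q k.+1 * ((2 * k%:R + 2) * (2 * k%:R + 2 * (n - 2 * k.+1)%:R + d%:R)) =
    - (((n - 2 * k.+1)%:R + 2) * ((n - 2 * k.+1)%:R + 1)) * q k.
Proof.
move=> qE.
pose q' k := if (2 * k <= n)%N then q k else 0.
have qE' x y : avg n n x y = \sum_(k < n.+1)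
     q' k * dot x y ^+ (n - 2 * k) * (dot x x * dot y y) ^+ k.
  rewrite qE big_mkcond; apply: eq_bigr => k _; rewrite /q'.
  by case: ifP => // _; rewrite !mul0r.
have lap x y : dot x x = 1 -> \sum_(k < n.+1) q' k *
    (k%:R * (d%:R + 2 * k.-1%:R + 2 * (n - 2 * k)%:R) * dot x y ^+ (n - 2 * k) * dot y y ^+ k.-1
     + 'C(n - 2 * k, 2)%:R * dot x y ^+ (n - 2 * k).-2 * dot y y ^+ k) = 0.
  move=> xx.
  pose Lp (j : 'I_d) : {poly C} := \sum_i (toC (wt i) * dot (z i) x ^+ n) *:
    ((dot (zc i) y)%:P + (zc i j 0)%:P * 'X) ^+ n.
  pose Rp (j : 'I_d) : {poly C} := \sum_(k < n.+1) q' k *: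
    (((dot x y)%:P + (x j 0)%:P * 'X) ^+ (n - 2 * k) * polar_poly (dot y y) (y j 0) 1 ^+ k).
  have LR j : Lp j = Rp j.
    apply: poly_nat_ext => s; rewrite /Lp /Rp !horner_sum.
    have dy u : dot u (y + s%:R *: delta_mx j 0) = dot u y + u j 0 * s%:R.
      by rewrite dotDr dotZr dot_delta mulrC.
    transitivity (avg n n x (y + s%:R *: delta_mx j 0)).
      apply: eq_bigr => i _; rewrite hornerZ horner_exp !hornerE -dy.
      by [].
    rewrite qE'; apply: eq_bigr => k _.
    rewrite hornerZ hornerM !horner_exp polar_poly_horner !hornerE dy xx !mul1r.
    rewrite dot_polar dot_delta dot_delta mxE !eqxx mul1r -mulrA.
    exact: mulrA.
  have c0 (a b : C) : (a%:P + b%:P * 'X)`_0 = a.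
    by rewrite coefD coefC coefCM coefX mulr0 addr0.
  have c1 (a b : C) : (a%:P + b%:P * 'X)`_1 = b.
    by rewrite coefD coefC coefCM coefX mulr1 add0r.
  have c2 (a b : C) : (a%:P + b%:P * 'X)`_2 = 0.
    by rewrite coefD coefC coefCM coefX mulr0 addr0.
  have L0 : \sum_(j < d) (Lp j)`_2 = 0.
    rewrite /Lp; under eq_bigr do rewrite coef_sum; rewrite exchange_big big1 // => i _ /=.
    under eq_bigr do rewrite coefZ coef2X c0 c1 c2 mulr0 add0r mulrA.
    rewrite -mulr_sumr [X in _ * X](_ : _ = 0) ?mulr0 //.
    transitivity (dot (zc i) (zc i)); last exact: zc_null.
    by apply: eq_bigr => j _; rewrite expr2.
  transitivity (\sum_(j < d) (Lp j)`_2); last exact: L0.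
  under [RHS]eq_bigr do rewrite LR.
  rewrite /Rp; under [RHS]eq_bigr do rewrite coef_sum.
  rewrite exchange_big /=; apply: eq_bigr => k _.
  under [RHS]eq_bigr do rewrite coefZ.
  rewrite -mulr_sumr; congr (_ * _).
  under eq_bigr do rewrite coef2M !coef0X !coef1X !coef2X c0 c1 c2
     polar_coef0 polar_coef1 polar_coef2 mulr0 add0r mulr1.
  set a := (n - 2 * k)%N; set B := dot x y; set D := dot y y.
  have -> : \sum_(j < d) (B ^+ a * (k%:R * D ^+ k.-1 + 'C(k, 2)%:R * D ^+ k.-2 * (2 * y j 0) ^+ 2)
      + a%:R * B ^+ a.-1 * x j 0 * (k%:R * D ^+ k.-1 * (2 * y j 0))
      + 'C(a, 2)%:R * B ^+ a.-2 * x j 0 ^+ 2 * D ^+ k) =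
    B ^+ a * (k%:R * D ^+ k.-1 * d%:R + 4 * 'C(k, 2)%:R * D ^+ k.-2 * D)
      + 2 * a%:R * B ^+ a.-1 * k%:R * D ^+ k.-1 * B
      + 'C(a, 2)%:R * B ^+ a.-2 * D ^+ k.
    have sx2 : \sum_(j < d) x j 0 ^+ 2 = 1.
      by rewrite -xx; apply: eq_bigr => j _; rewrite expr2.
    have sy2 : \sum_(j < d) y j 0 ^+ 2 = D.
      by apply: eq_bigr => j _; rewrite expr2.
    rewrite !big_split /=; congr (_ + _ + _).
    - rewrite -mulr_sumr big_split /= sumr_const card_ord -[_ *+ d]mulr_natr; congr (_ * (_ + _)).
      by rewrite -sy2 mulr_sumr; apply: eq_bigr => j _; ring.
    - rewrite /B /dot mulr_sumr; apply: eq_bigr => j _; ring.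
    - by rewrite -[RHS]mulr1 -sx2 mulr_sumr; apply: eq_bigr => j _; ring.
  have -> : 4 * 'C(k, 2)%:R * D ^+ k.-2 * D = k%:R * (2 * k.-1%:R) * D ^+ k.-1.
    case: (val k) => [|[|k']]; [by rewrite bin_small // !(mulr0, mul0r)|by rewrite bin_small // !(mulr0, mul0r)|].
    have := mul_bin_diag k'.+2 1; rewrite bin1 => /(congr1 (fun n => n%:R : C)).
    rewrite !natrM => E.
    transitivity (2 * (2 * 'C(k'.+2, 2)%:R) * D ^+ k' * D); first by rewrite /=; ring.
    by rewrite -E /= exprS; ring.
  have -> : 2 * a%:R * B ^+ a.-1 * k%:R * D ^+ k.-1 * B = 2 * a%:R * k%:R * B ^+ a * D ^+ k.-1.
    by case: a => [|a']; rewrite ?(mulr0, mul0r) //= exprS; ring.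
  by rewrite -/a; ring.
(* Two coordinate directions give [x.y = 1] with infinitely many values of [y.y]. *)
have d1 : (1 < d)%N by lia.
pose e0 : 'cV[C]_d := delta_mx (Ordinal d_gt0) 0.
pose e1 : 'cV[C]_d := delta_mx (Ordinal d1) 0.
have e00 : dot e0 e0 = 1 by rewrite dot_delta mxE !eqxx.
have e11 : dot e1 e1 = 1 by rewrite dot_delta mxE !eqxx.
have e01 : dot e0 e1 = 0 by rewrite dot_delta mxE.
pose ck k : C := k%:R * (d%:R + 2 * k.-1%:R + 2 * (n - 2 * k)%:R).
pose Q : {poly C} := \sum_(k < n.+1) q' k *: (ck k *: 'X^(k.-1) + 'C(n - 2 * k, 2)%:R *: 'X^k).
have Q0 : Q = 0.
  apply: (@poly_inj_eq0 _ (fun j => 1 + (j ^ 2)%:R)) => [i j /addrI /eqP|j].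
    by rewrite eqr_nat eqn_exp2r // => /eqP.
  rewrite -[RHS](lap e0 (e0 + j%:R *: e1) e00) horner_sum; apply: eq_bigr => k _.
  rewrite dot_polar dotDr dotZr e00 e01 e11 !(mulr0, addr0, mul0r, mul1r) !expr1n !mulr1.
  by rewrite hornerZ hornerD !hornerZ !hornerXn natrX.
move=> k kn.
have ltk : (k.+1 < n.+1)%N by lia.
have ltk' : (k < n.+1)%N by lia.
have := congr1 (fun p : {poly C} => p`_k) Q0.
rewrite /Q coef_sum coef0.
under eq_bigr do rewrite coefZ coefD !coefZ !coefXn mulrDr.
rewrite big_split /= (bigD1 (Ordinal ltk)) //= eqxx mulr1 big1 ?addr0; last first.
  move=> i ik; have [ki|] := eqVneq k i.-1; last by rewrite !mulr0.
  have i0 : i = 0%N :> nat.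
    by apply/eqP; apply: contraNT ik => i0; apply/eqP/val_inj; rewrite /= ki prednK // lt0n.
  by rewrite /ck i0 !mul0r mulr0.
rewrite (bigD1 (Ordinal ltk')) //= eqxx mulr1 big1 ?addr0; last first.
  move=> i ik; rewrite (_ : (k == i) = false) ?mulr0 //.
  by apply: contraNF ik => /eqP ki; apply/eqP/val_inj.
have -> : (n - 2 * k = (n - 2 * k.+1).+2)%N by lia.
rewrite /q' kn (_ : (2 * k <= n)%N); last by lia.
rewrite /ck /=; set a := (n - 2 * k.+1)%N => E.
have binE : 2 * 'C(a.+2, 2)%:R = (a%:R + 2) * (a%:R + 1) :> C.
  have := mul_bin_diag a.+2 1; rewrite bin1 => /(congr1 (fun n => n%:R : C)).
  by rewrite /= !natrM => <-; rewrite -!natr1; ring.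
have E2 : 2 * (q k.+1 * (k.+1%:R * (d%:R + 2 * k%:R + 2 * a%:R)) + q k * 'C(a.+2, 2)%:R) = 0.
  by rewrite E mulr0.
apply/eqP; rewrite -subr_eq0 -E2 -binE -natr1; apply/eqP; ring.
Qed.

(** The averaged kernel is the zonal polynomial: its coefficients satisfy the
    same two-term recursion, and its value on the diagonal fixes the factor. *)
Lemma avg_coef n : (2 * n <= L)%N -> exists2 q : nat -> C,
  forall x y, avg n n x y = \sum_(k < n.+1 | (2 * k <= n)%N)
     q k * dot x y ^+ (n - 2 * k) * (dot x x * dot y y) ^+ k &
  forall k, (2 * k <= n)%N ->
    q k = toC (nc n * 2 ^+ n / dimH R d n * zonal_coef d k (n - 2 * k)).
Proof.
move=> nL; have [|G fG GE] := @avg_form n n; first by lia.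
have [q Gq] := form_diag fG erefl.
have qE x y : avg n n x y = \sum_(k < n.+1 | (2 * k <= n)%N)
     q k * dot x y ^+ (n - 2 * k) * (dot x x * dot y y) ^+ k by rewrite GE Gq.
exists q => //.
have z0 : zonal_coef d 0 n != 0 :> R.
  rewrite zonal_coef_lead mulf_neq0 ?invr_neq0 ?fact_neq0 //.
  by rewrite mulf_neq0 ?expf_neq0 // gt_eqF // poch_gt0 // d_gt0.
have z0C : toC (zonal_coef d 0 n) != 0 by rewrite fmorph_eq0.
have ratio k : (2 * k <= n)%N ->
    q k = q 0%N / toC (zonal_coef d 0 n) * toC (zonal_coef d k (n - 2 * k)).
  elim: k => [_|k IH kn]; first by rewrite muln0 subn0 divfK.
  have H := avg_harmonic qE kn; have := @zonal_coef_rec R d k (n - 2 * k.+1).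
  have -> : ((n - 2 * k.+1).+2 = n - 2 * k)%N by lia.
  set a := (n - 2 * k.+1)%N in H *; move=> /(congr1 toC) Z.
  have fac : (2 * k%:R + 2) * (2 * k%:R + 2 * a%:R + d%:R) != 0 :> C.
    by rewrite -!natrM -!natrD -natrM pnatr_eq0; have := d_gt0; lia.
  apply: (mulIf fac); rewrite H IH; last by lia.
  rewrite -[RHS]mulrA.
  have -> : toC (zonal_coef d k.+1 a) * ((2 * k%:R + 2) * (2 * k%:R + 2 * a%:R + d%:R)) =
     toC (zonal_coef d k.+1 a * ((2 * k%:R + 2) * (2 * k%:R + 2 * a%:R + d%:R))).
    by rewrite !(rmorphM toC) !(rmorphD toC) !(rmorphM toC) !(rmorph_nat toC).
  rewrite Z (rmorphM toC) (rmorphN toC) (rmorphM toC) !(rmorphD toC) !(rmorph_nat toC).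
  ring.
have sp := avg_diag_value nL sphere_pole.
have dH : dimH R d n != 0.
  rewrite -zonal_at1 //; apply/eqP => Z1.
  move: sp; rewrite qE !dot_sphere //.
  under eq_bigr => k kn do rewrite ratio // !(expr1n, mulr1).
  rewrite -mulr_sumr.
  have -> : \sum_(k < n.+1 | (2 * k <= n)%N) toC (zonal_coef d k (n - 2 * k)) = 0.
    transitivity (toC (zonal d n 1)); last by rewrite Z1.
    rewrite /zonal (rmorph_sum toC); apply: eq_bigr => k _.
    by rewrite expr1n mulr1.
  rewrite mulr0 => /esym/eqP; rewrite fmorph_eq0 /null_const mulf_eq0 mulf_eq0.
  rewrite (negbTE (fact_neq0 _)) invr_eq0 mulf_eq0 !expf_eq0 pnatr_eq0 /= !andbF /=.
  by rewrite gt_eqF // poch_gt0 // d_gt0.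
have q0E : q 0%N / toC (zonal_coef d 0 n) = toC (nc n * 2 ^+ n / dimH R d n).
  move: sp; rewrite qE !dot_sphere //.
  under eq_bigr => k kn do rewrite ratio // !(expr1n, mulr1).
  rewrite -mulr_sumr.
  have -> : \sum_(k < n.+1 | (2 * k <= n)%N) toC (zonal_coef d k (n - 2 * k)) = toC (dimH R d n).
    rewrite -zonal_at1 // /zonal (rmorph_sum toC); apply: eq_bigr => k _.
    by rewrite expr1n mulr1.
  have dHC : toC (dimH R d n) != 0 by rewrite fmorph_eq0.
  by move=> E; apply: (mulIf dHC); rewrite E -(rmorphM toC) divfK.
by move=> k kn; rewrite ratio // q0E [RHS](rmorphM toC).
Qed.

Lemma avg_zonal n (x y : 'cV[R]_d) : (2 * n <= L)%N -> sphere x -> sphere y ->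
  avg n n (emb x) (emb y) = toC (nc n * 2 ^+ n / dimH R d n * zonal d n (dot x y)).
Proof.
move=> nL sx sy; have [q qE qz] := avg_coef nL.
rewrite qE !dot_sphere // dot_emb /zonal mulr_sumr [RHS](rmorph_sum toC).
apply: eq_bigr => k kn; rewrite qz // mulr1 expr1n mulr1 -(rmorphXn toC) -(rmorphM toC).
by rewrite mulrA.
Qed.

(** For null [w] only the leading monomial of the form survives. *)
Lemma avg_null_right n x w : (2 * n <= L)%N -> dot w w = 0 ->
  avg n n x w = toC (2 ^+ n / dimH R d n) * dot x w ^+ n.
Proof.
move=> nL w0; have [q qE qz] := avg_coef nL.
rewrite qE w0 mulr0 big_mkcond big_ord_recl /= muln0 subn0 mulr1 big1 => [|k _]; last first.
  by case: ifP => // _; rewrite expr0n /= mulr0.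
rewrite addr0 qz // muln0 subn0 zonal_coef_lead /null_const; congr (toC _ * _).
have := fact_neq0 (R := R) n; have := @poch_gt0 R d n d_gt0.
have : 2 ^+ n != 0 :> R by rewrite expf_neq0.
move: (2 ^+ n) (poch d n) (n`!%:R) (dimH R d n)^-1 => a b c e a0 b0 c0.
by field; rewrite c0 a0 gt_eqF.
Qed.

(** For [n < m] the average vanishes when the second argument is null, and
    null vectors suffice because [avg m m] reproduces [(zc.y)^m]. *)
Lemma avg_orth_lt n m x y : (n < m)%N -> (2 * m <= L)%N -> dimH R d m != 0 ->
  avg n m x y = 0.
Proof.
move=> nm mL dm.
have k0 : toC (2 ^+ m / dimH R d m) != 0.
  by rewrite fmorph_eq0 mulf_neq0 ?invr_neq0 ?expf_neq0.
have null_case w : dot w w = 0 -> avg n m x w = 0.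
  move=> w0; have [|G fG GE] := @avg_form n m; first by lia.
  by rewrite GE w0; exact: form_null_lt fG nm _ _.
apply: (mulfI k0); rewrite mulr0 /avg mulr_sumr.
under eq_bigr => i _.
  rewrite mulrCA [X in _ * X]mulrCA (dotC (zc i) y) -avg_null_right //.
  over.
rewrite /avg; under eq_bigr do rewrite !mulr_sumr.
rewrite exchange_big big1 //= => i _.
transitivity (toC (wt i) * dot (z i) y ^+ m * avg n m x (zc i)); last by rewrite null_case ?mulr0.
rewrite /avg mulr_sumr; apply: eq_bigr => k _.
by rewrite (dotC (zc k) (zc i)); ring.
Qed.

Lemma dimH_gt0 n : 0 < dimH R d n.
Proof.
rewrite /dimH divr_gt0 // ltr0n muln_gt0 !fact_gt0 ?andbT //=; lia.
Qed.

Lemma avg_orth n m (x y : 'cV[R]_d) : n != m -> (2 * n <= L)%N -> (2 * m <= L)%N ->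
  avg n m (emb x) (emb y) = 0.
Proof.
rewrite neq_ltn => /orP[nm|mn] nL mL; first by rewrite avg_orth_lt // gt_eqF // dimH_gt0.
by rewrite avg_conj avg_orth_lt ?conjc0 // gt_eqF // dimH_gt0.
Qed.

Lemma bounded_borel_zonal n (x : 'cV[R]_d) :
  bounded_borel (fun y : 'cV[R]_d => toC (zonal d n (dot x y))).
Proof.
have -> : (fun y : 'cV[R]_d => toC (zonal d n (dot x y))) =
  (fun y : 'cV[R]_d => \sum_(k < n.+1 | (2 * k <= n)%N) toC (zonal_coef d k (n - 2 * k)) *
     dot (emb x) (emb y) ^+ (n - 2 * k)).
  apply/funext => y; rewrite /zonal (rmorph_sum toC); apply: eq_bigr => k _.
  by rewrite (rmorphM toC) (rmorphXn toC) dot_emb.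
apply: bounded_borel_sum => k _; apply: bounded_borelM; first exact: bounded_borel_cst.
by apply: bounded_borelX; exact: bounded_borel_dot.
Qed.

(** Both factors are averages over the frame, so the integral is a double
    average of moments of the null vectors [zc i] and [z k].  These vanish
    unless the degrees agree, and then the two averages can be carried out one
    after the other. *)
Lemma zonal_convolution n m (x u : 'cV[R]_d) : (2 * n <= L)%N -> (2 * m <= L)%N ->
  sphere x -> sphere u ->
  sphere_integral mu (fun y : 'cV[R]_d => toC (zonal d n (dot x y)) * toC (zonal d m (dot y u))) =
  toC (zonal d n (dot x u)) *+ (n == m).
Proof.
move=> nL mL sx su.
pose b n := nc n * 2 ^+ n / dimH R d n.
have b0 k : toC (b k) != 0.
  rewrite fmorph_eq0 /b /null_const !mulf_neq0 ?invr_neq0 ?expf_neq0 ?fact_neq0 //.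
  - by rewrite mulf_neq0 ?expf_neq0 // gt_eqF // poch_gt0 // d_gt0.
  - by rewrite gt_eqF // dimH_gt0.
have bZ : bounded_borel (fun y : 'cV[R]_d => toC (zonal d n (dot x y)) * toC (zonal d m (dot y u))).
  apply: bounded_borelM; first exact: bounded_borel_zonal.
  by under eq_fun do rewrite dotC; exact: bounded_borel_zonal.
have bZ' := bounded_borelM (bounded_borel_cst (toC (b n))) bZ.
apply: (mulfI (b0 n)); apply: (mulfI (b0 m)).
rewrite -sphere_integralZ; last exact: bounded_borel_cintegrable.
rewrite -sphere_integralZ; last exact: bounded_borel_cintegrable.
rewrite (@sphere_integral_ext _ _ _ _ (fun y : 'cV[R]_d => avg n n (emb x) (emb y) * avg m m (emb y) (emb u)));
  last first.
  by move=> y sy; rewrite !avg_zonal // -/(b n) -/(b m) (rmorphM toC (b n)) (rmorphM toC (b m)); ring.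
pose F (i k : I) (y : 'cV[R]_d) : C := (toC (wt i) * dot (z i) (emb x) ^+ n * (toC (wt k) * dot (zc k) (emb u) ^+ m)) *
  (dot (zc i) (emb y) ^+ n * dot (z k) (emb y) ^+ m).
have bF (i k : I) : bounded_borel (F i k).
  by apply: bounded_borelM; [exact: bounded_borel_cst|exact: bounded_borel_mixed].
have -> : (fun y : 'cV[R]_d => avg n n (emb x) (emb y) * avg m m (emb y) (emb u)) =
    (fun y : 'cV[R]_d => \sum_i \sum_k F i k y).
  apply/funext => y; rewrite /avg mulr_suml; apply: eq_bigr => i _.
  by rewrite mulr_sumr; apply: eq_bigr => k _; rewrite /F; ring.
rewrite sphere_integral_sum //; last first.
  by move=> i _; apply: bounded_borel_cintegrable => //; apply: bounded_borel_sum => k _; exact: bF.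
under eq_bigr => i _.
  rewrite sphere_integral_sum //; last by move=> k _; exact: bounded_borel_cintegrable.
  under eq_bigr => k _.
    rewrite /F sphere_integralZ; last first.
      by apply: bounded_borel_cintegrable => //; exact: bounded_borel_mixed.
    rewrite -/(mixed_moment mu n m (zc i) (z k)).
    rewrite (mixed_moment_null mu_sphere mu_invariant sphere_pole rotations) ?d_gt0 //.
    over.
  over.
have [<-|nm] := eqVneq n m; last first.
  by rewrite !mulr0n !mulr0 big1 // => i _; rewrite big1 // => k _; rewrite mulr0n mulr0.
rewrite !mulr1n.
transitivity (toC (nc n) * toC (2 ^+ n / dimH R d n) * avg n n (emb x) (emb u)); last first.
  rewrite avg_zonal // -/(b n) (rmorphM toC (b n)) -(rmorphM toC (nc n)).
  by congr (toC _ * _); rewrite /b mulrA.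
rewrite exchange_big /= [in RHS]/avg mulr_sumr; apply: eq_bigr => k _.
transitivity (toC (wt k) * dot (zc k) (emb u) ^+ n * toC (nc n) * avg n n (emb x) (z k)).
  rewrite /avg mulr_sumr; apply: eq_bigr => i _; rewrite mulr1n; ring.
rewrite avg_null_right // (dotC (emb x)); ring.
Qed.

End FrameAverage.

(** * Rotation-invariance of the frame averages *)

Section SphericalPoly.
Context {R : realType} {d : nat}.
Local Notation C := R[i].
Implicit Types (P Q : mpoly.mpoly d C) (n m k l : nat) (x y : 'cV[C]_d).

(** A polynomial representation on the whole space, not only on the sphere,
    with an integer bound on the degree. *)
Definition spherical_deg n (f : 'cV[R]_d -> C) := exists2 P : mpoly.mpoly d C,
  (mpoly.msize P <= n.+1)%N & forall v, f v = mpoly.meval (fun i => real_complex R (v i 0)) P.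

Lemma spherical_deg_poly n (m : R) f : n%:R <= m -> spherical_deg n f -> spherical_poly m f.
Proof.
move=> nm [P sP fP]; exists P; split=> [|x _]; last exact: fP.
by apply: le_trans nm; rewrite ler_nat; case: (mpoly.msize P) sP.
Qed.

Lemma spherical_deg_cst (c : C) : spherical_deg 0 (fun _ => c).
Proof.
exists (mpoly.mpolyC d c) => [|v]; last by rewrite mpoly.mevalC.
by rewrite mpoly.mmeasureC; case: (c != 0).
Qed.

Lemma spherical_deg_coord (i : 'I_d) :
  spherical_deg 1 (fun v => real_complex R (v i 0)).
Proof.
exists (mpoly.mpolyX C (mpoly.mnm1 i)) => [|v]; last by rewrite mpoly.mevalXU.
by rewrite mpoly.msizeX mpoly.mdeg1.
Qed.

Lemma spherical_degD n f g : spherical_deg n f -> spherical_deg n g ->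
  spherical_deg n (fun v => f v + g v).
Proof.
move=> [P sP fP] [Q sQ gQ]; exists (P + Q) => [|v]; last by rewrite mpoly.mevalD fP gQ.
by rewrite (leq_trans (mpoly.mmeasureD_le _ _ _)) // geq_max sP sQ.
Qed.

Lemma spherical_degM n m f g : spherical_deg n f -> spherical_deg m g ->
  spherical_deg (n + m) (fun v => f v * g v).
Proof.
move=> [P sP fP] [Q sQ gQ]; exists (P * Q) => [|v]; last by rewrite mpoly.mevalM fP gQ.
have [->|P0] := eqVneq P 0; first by rewrite mul0r mpoly.mmeasure0.
have [->|Q0] := eqVneq Q 0; first by rewrite mulr0 mpoly.mmeasure0.
rewrite mpoly.msizeM // -subn1 leq_subLR; apply: leq_trans (leq_add sP sQ) _; lia.
Qed.

Lemma spherical_deg_sum n (I : Type) (r : seq I) (F : I -> 'cV[R]_d -> C) :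
  (forall i, spherical_deg n (F i)) -> spherical_deg n (fun v => \sum_(i <- r) F i v).
Proof.
move=> FI; elim: r => [|i r IH].
  under eq_fun do rewrite big_nil.
  have [P sP Pv] := spherical_deg_cst 0.
  by exists P => //; exact: leq_trans sP _.
by under eq_fun do rewrite big_cons; exact: spherical_degD.
Qed.

Lemma spherical_degX n k f : spherical_deg n f -> spherical_deg (k * n) (fun v => f v ^+ k).
Proof.
move=> fn; elim: k => [|k IH]; first by under eq_fun do rewrite expr0; exact: spherical_deg_cst.
by under eq_fun do rewrite exprS; rewrite mulSn; exact: spherical_degM.
Qed.

Lemma spherical_deg_dot x : spherical_deg 1 (fun v => dot x (emb v)).
Proof.
apply: spherical_deg_sum => i.
apply: (@spherical_degM 0 1); first exact: spherical_deg_cst.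
by under eq_fun do rewrite mxE; exact: spherical_deg_coord.
Qed.

Lemma spherical_deg_mixed k l x y :
  spherical_deg (k + l) (fun v => dot x (emb v) ^+ k * dot y (emb v) ^+ l).
Proof.
rewrite -[X in (X + _)%N]muln1 -[X in (_ + X)%N]muln1.
by apply: spherical_degM; apply: spherical_degX; exact: spherical_deg_dot.
Qed.

End SphericalPoly.

Section AxialForms.
Context {F : numFieldType}.
Implicit Types (n m k l : nat) (X Y A B D c : F).

(** Polynomials in [X = a.x], [Y = a.y] and the three invariants of [x], [y],
    graded by the degrees in [x] and in [y]: the forms invariant under the
    rotations fixing [a]. *)
Inductive aform : nat -> nat -> (F -> F -> F -> F -> F -> F) -> Prop :=
| aform_zero n m : aform n m (fun _ _ _ _ _ => 0)
| aform_mono c s t i j k : aform (s + (2 * i + j)) (t + (j + 2 * k))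
    (fun X Y A B D => c * X ^+ s * Y ^+ t * A ^+ i * B ^+ j * D ^+ k)
| aform_add n m G H : aform n m G -> aform n m H ->
    aform n m (fun X Y A B D => G X Y A B D + H X Y A B D).

Lemma aform_ext n m G H : (forall X Y A B D, G X Y A B D = H X Y A B D) ->
  aform n m G -> aform n m H.
Proof.
move=> GH; have -> : H = G; last by [].
apply/funext => X; apply/funext => Y; apply/funext => A.
by apply/funext => B; apply/funext => D.
Qed.

Lemma aform_mono_eq c s t i j k n m : (n = s + (2 * i + j))%N -> (m = t + (j + 2 * k))%N ->
  aform n m (fun X Y A B D => c * X ^+ s * Y ^+ t * A ^+ i * B ^+ j * D ^+ k).
Proof. by move=> -> ->; exact: aform_mono. Qed.

Lemma aform_mul n m n' m' G H : aform n m G -> aform n' m' H ->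
  aform (n + n') (m + m') (fun X Y A B D => G X Y A B D * H X Y A B D).
Proof.
move=> fG fH; elim: fG => [{}n {}m|c s t i j k|{}n {}m {}G G' _ IG _ IG'].
- by apply: aform_ext (aform_zero _ _) => *; rewrite mul0r.
- elim: fH => [{}n' {}m'|c' s' t' i' j' k'|{}n' {}m' {}H H' _ IH _ IH'].
  + by apply: aform_ext (aform_zero _ _) => *; rewrite mulr0.
  + apply: (@aform_ext _ _ (fun X Y A B D => c * c' * X ^+ (s + s') * Y ^+ (t + t') *
        A ^+ (i + i') * B ^+ (j + j') * D ^+ (k + k'))).
      by move=> X Y A B D; rewrite !exprD; ring.
    by apply: aform_mono_eq; lia.
  + by apply: aform_ext (aform_add IH IH') => *; rewrite mulrDr.
- by apply: aform_ext (aform_add IG IG') => *; rewrite mulrDl.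
Qed.

Lemma aform_exp n m G k : aform n m G ->
  aform (k * n) (k * m) (fun X Y A B D => G X Y A B D ^+ k).
Proof.
move=> fG; elim: k => [|k IH].
  by apply: aform_ext (aform_mono 1 0 0 0 0 0) => X Y A B D; rewrite !expr0 !mulr1.
by rewrite !mulSn; apply: aform_ext (aform_mul fG IH) => X Y A B D; rewrite exprS.
Qed.

Lemma aform_sum n m (I : Type) (r : seq I) (G : I -> F -> F -> F -> F -> F -> F) :
  (forall i, aform n m (G i)) ->
  aform n m (fun X Y A B D => \sum_(i <- r) G i X Y A B D).
Proof.
move=> fG; elim: r => [|i r IH].
  by apply: aform_ext (aform_zero n m) => *; rewrite big_nil.
by apply: aform_ext (aform_add (fG i) IH) => X Y A B D; rewrite big_cons.
Qed.

(** The components of [x], [y] orthogonal to the unit vector [a] have inner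
    products [x.x - X^2], [x.y - XY] and [y.y - Y^2]. *)
Lemma aform_orth n m G : form n m G ->
  aform n m (fun X Y A B D => G (A - X ^+ 2) (B - X * Y) (D - Y ^+ 2)).
Proof.
elim=> [{}n {}m|c i j k|{}n {}m {}G H _ IG _ IH]; first exact: aform_zero.
- have fA : aform 2 0 (fun X Y A B D => A - X ^+ 2).
    apply: aform_ext (aform_add (aform_mono 1 0 0 1 0 0) (aform_mono (-1) 2 0 0 0 0)) => *.
    by rewrite /=; ring.
  have fB : aform 1 1 (fun X Y A B D => B - X * Y).
    apply: aform_ext (aform_add (aform_mono 1 0 0 0 1 0) (aform_mono (-1) 1 1 0 0 0)) => *.
    by rewrite /=; ring.
  have fD : aform 0 2 (fun X Y A B D => D - Y ^+ 2).
    apply: aform_ext (aform_add (aform_mono 1 0 0 0 0 1) (aform_mono (-1) 0 2 0 0 0)) => *.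
    by rewrite /=; ring.
  have := aform_mul (aform_mono c 0 0 0 0 0)
     (aform_mul (aform_mul (aform_exp i fA) (aform_exp j fB)) (aform_exp k fD)).
  have -> : (0 + (2 * 0 + 0) + (i * 2 + j * 1 + k * 0) = 2 * i + j)%N by lia.
  have -> : (0 + (0 + 2 * 0) + (i * 0 + j * 1 + k * 2) = j + 2 * k)%N by lia.
  by apply: aform_ext => *; ring.
- exact: aform_add IG IH.
Qed.

End AxialForms.

Section Quadrature.
Context {R : realType} {d : nat} (mu : probability (borelRd R d) R).
Hypothesis mu_sphere : mu (@sphere R d : set (borelRd R d)) = 1%E.
Hypothesis mu_invariant : forall (g : 'M[R]_d) (A : set (borelRd R d)), SO g ->
  measurable A -> mu ((fun x : 'cV[R]_d => g *m x) @` A : set (borelRd R d)) = mu A.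
Variable pole : 'cV[R]_d.
Hypothesis sphere_pole : sphere pole.
Hypothesis rotations : forall nu, sphere nu -> exists2 g, SO g & g *m pole = nu.
Variables (N L : nat) (a : 'I_N -> 'cV[R]_d) (w : 'I_N -> R).
Hypothesis exact_rule : forall f, spherical_poly L%:R f ->
  sphere_integral mu f = \sum_r real_complex R (w r) * f (a r).

Local Notation C := R[i].
Local Notation toC := (real_complex R).

Lemma quadrature_mixed k l (x y : 'cV[C]_d) : (k + l <= L)%N ->
  \sum_r toC (w r) * (dot x (emb (a r)) ^+ k * dot y (emb (a r)) ^+ l) = mixed_moment mu k l x y.
Proof.
move=> klL.
rewrite -(exact_rule (f := fun v : 'cV[R]_d => dot x (emb v) ^+ k * dot y (emb v) ^+ l)) //.
by apply: spherical_deg_poly (spherical_deg_mixed k l x y); rewrite ler_nat.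
Qed.

Lemma quadrature_weights : \sum_r w r = 1.
Proof.
have L0 : 0%:R <= L%:R :> R by rewrite ler_nat.
have := exact_rule (spherical_deg_poly L0 (spherical_deg_cst 1)).
rewrite (sphere_integral_cst mu_sphere); under eq_bigr do rewrite mulr1.
by rewrite -(rmorph_sum toC) => -[<-].
Qed.

(** Every monomial of [G] has degree at most [n + m] in the node, so that the
    rule integrates it exactly to a mixed moment. *)
Lemma quadrature_aform n m G : aform n m G -> (n + m <= L)%N ->
  exists2 H, form n m H & forall x y : 'cV[C]_d,
    \sum_r toC (w r) * G (dot x (emb (a r))) (dot y (emb (a r))) (dot x x) (dot x y) (dot y y) =
    H (dot x x) (dot x y) (dot y y).
Proof.
elim=> [{}n {}m _|c s t i j k nmL|{}n {}m {}G G' _ IG _ IG' nmL].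
- by exists (fun _ _ _ => 0) => [|x y]; [exact: form_zero|rewrite big1 // => r _; rewrite mulr0].
- have [H fH HE] := mixed_moment_form mu_sphere mu_invariant sphere_pole rotations s t.
  exists (fun A B D => H A B D * (c * A ^+ i * B ^+ j * D ^+ k)).
    exact: form_mul fH (form_mono c i j k).
  move=> x y; rewrite -HE -quadrature_mixed; last by lia.
  by rewrite mulr_suml; apply: eq_bigr => r _; ring.
- have [[H fH HE] [H' fH' HE']] := (IG nmL, IG' nmL).
  exists (fun A B D => H A B D + H' A B D); first exact: form_add.
  by move=> x y; rewrite -HE -HE' -big_split; apply: eq_bigr => r _; rewrite mulrDr.
Qed.

End Quadrature.

(** * Frames of null vectors from the two quadrature rules *)

Section Equator.
Context {R : realType} {n : nat}.
Local Notation C := R[i].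
Implicit Types (u v : 'cV[R]_n).

Lemma nth_coordE d (x : 'cV[R]_d) (i : 'I_d) : nth_coord x i = x i 0.
Proof. by rewrite /nth_coord valK. Qed.

Lemma nth_coord_out d (x : 'cV[R]_d) k : (d <= k)%N -> nth_coord x k = 0.
Proof. by move=> dk; rewrite /nth_coord insubF // ltnNge dk. Qed.

Lemma basis_vec_delta d (i : 'I_d) : basis_vec R d i = delta_mx i 0.
Proof. by apply/colP => j; rewrite !mxE andbT. Qed.

Lemma sphere_basis_vec d k : (k < d)%N -> sphere (basis_vec R d k).
Proof.
move=> kd; apply/sphere_dot1; rewrite (basis_vec_delta (Ordinal kd)) dot_delta mxE.
by rewrite !eqxx.
Qed.

Lemma sum_lift_max (V : nmodType) (F : 'I_n.+1 -> V) :
  \sum_i F i = \sum_(i < n) F (lift ord_max i) + F ord_max.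
Proof.
rewrite big_ord_recr; congr (_ + _); apply: eq_bigr => i _; congr F.
by apply: val_inj; rewrite /= /bump leqNgt ltn_ord.
Qed.

Lemma extend0_lift v (i : 'I_n) : @extend0 R n.+1 v (lift ord_max i) 0 = v i 0.
Proof.
by rewrite mxE (_ : (lift ord_max i : nat) = i) ?nth_coordE //= /bump leqNgt ltn_ord.
Qed.

Lemma extend0_max v : @extend0 R n.+1 v ord_max 0 = 0.
Proof. by rewrite mxE nth_coord_out. Qed.

Definition trunc (F : Type) (u : 'cV[F]_n.+1) : 'cV[F]_n := \col_i u (lift ord_max i) 0.

Lemma dot_trunc (F : comNzRingType) (x y : 'cV[F]_n.+1) :
  dot (trunc x) (trunc y) = dot x y - x ord_max 0 * y ord_max 0.
Proof.
by rewrite [dot x y]sum_lift_max addrK; apply: eq_bigr => i _; rewrite !mxE.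
Qed.

Lemma trunc_extend0 v : trunc (@extend0 R n.+1 v) = v.
Proof. by apply/colP => i; rewrite mxE extend0_lift. Qed.

Lemma dot_extend0 v (x : 'cV[C]_n.+1) :
  dot (emb (@extend0 R n.+1 v)) x = dot (trunc x) (emb v).
Proof.
rewrite [LHS]sum_lift_max !mxE nth_coord_out // mul0r addr0.
by apply: eq_bigr => i _; rewrite mxE extend0_lift !mxE mulrC.
Qed.

Lemma sphere_extend0 v : sphere v -> sphere (@extend0 R n.+1 v).
Proof.
move=> /sphere_dot1 v1; apply/sphere_dot1; rewrite -v1 [LHS]sum_lift_max extend0_max mulr0 addr0.
by apply: eq_bigr => i _; rewrite !extend0_lift.
Qed.

(** A rotation fixing the last basis vector has block form, so its leading
    minor is a rotation of one dimension less. *)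
Lemma SO_stab_minor (h : 'M[R]_n.+1) : SO_stab h -> SO (row' ord_max (col' ord_max h)).
Proof.
move=> [[hh dh] he]; set e := basis_vec R n.+1 n in he.
have eE : e = delta_mx ord_max 0 := basis_vec_delta ord_max.
have hTe : h^T *m e = e by rewrite -{1}he mulmxA (mulmx1C hh) mul1mx.
have col_h i : h i ord_max = (i == ord_max)%:R.
  have := congr1 (fun x : 'cV[R]_n.+1 => x i 0) he.
  by rewrite eE -colE !mxE andbT.
have row_h i : h ord_max i = (i == ord_max)%:R.
  have := congr1 (fun x : 'cV[R]_n.+1 => x i 0) hTe.
  by rewrite eE -colE !mxE andbT.
split.
  apply/matrixP => i j; rewrite !mxE.
  have := congr1 (fun A : 'M[R]_n.+1 => A (lift ord_max i) (lift ord_max j)) hh.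
  rewrite !mxE sum_lift_max !mxE col_h eq_sym (negbTE (neq_lift _ _)) mul0r addr0.
  rewrite (inj_eq lift_inj) => <-.
  by apply: eq_bigr => k _; rewrite !mxE.
rewrite -dh (expand_det_row h ord_max) (bigD1 ord_max) //= row_h eqxx mul1r big1 => [|i im].
  by rewrite addr0 /cofactor -signr_odd oddD addbb mul1r.
by rewrite row_h (negbTE im) mul0r.
Qed.

Lemma SO_stab_minor_mul (h : 'M[R]_n.+1) v :
  trunc (h *m @extend0 R n.+1 v) = row' ord_max (col' ord_max h) *m v.
Proof.
apply/colP => i; rewrite !mxE sum_lift_max extend0_max mulr0 addr0.
by apply: eq_bigr => j _; rewrite extend0_lift !mxE.
Qed.

Lemma equator_transitive (h : 'cV[R]_n -> 'M[R]_n.+1) : (0 < n)%N -> @equator_rotation R n.+1 h ->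
  forall nu, sphere nu -> exists2 g, SO g & g *m basis_vec R n n.-1 = nu.
Proof.
move=> n0 hh nu /hh[sh hE]; exists (row' ord_max (col' ord_max (h nu))).
  exact: SO_stab_minor.
rewrite -SO_stab_minor_mul -[RHS]trunc_extend0 -hE; congr trunc; congr (_ *m _).
apply/colP => i; have [j|] := unliftP ord_max i; last first.
  by move=> ->; rewrite extend0_max !mxE /= eq_sym ltn_eqF // prednK.
by move=> ->; rewrite extend0_lift !mxE /= /bump leqNgt ltn_ord.
Qed.

End Equator.

Section Frame.
Context {R : realType} {n : nat}.
Variables (mu : probability (borelRd R n.+1) R) (mu' : probability (borelRd R n) R).
Hypothesis n2 : (2 <= n)%N.
Hypothesis mu_sphere : mu (@sphere R n.+1 : set (borelRd R n.+1)) = 1%E.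
Hypothesis mu_invariant : forall (g : 'M[R]_n.+1) (A : set (borelRd R n.+1)), SO g ->
  measurable A -> mu ((fun x : 'cV[R]_n.+1 => g *m x) @` A : set (borelRd R n.+1)) = mu A.
Hypothesis mu'_sphere : mu' (@sphere R n : set (borelRd R n)) = 1%E.
Hypothesis mu'_invariant : forall (g : 'M[R]_n) (A : set (borelRd R n)), SO g ->
  measurable A -> mu' ((fun x : 'cV[R]_n => g *m x) @` A : set (borelRd R n)) = mu' A.
Variables (g : 'cV[R]_n.+1 -> 'M[R]_n.+1) (h : 'cV[R]_n -> 'M[R]_n.+1).
Hypothesis g_rotation : pole_rotation g.
Hypothesis h_rotation : @equator_rotation R n.+1 h.
Variables (N N' L : nat) (a : 'I_N -> 'cV[R]_n.+1) (w : 'I_N -> R)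
  (b : 'I_N' -> 'cV[R]_n) (w' : 'I_N' -> R).
Hypothesis sphere_a : forall r, sphere (a r).
Hypothesis sphere_b : forall s, sphere (b s).
Hypothesis exact_rule : forall f, spherical_poly L%:R f ->
  sphere_integral mu f = \sum_r real_complex R (w r) * f (a r).
Hypothesis exact_rule' : forall f, spherical_poly L%:R f ->
  sphere_integral mu' f = \sum_r real_complex R (w' r) * f (b r).

Local Notation C := R[i].
Local Notation toC := (real_complex R).
Local Notation ii := (Complex 0 1 : C).
Local Notation pole := (basis_vec R n.+1 n).

Lemma ii2 : ii * ii = -1.
Proof. by apply: complex_ext; rewrite /= ?(mulr0, mul0r, mulr1, addr0, sub0r, oppr0). Qed.

Definition tangent (i : 'I_N * 'I_N') : 'cV[R]_n.+1 :=
  g (a i.1) *m @extend0 R n.+1 (b i.2).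

(** For the node [eta] and the tangent vector [b] this is [eta + i b]: the
    rotated curvelet is a function of [x.eta] and [x.b], the coordinates of
    the rotated point that enter [x_d + i x_(d-1)]. *)
Definition frame_z i : 'cV[C]_n.+1 := emb (a i.1) + ii *: emb (tangent i).
Definition frame_zc i : 'cV[C]_n.+1 := emb (a i.1) + (- ii) *: emb (tangent i).
Definition frame_wt (i : 'I_N * 'I_N') := w i.1 * w' i.2.

Lemma SO_dot d (q : 'M[R]_d) (x y : 'cV[R]_d) : SO q -> dot (q *m x) (q *m y) = dot x y.
Proof. by move=> [qq _]; rewrite dot_mulmx mulmxA (mulmx1C qq) mul1mx. Qed.

Lemma frame_orthonormal i :
  [/\ dot (emb (a i.1)) (emb (a i.1)) = 1, dot (emb (a i.1)) (emb (tangent i)) = 0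
    & dot (emb (tangent i)) (emb (tangent i)) = 1].
Proof.
have [sg gE] := g_rotation (sphere_a i.1); rewrite !dot_emb; split.
- by have /sphere_dot1 -> := sphere_a i.1.
- rewrite /tangent -{1}gE SO_dot // (basis_vec_delta ord_max) dotC dot_delta.
  by rewrite extend0_max.
- by have /sphere_dot1 -> : sphere (tangent i) by apply: sphere_mulmx => //; exact: sphere_extend0.
Qed.

Lemma frame_z_null i : dot (frame_z i) (frame_z i) = 0.
Proof.
have [aa ab bb] := frame_orthonormal i.
by rewrite dot_polar aa ab bb expr2 ii2 mulr0 mul0r addr0 mul1r subrr.
Qed.

Lemma frame_zc_null i : dot (frame_zc i) (frame_zc i) = 0.
Proof.
have [aa ab bb] := frame_orthonormal i.
by rewrite dot_polar aa ab bb expr2 mulrNN ii2 mulr0 mul0r addr0 mul1r subrr.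
Qed.

Lemma frame_z_zc i : dot (frame_z i) (frame_zc i) = 2.
Proof.
have [aa ab bb] := frame_orthonormal i.
rewrite !(dotDl, dotDr, dotZl, dotZr) aa ab bb dotC ab !mulr0 addr0 mulr1 mulrN ii2.
by rewrite add0r opprK.
Qed.

Lemma frame_z_conj i (x : 'cV[R]_n.+1) : conjc (dot (frame_z i) (emb x)) = dot (frame_zc i) (emb x).
Proof.
rewrite !(dotDl, dotZl) !dot_emb.
by apply: complex_ext; rewrite /= ?(mulr0, mul0r, mulr1, mul1r, addr0, add0r, oppr0, subr0, mulN1r).
Qed.

Lemma sum_frame_wt : \sum_i frame_wt i = 1.
Proof.
rewrite -(pair_bigA _ (fun r s => w r * w' s)) /=.
under eq_bigr do rewrite -mulr_sumr (quadrature_weights mu'_sphere exact_rule') mulr1.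
exact: (quadrature_weights mu_sphere exact_rule).
Qed.

Let sphere_pole : sphere pole. Proof. exact: sphere_basis_vec. Qed.

Lemma pole_transitive nu : sphere nu -> exists2 q, SO q & q *m pole = nu.
Proof. by move=> /g_rotation[sq qE]; exists (g nu). Qed.

(** Averaging over the directions orthogonal to [q *m pole] only leaves the
    invariants of its stabiliser. *)
Lemma tangent_average k l : (k + l <= L)%N -> exists2 H, aform k l H &
  forall (q : 'M[R]_n.+1) x y, SO q ->
    \sum_s toC (w' s) *
      (dot (emb (q *m pole) + ii *: emb (q *m @extend0 R n.+1 (b s))) x ^+ k *
       dot (emb (q *m pole) + (- ii) *: emb (q *m @extend0 R n.+1 (b s))) y ^+ l) =
    H (dot x (emb (q *m pole))) (dot y (emb (q *m pole))) (dot x x) (dot x y) (dot y y).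
Proof.
move=> klL.
have n0 : (0 < n)%N by lia.
have sphere_pole' : sphere (basis_vec R n n.-1) by apply: sphere_basis_vec; rewrite prednK.
have [st|G GE] := @boolp.choice (nat * nat)%type (C -> C -> C -> C)
    (fun st G => form st.1 st.2 G /\ forall x y : 'cV[C]_n,
       mixed_moment mu' st.1 st.2 x y = G (dot x x) (dot x y) (dot y y)).
  have [G fG GE] := mixed_moment_form mu'_sphere mu'_invariant sphere_pole'
      (equator_transitive n0 h_rotation) st.1 st.2.
  by exists G.
pose c (s t : nat) : C := ii ^+ s * (- ii) ^+ t * 'C(k, s)%:R * 'C(l, t)%:R.
exists (fun X Y A B D => \sum_(s < k.+1) \sum_(t < l.+1)
   (c s t * X ^+ (k - s) * Y ^+ (l - t) * A ^+ 0 * B ^+ 0 * D ^+ 0) *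
     G (val s, val t) (A - X ^+ 2) (B - X * Y) (D - Y ^+ 2)).
  apply: aform_sum => s; apply: aform_sum => t.
  have [fG _] := GE (val s, val t).
  have := aform_mul (aform_mono (c s t) (k - s) (l - t) 0 0 0) (aform_orth fG).
  have -> : (k - s + (2 * 0 + 0) + (val s, val t).1 = k)%N by have := ltn_ord s; rewrite /=; lia.
  by have -> : (l - t + (0 + 2 * 0) + (val s, val t).2 = l)%N by have := ltn_ord t; rewrite /=; lia.
move=> q x y [qq _].
pose qC := map_mx toC q.
have qqC : qC *m qC^T = 1%:M by rewrite /qC map_trmx -map_mxM qq map_mx1.
pose x' := qC^T *m x; pose y' := qC^T *m y.
have dot' u v : dot (qC^T *m u) (qC^T *m v) = dot u v by rewrite dot_mulmx trmxK mulmxA qqC mul1mx.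
have max' u : (qC^T *m u) ord_max 0 = dot u (emb (q *m pole)).
  rewrite -dot_delta dot_mulmx trmxK emb_mulmx (basis_vec_delta ord_max).
  by rewrite /emb map_delta_mx.
have zE (e : C) s u : dot (emb (q *m pole) + e *: emb (q *m @extend0 R n.+1 (b s))) u =
    dot u (emb (q *m pole)) + e * dot (trunc (qC^T *m u)) (emb (b s)).
  by rewrite dotDl dotZl dotC emb_mulmx -/qC (emb_mulmx q (extend0 _)) -/qC (dot_mulmx _ (emb (extend0 _))) dot_extend0.
under eq_bigr do rewrite !zE !exprDn.
set X := dot x _; set Y := dot y _.
transitivity (\sum_(r < N') \sum_(s < k.+1) \sum_(t < l.+1) (c s t * X ^+ (k - s) * Y ^+ (l - t)) *
   (toC (w' r) * (dot (trunc x') (emb (b r)) ^+ s * dot (trunc y') (emb (b r)) ^+ t))).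
  apply: eq_bigr => r _; rewrite mulr_suml mulr_sumr; apply: eq_bigr => s _.
  rewrite mulr_sumr mulr_sumr; apply: eq_bigr => t _.
  by rewrite -(mulr_natl _ 'C(k, s)) -(mulr_natl _ 'C(l, t)) !exprMn /c; ring.
rewrite exchange_big; apply: eq_bigr => s _ /=.
rewrite exchange_big; apply: eq_bigr => t _ /=.
rewrite -mulr_sumr (quadrature_mixed exact_rule'); last first.
  by have := ltn_ord s; have := ltn_ord t; lia.
have [_ ->] := GE (val s, val t).
by rewrite !dot_trunc !dot' !max' -/X -/Y !expr0 !mulr1 -!expr2.
Qed.

Lemma frame_avg_form k l : (k + l <= L)%N -> exists2 G, form k l G &
  forall x y, avg frame_z frame_zc frame_wt k l x y = G (dot x x) (dot x y) (dot y y).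
Proof.
move=> klL; have [H fH HE] := tangent_average klL.
have [G fG GE] := quadrature_aform mu_sphere mu_invariant sphere_pole pole_transitive
  exact_rule fH klL.
exists G => // x y; rewrite -GE /avg.
rewrite -(pair_bigA _ (fun r s => toC (frame_wt (r, s)) *
  (dot (frame_z (r, s)) x ^+ k * dot (frame_zc (r, s)) y ^+ l))) /=.
apply: eq_bigr => r _.
have [sg gE] := g_rotation (sphere_a r).
rewrite -gE -(HE (g (a r))) // mulr_sumr; apply: eq_bigr => s _.
by rewrite /frame_wt /frame_z /frame_zc /tangent /= gE (rmorphM toC) mulrA.
Qed.

End Frame.

(** * The kernel of the frame operator *)

Section Cutoff.
Context {R : realType} (phi : R -> R).
Hypothesis cphi : cutoff phi.

Lemma cutoff_ge0 t : 0 <= t -> 0 <= phi t.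
Proof.
move=> t0; have [_ dec _ z] := cphi; have [t1|t1] := leP 1 t; first by rewrite z.
by rewrite -(z 1) // dec // ltW.
Qed.

(** Monotonicity of [phi] makes the radicand nonnegative. *)
Lemma kappa_sqr t : 0 <= t -> kappa phi t ^+ 2 = phi (t / 2) ^+ 2 - phi t ^+ 2.
Proof.
move=> t0; rewrite sqr_sqrtr // subr_ge0 ler_pXn2r ?nnegrE ?cutoff_ge0 ?divr_ge0 //.
by have [_ dec _ _] := cphi; apply: dec; lra.
Qed.

Lemma kappa_eq0 t : 2 <= t -> kappa phi t = 0.
Proof.
move=> t2; have [_ _ _ z] := cphi.
by rewrite /kappa !z ?expr0n ?subrr ?sqrtr0 //; lra.
Qed.

Lemma kappa0 : kappa phi 0 = 0.
Proof. by rewrite /kappa mul0r subrr sqrtr0. Qed.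

Context {d : nat}.
Hypothesis d3 : (3 <= d)%N.

(** The coefficients of the curvelet in the powers of [x_d + i x_(d-1)]. *)
Definition curvelet_coef j k : R :=
  Num.sqrt (dimH R d k) * kappa phi (k%:R / 2 ^+ j) * A_ R d k.

Lemma curvelet_coef_eq0 j k : (2 ^ j.+1 <= k)%N -> curvelet_coef j k = 0.
Proof.
move=> jk; rewrite /curvelet_coef kappa_eq0 ?mulr0 ?mul0r //.
by rewrite ler_pdivlMr ?exprn_gt0 // -exprS -natrX ler_nat.
Qed.

Lemma curveletE j (x : 'cV[R]_d) : curvelet phi j.+1 x = real_complex R (Num.sqrt 2 *
  \sum_(k < 2 ^ j.+1) curvelet_coef j k *
     Re (Complex (nth_coord x d.-1) (nth_coord x d.-2) ^+ k)).
Proof.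
rewrite /curvelet /=; congr (real_complex R (_ * _)).
have -> : j.+1%:Z - 1 = j%:Z by rewrite -addn1 PoszD addrK.
apply: lim_near_cst => //; near=> M.
have JM : (2 ^ j.+1 <= M)%N by near: M; exact: nbhs_infty_ge.
rewrite /series /= (big_cat_nat _ JM) //= [X in _ + X]big_nat_cond [X in _ + X]big1 ?addr0.
  by rewrite big_mkord.
move=> k /andP[/andP[jk _] _].
by rewrite -/(curvelet_coef j k) curvelet_coef_eq0 // mul0r.
Unshelve. all: by end_near.
Qed.

(** The square of [A_n] is the inverse of [null_const n * 2^n], the value of the
    average on the diagonal, so the normalisations cancel. *)
Lemma curvelet_coef_sqr j k :
  curvelet_coef j k ^+ 2 * (@null_const R d k * 2 ^+ k / dimH R d k) =
  kappa phi (k%:R / 2 ^+ j) ^+ 2.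
Proof.
case: k => [|k]; first by rewrite /curvelet_coef mul0r kappa0 !(mulr0, mul0r) expr0n mul0r.
have dH := dimH_gt0 (R := R) d3 k.+1.
have -> : curvelet_coef j k.+1 ^+ 2 =
    Num.sqrt (dimH R d k.+1) ^+ 2 * kappa phi (k.+1%:R / 2 ^+ j) ^+ 2 * A_ R d k.+1 ^+ 2.
  by rewrite /curvelet_coef; ring.
rewrite sqr_sqrtr ?ltW // A_sqr // /null_const.
have := fact_neq0 (R := R) k.+1; have := @poch_gt0 R d k.+1 (leq_trans (isT : (0 < 3)%N) d3).
have : 2 ^+ k.+1 != 0 :> R by rewrite expf_neq0.
move: (2 ^+ k.+1) (poch d k.+1) (k.+1`!%:R) (dimH R d k.+1) dH (kappa _ _) => a b c e e0 q a0 b0 c0.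
by field; rewrite c0 a0 !gt_eqF.
Qed.

Definition kernel J t : R := \sum_(k < 2 ^ J) phi (k%:R / (2 ^ J)%:R) ^+ 2 * zonal d k t.

Lemma kernel_wide J M t : (2 ^ J <= M)%N ->
  kernel J t = \sum_(k < M) phi (k%:R / (2 ^ J)%:R) ^+ 2 * zonal d k t.
Proof.
move=> JM; rewrite /kernel (big_ord_widen M (fun k => phi (k%:R / (2 ^ J)%:R) ^+ 2 * zonal d k t)) //.
rewrite [RHS](bigID (fun k : 'I_M => (k < 2 ^ J)%N)) /= [X in _ = _ + X]big1 ?addr0 //.
move=> k; rewrite -leqNgt => kJ; have [_ _ _ ->] := cphi; first by rewrite expr0n mul0r.
by rewrite ler_pdivlMr ?mul1r ?ler_nat // ltr0n expn_gt0.
Qed.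

Lemma zonal0 t : zonal d 0 t = 1 :> R.
Proof.
rewrite /zonal big_mkcond big_ord_recl big_ord0 /= addr0 mulr1 zonal_coef_lead.
by rewrite poch0 fact0 expr0 mul1r divr1.
Qed.

Lemma kernel0 t : kernel 0 t = 1.
Proof.
have [_ _ p1 _] := cphi.
rewrite /kernel big_ord_recl big_ord0 addr0 mul0r p1 ?lexx ?invr_ge0 ?ler0n //.
by rewrite expr1n mul1r zonal0.
Qed.

(** [kappa^2] is the increment of the multiplier from one level to the next. *)
Lemma kernelS j t : kernel j.+1 t =
  kernel j t + \sum_(k < 2 ^ j.+1) kappa phi (k%:R / 2 ^+ j) ^+ 2 * zonal d k t.
Proof.
rewrite (@kernel_wide j (2 ^ j.+1)); last by rewrite leq_exp2l.
rewrite -big_split; apply: eq_bigr => k _ /=.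
rewrite kappa_sqr ?divr_ge0 ?exprn_ge0 //.
have -> : k%:R / 2 ^+ j / 2 = k%:R / (2 ^ j.+1)%:R :> R by rewrite natrX exprSr invfM mulrA.
by rewrite !natrX; ring.
Qed.

End Cutoff.

Section RealParts.
Context {R : realType} {d : nat}.
Local Notation C := R[i].
Local Notation toC := (real_complex R).

Lemma conjcX (u : C) l : conjc u ^+ l = conjc (u ^+ l).
Proof. by rewrite (rmorphXn (@conjc R)). Qed.

Lemma Re_sum (I : finType) (G : I -> C) : \sum_i Re (G i) = Re (\sum_i G i).
Proof. by elim/big_rec2: _ => // i u v _ ->; rewrite complexReD. Qed.

Lemma Re_mul_sum (t a b : R) (u v : C) : t * 2 * ((a * Re u) * (b * Re v)) =
  a * b * (Re (toC t * (u * conjc v)) + Re (toC t * (u * v))).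
Proof. by case: u v => [u1 u2] [v1 v2] /=; ring. Qed.

(** The product formula [2 Re u Re v = Re (u conj(v)) + Re (u v)]. *)
Lemma Re_expand (I : finType) (z zc : I -> 'cV[C]_d) (wt : I -> R) (c : nat -> R) M
    (x y : 'cV[R]_d) :
  (forall i, conjc (dot (z i) (emb y)) = dot (zc i) (emb y)) ->
  \sum_i wt i * 2 * ((\sum_(k < M) c k * Re (dot (z i) (emb x) ^+ k)) *
                     (\sum_(l < M) c l * Re (dot (z i) (emb y) ^+ l))) =
  \sum_(k < M) \sum_(l < M) c k * c l * (Re (avg z zc wt k l (emb x) (emb y)) +
     Re (\sum_i toC (wt i) * (dot (z i) (emb x) ^+ k * dot (z i) (emb y) ^+ l))).
Proof.
move=> zconj.
under eq_bigr do rewrite big_distrlr /= mulr_sumr.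
rewrite exchange_big; apply: eq_bigr => k _ /=.
under eq_bigr do rewrite mulr_sumr.
rewrite exchange_big; apply: eq_bigr => l _ /=.
rewrite /avg -!Re_sum -big_split mulr_sumr; apply: eq_bigr => i _.
by rewrite Re_mul_sum -conjcX zconj.
Qed.

End RealParts.

Section FrameKernel.
Context {R : realType} {n : nat} (phi : R -> R).
Variables (mu : probability (borelRd R n.+1) R) (mu' : probability (borelRd R n) R).
Hypothesis n2 : (2 <= n)%N.
Hypothesis cphi : cutoff phi.
Hypothesis mu_rot : rotation_invariant_on_sphere mu.
Hypothesis mu'_rot : rotation_invariant_on_sphere mu'.
Variables (g : 'cV[R]_n.+1 -> 'M[R]_n.+1) (h : 'cV[R]_n -> 'M[R]_n.+1).
Hypothesis g_rotation : pole_rotation g.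
Hypothesis h_rotation : @equator_rotation R n.+1 h.
Variables (N N' : nat -> nat) (eta : nat -> nat -> 'cV[R]_n.+1) (w : nat -> nat -> R)
  (eta' : nat -> nat -> 'cV[R]_n) (w' : nat -> nat -> R).
Hypothesis rules : quadrature_rules mu N eta w.
Hypothesis rules' : quadrature_rules mu' N' eta' w'.

Local Notation C := R[i].
Local Notation toC := (real_complex R).
Local Notation psi := (frame_curvelet phi g h eta w eta' w' : nat -> nat -> nat -> 'cV[R]_n.+1 -> C).

Lemma SO_invmx d (q : 'M[R]_d) : SO q -> invmx q = q^T.
Proof.
move=> [qq _]; have [uq _] := mulmx1_unit qq.
by rewrite -[LHS]mulmx1 -qq mulmxA mulVmx // mul1mx.
Qed.

Section Level.
Variable (j : nat).
Let a (r : 'I_(N j.+1)) := eta j.+1 r.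
Let b (s : 'I_(N' j.+1)) := eta' j.+1 s.
Let wj (r : 'I_(N j.+1)) := w j.+1 r.
Let wj' (s : 'I_(N' j.+1)) := w' j.+1 s.
Let L := (2 ^ j.+2)%N.
Let z := frame_z g a b.
Let zc := frame_zc g a b.
Let wt := frame_wt wj wj'.

Let sphere_a r : sphere (a r). Proof. by have [_ ss _ _] := rules; exact: ss. Qed.
Let sphere_b s : sphere (b s). Proof. by have [_ ss _ _] := rules'; exact: ss. Qed.

Let exact_rule f : spherical_poly L%:R f ->
  sphere_integral mu f = \sum_r toC (wj r) * f (a r).
Proof. by have [_ _ _ E] := rules; rewrite natrX; exact: E. Qed.

Let exact_rule' f : spherical_poly L%:R f ->
  sphere_integral mu' f = \sum_r toC (wj' r) * f (b r).
Proof. by have [_ _ _ E] := rules'; rewrite natrX; exact: E. Qed.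

Let wt_ge0 i : 0 <= wt i.
Proof.
have [_ _ p _] := rules; have [_ _ p' _] := rules'.
by rewrite mulr_ge0 // ltW // ?p ?p'.
Qed.

Let poles : sphere (basis_vec R n.+1 n).
Proof. exact: sphere_basis_vec. Qed.

(** Rotating back by [g h] sends the coordinates along [e^d] and [e^(d-1)] to
    those along the node and the tangent vector. *)
Lemma frame_curveletE (r : 'I_(N j.+1)) (s : 'I_(N' j.+1)) x : psi j.+1 r s x =
  toC (Num.sqrt (wt (r, s))) * toC (Num.sqrt 2 *
    \sum_(k < 2 ^ j.+1) @curvelet_coef _ phi n.+1 j k * Re (dot (z (r, s)) (emb x) ^+ k)).
Proof.
rewrite /frame_curvelet /translate curveletE //; congr (_ * toC (_ * _)).
apply: eq_bigr => k _; congr (_ * Re (_ ^+ _)).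
have [sg gE] := g_rotation (sphere_a r); have [[sh he] hE] := h_rotation (sphere_b s).
have sgh : SO (g (eta j.+1 r) *m h (eta' j.+1 s)).
  split; last by rewrite det_mulmx sg.2 sh.2 mulr1.
  by rewrite trmx_mul mulmxA -(mulmxA (g _)) sh.1 mulmx1 sg.1.
rewrite SO_invmx //; set q := g _ *m h _; set y := q^T *m x.
have coordE (i : 'I_n.+1) : nth_coord y i = dot (q *m basis_vec R n.+1 i) x.
  by rewrite nth_coordE dot_mulmx -/y (basis_vec_delta i) dotC dot_delta.
have n1n : (n.-1 < n.+1)%N by lia.
rewrite (coordE ord_max) (coordE (Ordinal n1n)) /= /q -!mulmxA he gE hE.
rewrite dotDl dotZl !dot_emb.
by apply: complex_ext; rewrite /= ?(mulr0, mul0r, mulr1, mul1r, addr0, add0r, oppr0, subr0).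
Qed.

(** In the double sum over the degrees, the averages of [z] with [z] vanish
    (the constant term is killed by [kappa 0 = 0]), and so do those of [z] with
    [zc] for different degrees. *)
Lemma level_kernel (x y : 'cV[R]_n.+1) : sphere x -> sphere y ->
  \sum_(r < N j.+1) \sum_(s < N' j.+1) psi j.+1 r s x * conjc (psi j.+1 r s y) =
  toC (\sum_(k < 2 ^ j.+1) kappa phi (k%:R / 2 ^+ j) ^+ 2 * zonal n.+1 k (dot x y)).
Proof.
move=> sx sy.
pose c := @curvelet_coef _ phi n.+1 j.
have form := frame_avg_form n2 mu_rot.1 mu_rot.2 mu'_rot.1 mu'_rot.2 g_rotation h_rotation
   sphere_a exact_rule exact_rule'.
have tr := pole_transitive g_rotation.
have zn := frame_z_null g_rotation sphere_a sphere_b.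
have zcn := frame_zc_null g_rotation sphere_a sphere_b.
have zzc := frame_z_zc g_rotation sphere_a sphere_b.
have zconj := frame_z_conj g a b.
have swt := sum_frame_wt mu_rot.1 mu'_rot.1 exact_rule exact_rule'.
have n3 : (3 <= n.+1)%N by [].
pose F (i : 'I_(N j.+1) * 'I_(N' j.+1)) : R := wt i * 2 *
  ((\sum_(k < 2 ^ j.+1) c k * Re (dot (z i) (emb x) ^+ k)) *
   (\sum_(l < 2 ^ j.+1) c l * Re (dot (z i) (emb y) ^+ l))).
transitivity (toC (\sum_i F i)).
  rewrite (rmorph_sum toC) -(pair_bigA _ (fun r s => toC (F (r, s)))).
  apply: eq_bigr => r _; apply: eq_bigr => s _.
  rewrite !frame_curveletE -!(rmorphM toC) conjc_real -(rmorphM toC); congr toC.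
  rewrite /F -[in RHS](sqr_sqrtr (wt_ge0 (r, s))) -[in RHS](@sqr_sqrtr R 2) //.
  by rewrite -/c; ring.
congr toC.
rewrite /F (Re_expand wt c (2 ^ j.+1) x (fun i => zconj i y)); apply: eq_bigr => k _.
have LE : L = (2 * 2 ^ j.+1)%N := expnS 2 j.+1.
have lL (l : 'I_(2 ^ j.+1)) : (2 * l <= L)%N by rewrite LE leq_mul2l ltnW.
rewrite (bigD1 k) //= [X in _ + X]big1 ?addr0 => [|l lk]; last first.
  rewrite (avg_orth n3 mu_rot.1 mu_rot.2 poles tr zn zcn zzc zconj swt form) //; last first.
    by apply: contraNneq lk => /val_inj ->.
  rewrite (avg_zz_eq0 mu_rot.1 mu_rot.2 poles tr zn form) ?addr0 ?mulr0 //.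
  apply/andP; split; last first.
    rewrite -(@leq_pmul2l 2) // mulnDr [leqRHS]mul2n -addnn.
    exact: leq_add (lL k) (lL l).
  rewrite addn_gt0 !lt0n -negb_and; apply: contra lk => /andP[/eqP k0 /eqP l0].
  by apply/eqP/val_inj; rewrite /= k0 l0.
rewrite (avg_zonal n3 mu_rot.1 mu_rot.2 poles tr zn zcn zzc swt form) //.
have [k0|k0] := posnP k.
  by rewrite /c /curvelet_coef k0 mul0r kappa0 !(mulr0, mul0r) expr0n mul0r.
rewrite (avg_zz_eq0 mu_rot.1 mu_rot.2 poles tr zn form) ?addr0; last first.
  by rewrite addn_gt0 k0 addnn -mul2n lL.
by rewrite /= mulrA -expr2 curvelet_coef_sqr.
Qed.

Lemma level_convolution k l (x u : 'cV[R]_n.+1) : (2 * k <= 2 ^ j.+2)%N -> (2 * l <= 2 ^ j.+2)%N ->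
  sphere x -> sphere u ->
  sphere_integral mu (fun y => toC (zonal n.+1 k (dot x y)) * toC (zonal n.+1 l (dot y u))) =
  toC (zonal n.+1 k (dot x u)) *+ (k == l).
Proof.
have form := frame_avg_form n2 mu_rot.1 mu_rot.2 mu'_rot.1 mu'_rot.2 g_rotation h_rotation
   sphere_a exact_rule exact_rule'.
have n3 : (3 <= n.+1)%N by [].
exact: (zonal_convolution n3 mu_rot.1 mu_rot.2 poles (pole_transitive g_rotation)
  (frame_z_null g_rotation sphere_a sphere_b) (frame_zc_null g_rotation sphere_a sphere_b)
  (frame_z_zc g_rotation sphere_a sphere_b)
  (sum_frame_wt mu_rot.1 mu'_rot.1 exact_rule exact_rule') form).
Qed.

Lemma bounded_borel_level (r : 'I_(N j.+1)) (s : 'I_(N' j.+1)) : bounded_borel (psi j.+1 r s).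
Proof.
have -> : psi j.+1 r s = fun x : 'cV[R]_n.+1 => \sum_(k < 2 ^ j.+1)
    toC (Num.sqrt (wt (r, s)) * (Num.sqrt 2 * @curvelet_coef _ phi n.+1 j k)) / 2 *
      (dot (z (r, s)) (emb x) ^+ k + dot (zc (r, s)) (emb x) ^+ k).
  apply/funext => x; rewrite frame_curveletE -(rmorphM toC) !mulr_sumr (rmorph_sum toC).
  apply: eq_bigr => k _.
  have zcE : dot (zc (r, s)) (emb x) = conjc (dot (z (r, s)) (emb x)).
    exact: esym (frame_z_conj g a b (r, s) x).
  rewrite zcE conjcX !mulrA; move: (dot _ _ ^+ k) => u.
  rewrite (rmorphM toC (_ * _ * _)) -[RHS]mulrA; congr (_ * _).
  apply: (mulfI (_ : 2 != 0 :> C)); first by rewrite pnatr_eq0.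
  rewrite mulrA divff ?mul1r ?pnatr_eq0 //.
  case: u => u v; apply: complex_ext; rewrite /= ?(mulr0, mul0r, addr0, subr0, subrr) //.
  by rewrite mulrDl mul1r.
apply: bounded_borel_sum => k _; apply: bounded_borelM; first exact: bounded_borel_cst.
by apply: bounded_borelD; apply: bounded_borelX; exact: bounded_borel_dot.
Qed.

End Level.

Lemma bounded_borel_frame j r s : (r < N j)%N -> (s < N' j)%N -> bounded_borel (psi j r s).
Proof.
case: j => [|j] rN sN; last exact: (@bounded_borel_level j (Ordinal rN) (Ordinal sN)).
exact: bounded_borel_cst.
Qed.

Lemma frame_kernel J (x y : 'cV[R]_n.+1) : sphere x -> sphere y ->
  \sum_(0 <= j < J.+1) \sum_(0 <= r < N j) \sum_(0 <= s < N' j)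
    psi j r s x * conjc (psi j r s y) = toC (@kernel _ phi n.+1 J (dot x y)).
Proof.
move=> sx sy; elim: J => [|J IH].
  rewrite big_nat1; have [[-> w1] _ _ _] := rules; have [[-> w1'] _ _ _] := rules'.
  have psi0 u : psi 0 0 0 u = 1.
    by rewrite /frame_curvelet w1 w1' mulr1 sqrtr1 /translate /curvelet eqxx mulr1.
  by rewrite !big_nat1 !psi0 kernel0 // (rmorph1 (@conjc R)) mulr1.
rewrite big_nat_recr // IH kernelS // (rmorphD toC); congr (_ + _).
apply: etrans (level_kernel J sx sy).
by rewrite big_mkord; apply: eq_bigr => r _; rewrite big_mkord.
Qed.

(** On integrable functions the frame operator is the integral operator with
    zonal kernel [kernel J]. *)
Lemma Lambda_kernel J f (x : 'cV[R]_n.+1) : cintegrable mu f -> sphere x ->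
  Lambda mu phi g h N eta w N' eta' w' J f x =
  sphere_integral mu (fun y => f y * toC (@kernel _ phi n.+1 J (dot x y))).
Proof.
move=> fi sx.
have bconj j r s : (r < N j)%N -> (s < N' j)%N -> bounded_borel (fun y => conjc (psi j r s y)).
  move=> rN sN; have [m1 m2 [M bM]] := bounded_borel_frame rN sN; split.
  - apply: eq_measurable_fun m1 => y _; by case: (psi _ _ _ _).
  - apply: eq_measurable_fun (measurable_funN m2) => y _ /=; by case: (psi _ _ _ _).
  - exists M => y sy; have [b1 b2] := bM y sy.
    by move: b1 b2; case: (psi _ _ _ _) => u v /=; rewrite normrN.
transitivity (sphere_integral mu (fun y => \sum_(0 <= j < J.+1) \sum_(0 <= r < N j)
    \sum_(0 <= s < N' j) psi j r s x * (f y * conjc (psi j r s y)))); last first.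
  apply: sphere_integral_ext => y sy; rewrite -frame_kernel // mulr_sumr.
  apply: eq_bigr => j _; rewrite mulr_sumr; apply: eq_bigr => r _.
  by rewrite mulr_sumr; apply: eq_bigr => s _; rewrite mulrCA.
have ci j (r : 'I_(N j)) (s : 'I_(N' j)) :
    cintegrable mu (fun y => psi j r s x * (f y * conjc (psi j r s y))).
  have := cintegrableM (cintegrableM fi (bconj _ _ _ (ltn_ord r) (ltn_ord s)))
    (bounded_borel_cst (psi j r s x)).
  by apply: cintegrable_ext => y _; rewrite mulrC.
have c0 : cintegrable mu (fun _ : 'cV[R]_n.+1 => 0 : C).
  by apply: bounded_borel_cintegrable; exact: bounded_borel_cst.
have cS (I : finType) (F : I -> 'cV[R]_n.+1 -> C) : (forall i, cintegrable mu (F i)) ->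
    cintegrable mu (fun y => \sum_i F i y).
  move=> iF; elim: (index_enum I) => [|i r IH].
    by apply: cintegrable_ext c0 => y _; rewrite big_nil.
  by apply: cintegrable_ext (cintegrableD (iF i) IH) => y _; rewrite big_cons.
rewrite /Lambda big_mkord.
under [in RHS]eq_fun => y.
  rewrite big_mkord; under eq_bigr => j _.
    rewrite big_mkord; under eq_bigr do rewrite big_mkord.
    over.
  over.
rewrite (sphere_integral_sum mu_rot.1); last by move=> j _; apply: (@cS _ _) => r; apply: (@cS _ _) => s; exact: ci.
apply: eq_bigr => j _; rewrite big_mkord.
rewrite (sphere_integral_sum mu_rot.1); last by move=> r _; apply: (@cS _ _) => s; exact: ci.
apply: eq_bigr => r _; rewrite big_mkord.
rewrite (sphere_integral_sum mu_rot.1); last by move=> s _; exact: ci.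
apply: eq_bigr => s _; rewrite sphere_integralZ; first by rewrite mulrC.
exact: cintegrableM fi (bconj _ _ _ (ltn_ord r) (ltn_ord s)).
Qed.

Lemma bounded_borel_Lambda J f : bounded_borel (Lambda mu phi g h N eta w N' eta' w' J f).
Proof.
rewrite /Lambda; under eq_fun do rewrite big_mkord.
apply: bounded_borel_sum => j _; under eq_fun do rewrite big_mkord.
apply: bounded_borel_sum => r _; under eq_fun do rewrite big_mkord.
apply: bounded_borel_sum => s _; apply: bounded_borelM; first exact: bounded_borel_cst.
by apply: bounded_borel_frame.
Qed.

End FrameKernel.

(** * The kernel reproduces spherical polynomials *)

Section Reproduction.
Context {R : realType} {d : nat} (mu : probability (borelRd R d) R) (phi : R -> R).
Hypothesis d3 : (3 <= d)%N.
Hypothesis mu_sphere : mu (@sphere R d : set (borelRd R d)) = 1%E.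
Hypothesis cphi : cutoff phi.
Local Notation C := R[i].
Local Notation toC := (real_complex R).
Hypothesis convolution : forall k l (x u : 'cV[R]_d), sphere x -> sphere u ->
  sphere_integral mu (fun y => toC (zonal d k (dot x y)) * toC (zonal d l (dot y u))) =
  toC (zonal d k (dot x u)) *+ (k == l).
Variable J : nat.
Implicit Types (x y u : 'cV[R]_d) (f : 'cV[R]_d -> C).

Local Notation K := (@kernel R phi d J).

Lemma kernelC t : toC (K t) =
  \sum_(k < 2 ^ J) toC (phi (k%:R / (2 ^ J)%:R) ^+ 2) * toC (zonal d k t).
Proof. by rewrite (rmorph_sum toC); apply: eq_bigr => k _; rewrite (rmorphM toC). Qed.

Lemma bounded_borel_kernel x : bounded_borel (fun y : 'cV[R]_d => toC (K (dot x y))).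
Proof.
under eq_fun do rewrite kernelC.
apply: bounded_borel_sum => k _.
by apply: bounded_borelM; [exact: bounded_borel_cst|exact: bounded_borel_zonal].
Qed.

Definition reproduced f := bounded_borel f /\ forall x, sphere x ->
  sphere_integral mu (fun y => f y * toC (K (dot x y))) = f x.

Let cint f x : bounded_borel f -> cintegrable mu (fun y => f y * toC (K (dot x y))).
Proof.
move=> bf; apply: bounded_borel_cintegrable => //.
by apply: bounded_borelM => //; exact: bounded_borel_kernel.
Qed.

Lemma reproduced_ext f g : f =1 g -> reproduced f -> reproduced g.
Proof. by move=> /funext ->. Qed.

Lemma reproducedD f g : reproduced f -> reproduced g -> reproduced (fun y => f y + g y).
Proof.
move=> [bf rf] [bg rg]; split=> [|x sx]; first exact: bounded_borelD.
under eq_fun do rewrite mulrDl.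
by rewrite sphere_integralD ?rf ?rg //; exact: cint.
Qed.

Lemma reproducedZ (c : C) f : reproduced f -> reproduced (fun y => c * f y).
Proof.
move=> [bf rf]; split=> [|x sx]; first by apply: bounded_borelM => //; exact: bounded_borel_cst.
under eq_fun do rewrite -mulrA.
by rewrite sphere_integralZ ?rf //; exact: cint.
Qed.

Lemma reproduced_sum (I : Type) (r : seq I) (P : pred I) (F : I -> 'cV[R]_d -> C) f0 :
  reproduced f0 -> (forall i, P i -> reproduced (F i)) ->
  reproduced (fun y => \sum_(i <- r | P i) F i y).
Proof.
move=> r0 rF; elim: r => [|i r IH].
  by apply: reproduced_ext (reproducedZ 0 r0) => y; rewrite big_nil mul0r.
have [Pi|nPi] := boolP (P i).
  by apply: reproduced_ext (reproducedD (rF i Pi) IH) => y; rewrite big_cons Pi.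
by apply: reproduced_ext IH => y; rewrite big_cons (negbTE nPi).
Qed.

(** Convolution keeps the term of degree [k], where the multiplier is 1. *)
Lemma reproduced_zonal k u : (2 * k <= 2 ^ J)%N -> sphere u ->
  reproduced (fun y => toC (zonal d k (dot y u))).
Proof.
move=> kJ su; have bz l x : bounded_borel (fun y : 'cV[R]_d => toC (zonal d l (dot x y))).
  exact: bounded_borel_zonal.
have bzk : bounded_borel (fun y => toC (zonal d k (dot y u))).
  by under eq_fun do rewrite dotC.
split=> // x sx.
have J0 : (0 < 2 ^ J)%N by rewrite expn_gt0.
have kJ' : (k < 2 ^ J)%N by lia.
have ->: (fun y : 'cV[R]_d => toC (zonal d k (dot y u)) * toC (K (dot x y))) = fun y =>
    \sum_(l < 2 ^ J) toC (phi (l%:R / (2 ^ J)%:R) ^+ 2) *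
      (toC (zonal d l (dot x y)) * toC (zonal d k (dot y u))).
  apply/funext => y; rewrite kernelC mulr_sumr; apply: eq_bigr => l _.
  by rewrite mulrCA; congr (_ * _); exact: mulrC.
have ci l : cintegrable mu (fun y : 'cV[R]_d => toC (zonal d l (dot x y)) * toC (zonal d k (dot y u))).
  by apply: bounded_borel_cintegrable => //; exact: bounded_borelM.
rewrite sphere_integral_sum //; last first.
  move=> l _; have := cintegrableM (ci l) (bounded_borel_cst (toC (phi (l%:R / (2 ^ J)%:R) ^+ 2))).
  by apply: cintegrable_ext => y _; rewrite mulrC.
under eq_bigr do rewrite sphere_integralZ // convolution //.
rewrite (bigD1 (Ordinal kJ')) //= eqxx mulr1n big1 ?addr0 => [|l lk]; last first.
  by rewrite (_ : (val l == k) = false) ?mulr0n ?mulr0 //; apply: contraNF lk => /eqP lk; apply/eqP/val_inj.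
have [_ _ p1 _] := cphi; rewrite p1 ?expr1n ?rmorph1 ?mul1r //.
rewrite divr_ge0 // ler_pdivrMr ?ltr0n ?expn_gt0 // mulrC ler_pdivlMr // -natrM ler_nat.
by rewrite mulnC.
Qed.

(** The leading coefficient of [zonal d k] is not zero, so the powers are
    combinations of zonal polynomials. *)
Lemma reproduced_sphere_pow k u : (2 * k <= 2 ^ J)%N -> sphere u ->
  reproduced (fun y => toC (dot y u ^+ k)).
Proof.
move=> kJ su; elim/ltn_ind: k kJ => k IH kJ.
have z0 : zonal_coef d 0 k != 0 :> R.
  rewrite zonal_coef_lead mulf_neq0 ?invr_neq0 ?fact_neq0 //.
  by rewrite mulf_neq0 ?expf_neq0 // gt_eqF // poch_gt0 //; lia.
have rz := reproduced_zonal kJ su.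
have rs : reproduced (fun y => \sum_(l < k | (2 * l.+1 <= k)%N)
    toC (zonal_coef d l.+1 (k - 2 * l.+1)) * toC (dot y u ^+ (k - 2 * l.+1))).
  apply: (reproduced_sum _ rz) => l lk; apply: reproducedZ; apply: IH; lia.
apply: reproduced_ext (reproducedZ (toC (zonal_coef d 0 k)^-1) (reproducedD rz (reproducedZ (-1) rs))) => y.
rewrite mulN1r /zonal.
have -> : \sum_(l < k | (2 * l.+1 <= k)%N)
    toC (zonal_coef d l.+1 (k - 2 * l.+1)) * toC (dot y u ^+ (k - 2 * l.+1)) =
  toC (\sum_(l < k | (2 * l.+1 <= k)%N) zonal_coef d l.+1 (k - 2 * l.+1) * dot y u ^+ (k - 2 * l.+1)).
  by rewrite (rmorph_sum toC); apply: eq_bigr => l _; rewrite (rmorphM toC).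
rewrite -(rmorphB toC) -(rmorphM toC); congr toC.
rewrite big_mkcond [X in _ - X]big_mkcond big_ord_recl /= muln0 subn0.
by rewrite -addrA subrr addr0 mulKf.
Qed.

Lemma reproduced_pow k u : (2 * k <= 2 ^ J)%N ->
  reproduced (fun y => dot (emb u) (emb y) ^+ k).
Proof.
move=> kJ; have E y : dot (emb u) (emb y) ^+ k = toC (dot y u ^+ k).
  by rewrite dot_emb (dotC u) (rmorphXn toC).
have s0 : sphere (basis_vec R d 0) by apply: sphere_basis_vec; lia.
have [u0|u0] := eqVneq (dot u u) 0.
  have u00 := dot_eq0 u0.
  have := reproduced_sphere_pow (k := 0) (isT : (2 * 0 <= 2 ^ J)%N) s0.
  move=> /(reproducedZ (toC (0 ^+ k))); apply: reproduced_ext => y.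
  by rewrite E u00 expr0 mulr1 /dot big1 // => i _; rewrite mxE mulr0.
pose c := Num.sqrt (dot u u).
have c0 : c != 0 by rewrite sqrtr_eq0 -ltNge lt_neqAle eq_sym u0 dot_ge0.
have su : sphere (c^-1 *: u).
  apply/sphere_dot1; rewrite dotZl dotZr mulrA -invfM -expr2 sqr_sqrtr ?dot_ge0 //.
  by rewrite mulVf.
apply: reproduced_ext (reproducedZ (toC (c ^+ k)) (reproduced_sphere_pow kJ su)) => y.
by rewrite E -(rmorphM toC) dotZr exprMn exprVn mulVKf // expf_neq0.
Qed.

(** Polarization: [t |-> ((u + t e_i).y)^(k+1)] has linear coefficient
    [(k+1) y_i (u.y)^k]. *)
Lemma reproduced_polarized (s : seq 'I_d) k u : (2 * (size s + k) <= 2 ^ J)%N ->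
  reproduced (fun y => \prod_(i <- s) toC (y i 0) * dot (emb u) (emb y) ^+ k).
Proof.
elim: s k u => [|i s IH] k u skJ.
  apply: reproduced_ext (reproduced_pow u _) => [y|]; last exact: skJ.
  by rewrite big_nil mul1r.
pose h l y : C := \prod_(i <- s) toC (y i 0) * (toC (y i 0) ^+ l * dot (emb u) (emb y) ^+ (k.+1 - l)).
have bh l : bounded_borel (h l).
  apply: bounded_borelM; last first.
    by apply: bounded_borelM; apply: bounded_borelX; [exact: bounded_borel_coord|exact: bounded_borel_dot].
  elim: (s) => [|j r IHr]; first by under eq_fun do rewrite big_nil; exact: bounded_borel_cst.
  by under eq_fun do rewrite big_cons; apply: bounded_borelM => //; exact: bounded_borel_coord.
have rh t : reproduced (fun y => \sum_(l < k.+2) ('C(k.+1, l)%:R * t%:R ^+ l) * h l y).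
  have := IH k.+1 (u + t%:R *: delta_mx i 0); rewrite addnS => /(_ skJ).
  apply: reproduced_ext => y.
  have -> : dot (emb (u + t%:R *: delta_mx i 0)) (emb y) = dot (emb u) (emb y) + t%:R * toC (y i 0).
    rewrite !dot_emb dotDl dotZl (dotC (delta_mx _ _)) dot_delta (rmorphD toC) (rmorphM toC).
    by rewrite (rmorph_nat toC).
  rewrite exprDn mulr_sumr; apply: eq_bigr => l _.
  by rewrite /h exprMn -mulr_natl; ring.
have bh1 : bounded_borel (fun y => \prod_(j <- i :: s) toC (y j 0) * dot (emb u) (emb y) ^+ k).
  have := bh 1%N; congr (bounded_borel _); apply/funext => y.
  by rewrite /h big_cons expr1 subn1 /=; ring.
split=> // x sx.
pose p : {poly C} := \poly_(l < k.+2) ('C(k.+1, l)%:R * sphere_integral mu (fun y => h l y * toC (K (dot x y)))).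
pose q : {poly C} := \poly_(l < k.+2) ('C(k.+1, l)%:R * h l x).
have pq : p = q.
  apply: poly_nat_ext => t; have [bt rt] := rh t; have := rt x sx.
  rewrite !horner_poly.
  under [X in sphere_integral _ X = _ -> _]eq_fun do rewrite mulr_suml.
  rewrite sphere_integral_sum //; last first.
    move=> l _; apply: cint; apply: bounded_borelM; last exact: bh.
    exact: bounded_borel_cst.
  move=> E; transitivity (\sum_(l < k.+2) 'C(k.+1, l)%:R * t%:R ^+ l * h l x).
    rewrite -E; apply: eq_bigr => l _.
    under [in RHS]eq_fun do rewrite -mulrA.
    by rewrite sphere_integralZ; [ring|exact: cint].
  by apply: eq_bigr => l _; ring.
have := congr1 (fun r : {poly C} => r`_1) pq.
rewrite !coef_poly /= bin1 => /(mulfI (_ : k.+1%:R != 0 :> C)) E.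
have hE y : \prod_(j <- i :: s) toC (y j 0) * dot (emb u) (emb y) ^+ k = h 1%N y.
  by rewrite /h big_cons expr1 subn1 /=; ring.
rewrite hE -E ?pnatr_eq0 //; apply: sphere_integral_ext => y _.
by rewrite hE.
Qed.

Lemma reproduced_spherical_poly (m : R) f : m * 2 <= (2 ^ J)%:R -> spherical_poly m f ->
  exists2 f', reproduced f' & forall x, sphere x -> f x = f' x.
Proof.
move=> mJ [P [Pm fP]].
exists (fun x => mpoly.meval (fun i => toC (x i 0)) P) => //.
have s0 : sphere (basis_vec R d 0) by apply: sphere_basis_vec; lia.
have r1 := reproduced_sphere_pow (k := 0) (isT : (2 * 0 <= 2 ^ J)%N) s0.
apply: (@reproduced_ext (fun x => \sum_(mm <- mpoly.msupp P) mpoly.mcoeff mm P *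
    \prod_i toC (x i 0) ^+ (mm : mpoly.multinom d) i)).
  by move=> x; rewrite mpoly.mevalE.
under eq_fun do rewrite big_seq_cond.
apply: (reproduced_sum _ r1) => mm; rewrite andbT => mP; apply: reproducedZ.
have degmm : (2 * mpoly.mdeg mm <= 2 ^ J)%N.
  rewrite -(ler_nat R); apply: le_trans mJ; rewrite natrM mulrC ler_pM2r //.
  apply: le_trans Pm; rewrite ler_nat.
  by have := mpoly.msize_mdeg_lt mP; case: (mpoly.mmeasure _ P).
pose s := flatten [seq nseq ((mm : mpoly.multinom d) i) i | i <- index_enum 'I_d].
have ss : size s = mpoly.mdeg mm.
  rewrite /s size_flatten /shape -map_comp mpoly.mdegE sumnE big_map.
  by apply: eq_bigr => i _; rewrite /= size_nseq.
have := @reproduced_polarized s 0 0; rewrite addn0 ss => /(_ degmm).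
apply: reproduced_ext => y; rewrite expr0 mulr1 /s big_flatten big_map.
by apply: eq_bigr => i _; rewrite big_nseq iter_mulr_1.
Qed.

Lemma kernel_reproduces (m : R) f : m * 2 <= (2 ^ J)%:R -> spherical_poly m f ->
  cintegrable mu f /\ forall x, sphere x ->
    sphere_integral mu (fun y => f y * toC (K (dot x y))) = f x.
Proof.
move=> mJ sf; have [f' [bf rf] ff'] := reproduced_spherical_poly mJ sf; split.
  have cf' : cintegrable mu f' by apply: bounded_borel_cintegrable.
  by apply: (cintegrable_ext _ cf') => x sx; rewrite ff'.
move=> x sx; rewrite ff' // -rf //; apply: sphere_integral_ext => y sy.
by rewrite ff'.
Qed.

End Reproduction.

(** * Lebesgue norms of positive integral operators *)

Section IntegralOperator.
Context {disp : measure_display} {T : measurableType disp} {R : realType}.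
Variables (mu : probability T R) (S : set T) (W : T -> T -> R) (C : R).
Hypothesis mS : measurable S.
Hypothesis W_ge0 : forall x y, 0 <= W x y.
Hypothesis mW : measurable_fun [set: T * T] (fun z => W z.1 z.2).
Hypothesis W_sym : forall x y, W x y = W y x.
Hypothesis C_gt0 : 0 < C.
Hypothesis W_mass : forall x, S x -> (\int[mu]_(y in S) (W x y)%:E <= C%:E)%E.

Let mWx x : measurable_fun [set: T] (W x).
Proof. exact: (measurableT_comp mW (pair1_measurable x)). Qed.

Let mWES x : measurable_fun S (fun y => (W x y)%:E).
Proof. by apply/measurable_EFinP; exact: measurable_funTS. Qed.

Lemma powR_split1 (r a : R) : 0 < a -> a `^ r = a * a `^ (r - 1).
Proof.
move=> a0; have -> : a * a `^ (r - 1) = a `^ 1 * a `^ (r - 1) by rewrite powRr1 // ltW.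
rewrite -powRD; last by rewrite (gt_eqF a0) implybT.
by have -> : 1 + (r - 1) = r by ring.
Qed.

(** Either [a <= lam], or [a <= lam^(1-r) a^r] because [lam < a]. *)
Lemma le_powR_split (r a lam : R) : 1 <= r -> 0 <= a -> 0 < lam ->
  a <= lam `^ (1 - r) * a `^ r + lam.
Proof.
move=> r1 a0 l0; have [al|la] := leP a lam.
  by rewrite ler_wpDl // mulr_ge0 ?powR_ge0.
have a0' : 0 < a by exact: lt_trans la.
apply: ler_wpDr; first exact: ltW.
rewrite (powR_split1 _ a0') mulrCA ler_pMr // -opprB powRN mulrC ler_pdivlMr ?powR_gt0 // mul1r.
by apply: ge0_ler_powR; rewrite ?nnegrE ?subr_ge0 // ltW.
Qed.

Section Power.
Variables (r : R) (u : T -> R).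
Hypothesis r1 : 1 <= r.
Hypothesis u_ge0 : forall x, 0 <= u x.
Hypothesis mu_ : measurable_fun S u.

Let r0 : 0 < r. Proof. exact: lt_le_trans r1. Qed.

Definition power_integral x : \bar R := (\int[mu]_(y in S) (W x y * u y `^ r)%:E)%E.

Let mup : measurable_fun S (fun y => u y `^ r).
Proof. exact: (measurableT_comp (measurable_powR r)). Qed.

Let mWup x : measurable_fun S (fun y => (W x y * u y `^ r)%:E).
Proof.
by apply/measurable_EFinP; apply: measurable_funM => //; exact: measurable_funTS.
Qed.

Let Wup_ge0 x y : (0 <= (W x y * u y `^ r)%:E)%E.
Proof. by rewrite lee_fin mulr_ge0 // powR_ge0. Qed.

(** A form of Jensen's inequality.  Integrating [u <= lam^(1-r) u^r + lam]
    against [W x] with [lam = t / (2 C)], the last term contributes at most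
    [t / 2] and is absorbed by the left-hand side. *)
Lemma operator_power_le x (t : R) : S x -> 0 <= t ->
  (t%:E <= \int[mu]_(y in S) (W x y * u y)%:E)%E ->
  ((t `^ r)%:E <= (2 `^ r * C `^ (r - 1))%:E * power_integral x)%E.
Proof.
move=> Sx t0 tE; have [->|tn0] := eqVneq t 0.
  rewrite powR0 ?gt_eqF // mule_ge0 ?lee_fin ?mulr_ge0 ?powR_ge0 //.
  by apply: integral_ge0 => y _; exact: Wup_ge0.
have tp : 0 < t by rewrite lt_neqAle eq_sym tn0.
have [lam lp tl] : exists2 lam, 0 < lam & t = 2 * C * lam.
  exists (t / (2 * C)); first by rewrite divr_gt0 // mulr_gt0.
  by field; rewrite gt_eqF.
have H : (t%:E <= (lam `^ (1 - r))%:E * power_integral x + (t / 2)%:E)%E.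
  apply: le_trans tE _.
  apply: (@le_trans _ _ (\int[mu]_(y in S)
     ((lam `^ (1 - r))%:E * (W x y * u y `^ r)%:E + lam%:E * (W x y)%:E))%E).
    apply: ge0_le_integral => //.
    - by move=> y _; rewrite lee_fin mulr_ge0.
    - by apply/measurable_EFinP; apply: measurable_funM => //; exact: measurable_funTS.
    - by apply: emeasurable_funD; apply: measurable_funeM.
    - move=> y _; rewrite -!EFinM -EFinD lee_fin.
      have := ler_wpM2l (W_ge0 x y) (le_powR_split r1 (u_ge0 y) lp).
      by move/le_trans; apply; rewrite le_eqVlt; apply/orP; left; apply/eqP; ring.
  rewrite ge0_integralD //.
  - rewrite ge0_integralZl //; last by rewrite lee_fin powR_ge0.
    rewrite ge0_integralZl //; last 2 first.
      by move=> y _; rewrite lee_fin.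
      by rewrite lee_fin ltW.
    apply: leeD => //.
    apply: le_trans (lee_wpmul2l _ (W_mass Sx)) _; first by rewrite lee_fin ltW.
    rewrite -EFinM lee_fin le_eqVlt; apply/orP; left; apply/eqP.
    by rewrite tl; field.
  - by move=> y _; rewrite mule_ge0 // lee_fin powR_ge0.
  - exact: measurable_funeM.
  - by move=> y _; rewrite mule_ge0 // lee_fin // ltW.
  - exact: measurable_funeM.
have {}H : ((t / 2)%:E <= (lam `^ (1 - r))%:E * power_integral x)%E.
  rewrite -(leeD2rE _ _ (isT : ((t / 2)%:E \is a fin_num)%E)) -EFinD.
  by rewrite (_ : t / 2 + t / 2 = t) //; field.
have [K [K0 E1 E2]] : exists K, [/\ 0 <= K, t `^ r = K * (t / 2) &
    2 `^ r * C `^ (r - 1) = K * lam `^ (1 - r)].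
  exists (2 `^ r * C `^ (r - 1) * lam `^ (r - 1)); split.
  - by rewrite !mulr_ge0 ?powR_ge0.
  - have -> : t / 2 = C * lam by rewrite tl; field.
    rewrite tl !powRM ?ltW ?mulr_gt0 //.
    by rewrite (powR_split1 _ C_gt0) (powR_split1 _ lp); ring.
  - rewrite -[RHS]mulrA -powRD; last by rewrite (gt_eqF lp) implybT.
    by rewrite (_ : r - 1 + (1 - r) = 0) ?powRr0 ?mulr1 //; ring.
rewrite E1 E2 (EFinM K (t / 2)) (EFinM K) -muleA.
by apply: lee_wpmul2l H; rewrite lee_fin.
Qed.

Let F (z : T * T) : \bar R := (\1_S z.1 * W z.1 z.2 * ((fun y => u y `^ r) \_ S) z.2)%:E.

Let restr_ge0 y : 0 <= ((fun y => u y `^ r) \_ S) y.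
Proof. by rewrite patchE; case: ifP => // _; exact: powR_ge0. Qed.

Let F_ge0 z : (0 <= F z)%E.
Proof. by rewrite lee_fin !mulr_ge0 // indicE. Qed.

Let mF : measurable_fun [set: T * T] F.
Proof.
apply/measurable_EFinP; apply: measurable_funM; first apply: measurable_funM => //.
- by apply: measurableT_comp => //; exact: measurable_indic.
- apply: measurableT_comp => //; exact/(measurable_restrictT _ _).1.
Qed.

Let F_fst x : (\int[mu]_y F (x, y) = (\1_S x)%:E * power_integral x)%E.
Proof.
rewrite /power_integral -ge0_integralZl //.
rewrite integral_mkcond; apply: eq_integral => y _.
rewrite /F /= !patchE; case: ifP => _; last by rewrite mulr0.
by rewrite -EFinM mulrA.
Qed.

Lemma measurable_power_integral : measurable_fun S power_integral.
Proof.
have m := measurable_fun_fubini_tonelli_F (m2 := mu) F mF F_ge0.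
apply: (eq_measurable_fun (fubini_F mu F)); last exact: measurable_funTS.
by move=> x Sx; rewrite /fubini_F F_fst indicE Sx mul1e.
Qed.

(** Tonelli's theorem and the symmetry of [W]. *)
Lemma power_integral_le :
  (\int[mu]_(x in S) power_integral x <= C%:E * \int[mu]_(x in S) (u x `^ r)%:E)%E.
Proof.
have -> : (\int[mu]_(x in S) power_integral x = \int[mu]_x \int[mu]_y F (x, y))%E.
  rewrite integral_mkcond; apply: eq_integral => x _; rewrite F_fst patchE indicE.
  by case: (x \in S); rewrite ?mul1e ?mul0e.
rewrite (fubini_tonelli (m1 := mu) (m2 := mu)) //.
rewrite -ge0_integralZl //; last 3 first.
  exact/measurable_EFinP.
  by move=> y _; rewrite lee_fin powR_ge0.
  by rewrite lee_fin ltW.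
rewrite [leRHS]integral_mkcond.
apply: ge0_le_integral => //.
- by move=> y _; apply: integral_ge0.
- exact: (measurable_fun_fubini_tonelli_G (m1 := mu) F mF F_ge0).
- apply/(measurable_restrictT _ _).1 => //; apply: measurable_funeM.
  exact/measurable_EFinP.
- move=> y _; rewrite patchE; case: ifPn => [|] yS; last first.
    rewrite integral0_eq // => x _.
    by rewrite /F /= patchE (negbTE yS) mulr0.
  have Sy : S y by rewrite inE in yS.
  have -> : (\int[mu]_x F (x, y) = (u y `^ r)%:E * \int[mu]_(x in S) (W y x)%:E)%E.
    rewrite -ge0_integralZl //; last 2 first.
      by move=> x _; rewrite lee_fin.
      by rewrite lee_fin powR_ge0.
    rewrite [RHS]integral_mkcond; apply: eq_integral => x _.
    rewrite /F /= !patchE yS indicE; case: (x \in S); last by rewrite !mul0r.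
    by rewrite mul1r mulrC EFinM W_sym.
  rewrite [leRHS]muleC; apply: lee_wpmul2l; first by rewrite lee_fin powR_ge0.
  exact: W_mass.
Qed.

(** From [G <= u + 2t], where [t] is an average of [u], the power of [G] is at
    most [2^r (u^r + (2t)^r)], and the average of [u^r] replaces [t^r]. *)
Lemma operator_power_integral (G : T -> R) : measurable_fun S G ->
  (forall x, S x -> 0 <= G x) ->
  (forall x, S x -> exists2 t, 0 <= t &
     G x <= u x + 2 * t /\ (t%:E <= \int[mu]_(y in S) (W x y * u y)%:E)%E) ->
  (\int[mu]_(x in S) (G x `^ r)%:E <=
   (2 `^ r * (1 + 2 `^ r * (2 `^ r * C `^ (r - 1)) * C))%:E * \int[mu]_(x in S) (u x `^ r)%:E)%E.
Proof.
move=> mG G0 Gt; set I := (\int[mu]_(x in S) (u x `^ r)%:E)%E.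
have I0 : (0 <= I)%E by apply: integral_ge0 => x _; rewrite lee_fin powR_ge0.
set B := 2 `^ r * C `^ (r - 1).
have B0 : 0 <= B by rewrite mulr_ge0 ?powR_ge0.
have P0 : 0 <= 2 `^ r :> R by rewrite powR_ge0.
have p0 x : (0 <= power_integral x)%E by apply: integral_ge0 => y _; exact: Wup_ge0.
have mI := measurable_power_integral.
have mE : measurable_fun S (fun y => (u y `^ r)%:E) by exact/measurable_EFinP.
apply: (@le_trans _ _ (\int[mu]_(x in S)
  ((2 `^ r)%:E * ((u x `^ r)%:E + (2 `^ r * B)%:E * power_integral x)))%E).
  apply: ge0_le_integral => //.
  - by move=> x _; rewrite lee_fin powR_ge0.
  - by apply/measurable_EFinP; exact: (measurableT_comp (measurable_powR r)).
  - by apply: measurable_funeM; apply: emeasurable_funD => //; exact: measurable_funeM.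
  - move=> x Sx; have [t t0 [Gx tW]] := Gt x Sx.
    have tp := operator_power_le Sx t0 tW; rewrite -/B in tp.
    have mono a b : 0 <= a -> a <= b -> a `^ r <= b `^ r.
      by move=> a0 ab; apply: ge0_ler_powR; rewrite ?nnegrE ?(ltW r0) //; exact: le_trans ab.
    apply: (@le_trans _ _ ((2 `^ r)%:E * ((u x `^ r)%:E + ((2 * t) `^ r)%:E))%E).
      rewrite -EFinD -EFinM lee_fin.
      have ux := u_ge0 x; have t20 : 0 <= 2 * t by rewrite mulr_ge0.
      have [h|h] := leP (u x) (2 * t).
        apply: (@le_trans _ _ ((2 * (2 * t)) `^ r)); first by apply: mono; [exact: G0|lra].
        by rewrite powRM // ler_wpM2l // lerDr powR_ge0.
      apply: (@le_trans _ _ ((2 * u x) `^ r)); first by apply: mono; [exact: G0|lra].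
      by rewrite powRM // ler_wpM2l // lerDl powR_ge0.
    apply: lee_wpmul2l; first by rewrite lee_fin.
    apply: leeD => //; rewrite powRM // !EFinM -muleA.
    by apply: lee_wpmul2l; rewrite ?lee_fin.
rewrite ge0_integralZl //; last 2 first.
  by apply: emeasurable_funD => //; exact: measurable_funeM.
  by move=> x _; rewrite adde_ge0 ?lee_fin ?powR_ge0 // mule_ge0 // lee_fin mulr_ge0.
rewrite ge0_integralD //; last 3 first.
  by move=> x _; rewrite lee_fin powR_ge0.
  by move=> x _; rewrite mule_ge0 // lee_fin mulr_ge0.
  exact: measurable_funeM.
rewrite ge0_integralZl //; last by rewrite lee_fin mulr_ge0.
rewrite (EFinM _ (1 + _)) -muleA.
apply: lee_wpmul2l; first by rewrite lee_fin.
rewrite EFinD ge0_muleDl ?lee_fin ?(mulr_ge0 (mulr_ge0 P0 B0) (ltW C_gt0)) // mul1e.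
apply: leeD => //; rewrite (EFinM _ C) -muleA; apply: lee_wpmul2l; first by rewrite lee_fin mulr_ge0.
exact: power_integral_le.
Qed.

End Power.

End IntegralOperator.

(** * A positive majorant of the kernel *)

Section Majorant.
Context {R : realType} {d : nat} (phi : R -> R).
Hypothesis d3 : (3 <= d)%N.
Hypothesis cphi : cutoff phi.
Local Notation C := R[i].
Local Notation toC := (real_complex R).

Lemma dot_sphere_le1 (x y : 'cV[R]_d) : sphere x -> sphere y -> -1 <= dot x y <= 1.
Proof.
move=> /sphere_dot1 xx /sphere_dot1 yy.
have := dot_ge0 (x + 1 *: y); have := dot_ge0 (x + (-1) *: y).
by rewrite !dot_polar xx yy => h1 h2; apply/andP; split; lra.
Qed.

(** The absolute values of the partial sums keep the majorant nonnegative on the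
    whole line; on [[-1, 1]] they do not change anything. *)
Definition majorant J t : R := \sum_(n < 2 ^ J)
  `|iter d.+1 fdiff (fun n => phi (n%:R / (2 ^ J)%:R) ^+ 2) n| *
  `|iter d.+1 psum (zonal d ^~ t) n|.

Lemma majorant_ge0 J t : 0 <= majorant J t.
Proof. by apply: sumr_ge0 => n _; rewrite mulr_ge0. Qed.

Lemma kernel_le_majorant J t : `|@kernel R phi d J t| <= majorant J t.
Proof.
rewrite /kernel (@abel_iter _ d.+1 (fun n => phi (n%:R / (2 ^ J)%:R) ^+ 2) (zonal d ^~ t)).
  by apply: le_trans (ler_norm_sum _ _ _) _; apply: ler_sum => n _; rewrite normrM.
move=> n Nn; have [_ _ _ ->] := cphi; first by rewrite expr0n.
by rewrite ler_pdivlMr ?mul1r ?ler_nat // ltr0n expn_gt0.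
Qed.

Lemma measurable_zonal n : measurable_fun [set: R] (zonal d n).
Proof.
rewrite /zonal; under eq_fun do rewrite big_mkcond.
apply: measurable_sum => k; case: (2 * k <= n)%N; last exact: measurable_cst.
by apply: measurable_funM => //; exact: measurable_funX.
Qed.

Lemma measurable_majorant J : measurable_fun [set: R] (majorant J).
Proof.
have mp M n : measurable_fun [set: R] (fun t : R => iter M psum (zonal d ^~ t) n).
  elim: M n => [|M IH] n /=; first exact: measurable_zonal.
  by rewrite /psum; apply: measurable_sum => k; exact: IH.
apply: measurable_sum => n; apply: measurable_funM => //.
by apply: measurableT_comp => //; exact: mp.
Qed.

Lemma measurable_dot :
  measurable_fun [set: borelRd R d * borelRd R d] (fun z => dot (z.1 : 'cV[R]_d) z.2).
Proof.
apply: measurable_sum => i.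
by apply: measurable_funM; apply: measurableT_comp (measurable_coord i) _.
Qed.

(** With [N = 2^J], a sum of [N] terms, each at most [B N^(-d-1) N^d]. *)
Lemma exists_mass : exists2 B : R, 0 < B & forall J,
  \sum_(n < 2 ^ J) `|iter d.+1 fdiff (fun n => phi (n%:R / (2 ^ J)%:R) ^+ 2) n| *
     iter d.+1 psum delta0 n <= B.
Proof.
have [B B0 HB] := cutoff_fdiff d cphi; exists B => // J.
have N0 : (0 < 2 ^ J)%N by rewrite expn_gt0.
set N := (2 ^ J)%N in N0 *.
have Nr : 0 < N%:R :> R by rewrite ltr0n.
apply: (@le_trans _ _ (\sum_(n < N) B / N%:R)).
  apply: ler_sum => n _.
  apply: (@le_trans _ _ (B / N%:R ^+ d.+1 * N%:R ^+ d)).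
    apply: ler_pM => //; [exact: iter_psum_ge0|exact: HB|].
    by apply: le_trans (iter_psum_delta0 _ _) _; rewrite lerXn2r ?nnegrE ?ler0n // ler_nat.
  by rewrite exprS invfM -!mulrA mulVf ?mulr1 // expf_neq0 // gt_eqF.
by rewrite sumr_const card_ord -[_ *+ _]mulr_natr divfK // gt_eqF.
Qed.

Section Mass.
Variable mu : probability (borelRd R d) R.
Hypothesis mu_sphere : mu (@sphere R d : set (borelRd R d)) = 1%E.
Hypothesis zonal_mean : forall k (x : 'cV[R]_d), sphere x ->
  sphere_integral mu (fun y => toC (zonal d k (dot x y))) = toC (delta0 k).
Local Notation sph := (@sphere R d : set (borelRd R d)).

(** Integration is linear and only the constant harmonic has a mean. *)
Lemma psum_zonal_mean M n (x : 'cV[R]_d) : sphere x ->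
  bounded_borel (fun y => toC (iter M psum (zonal d ^~ (dot x y)) n)) /\
  sphere_integral mu (fun y => toC (iter M psum (zonal d ^~ (dot x y)) n)) =
    toC (iter M psum delta0 n).
Proof.
move=> sx; elim: M n => [|M IH] n /=.
  by split; [exact: bounded_borel_zonal|exact: zonal_mean].
have E (c : nat -> R) : toC (psum c n) = \sum_(k < n.+1) toC (c k) by rewrite (rmorph_sum toC).
under eq_fun do rewrite E.
split; first by apply: bounded_borel_sum => k _; exact: (IH k).1.
rewrite sphere_integral_sum //; last first.
  by move=> k _; apply: bounded_borel_cintegrable => //; exact: (IH k).1.
by rewrite E; apply: eq_bigr => k _; exact: (IH k).2.
Qed.

Let c J n := `|iter d.+1 fdiff (fun n => phi (n%:R / (2 ^ J)%:R) ^+ 2) n|.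
Let w J (x y : 'cV[R]_d) : C :=
  \sum_(n < 2 ^ J) toC (c J n) * toC (iter d.+1 psum (zonal d ^~ (dot x y)) n).

Let bw J x : sphere x -> bounded_borel (w J x).
Proof.
move=> sx; apply: bounded_borel_sum => n _; apply: bounded_borelM.
  exact: bounded_borel_cst.
exact: (psum_zonal_mean _ _ sx).1.
Qed.

Let wE J x y : sphere x -> sphere y -> w J x y = toC (majorant J (dot x y)).
Proof.
move=> sx sy; rewrite (rmorph_sum toC); apply: eq_bigr => n _.
rewrite -(rmorphM toC) (ger0_norm (x := iter d.+1 psum _ _)) //.
by apply: iter_psum_zonal_ge0 => //; exact: dot_sphere_le1.
Qed.

Lemma majorant_bounded J (x : 'cV[R]_d) : sphere x ->
  exists M, forall y, sphere y -> `|majorant J (dot x y)| <= M.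
Proof.
move=> sx; have [_ _ [M HM]] := bw J sx; exists M => y sy.
by have := (HM y sy).1; rewrite wE.
Qed.

Lemma majorant_mass J B (x : 'cV[R]_d) : sphere x ->
  \sum_(n < 2 ^ J) c J n * iter d.+1 psum delta0 n <= B ->
  (\int[mu]_(y in sph) (majorant J (dot x y))%:E <= B%:E)%E.
Proof.
move=> sx HB.
have [iw _] : cintegrable mu (w J x) by apply: bounded_borel_cintegrable => //; exact: bw.
have -> : (\int[mu]_(y in sph) (majorant J (dot x y))%:E)%E = (Re (sphere_integral mu (w J x)))%:E.
  rewrite /sphere_integral /= fineK; last first.
    by apply: integrable_fin_num => //; exact: measurable_sphere.
  by apply: eq_integral => y; rewrite inE => sy; rewrite wE.
rewrite lee_fin sphere_integral_sum //; last first.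
  move=> n _; apply: bounded_borel_cintegrable => //; apply: bounded_borelM.
    exact: bounded_borel_cst.
  exact: (psum_zonal_mean _ _ sx).1.
under eq_bigr => n _.
  rewrite sphere_integralZ; last first.
    by apply: bounded_borel_cintegrable => //; exact: (psum_zonal_mean _ _ sx).1.
  rewrite (psum_zonal_mean _ _ sx).2 -(rmorphM toC); over.
by rewrite -(rmorph_sum toC).
Qed.

End Mass.

End Majorant.

(** * The error of the frame operator *)

Section Modulus.
Context {R : realType}.
Implicit Types (z : R[i]).

Lemma modc_ge0 z : 0 <= modc z.
Proof. by case: z => a b; rewrite /modc /= sqrtr_ge0. Qed.

Lemma Re_le_modc z : `|Re z| <= modc z.
Proof. by case: z => a b; rewrite /modc /= -sqrtr_sqr ler_wsqrtr // lerDl sqr_ge0. Qed.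

Lemma Im_le_modc z : `|Im z| <= modc z.
Proof. by case: z => a b; rewrite /modc /= -sqrtr_sqr ler_wsqrtr // lerDr sqr_ge0. Qed.

Lemma modc_le z : modc z <= `|Re z| + `|Im z|.
Proof.
case: z => a b; rewrite /modc /= -[leRHS]ger0_norm ?addr_ge0 // -sqrtr_sqr ler_wsqrtr //.
rewrite sqrrD !real_normK ?num_real // lerD2r lerDl mulrn_wge0 // mulr_ge0 //.
Qed.

Lemma modcB z1 z2 : modc (z1 - z2) <= modc z1 + modc z2.
Proof. by rewrite -lecR (rmorphD (real_complex R)); exact: (ler_normB z1 z2). Qed.

Lemma measurable_modc {disp} {T : measurableType disp} (S : set T) (f : T -> R[i]) :
  measurable_fun S (fun x => Re (f x)) -> measurable_fun S (fun x => Im (f x)) ->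
  measurable_fun S (fun x => modc (f x)).
Proof.
move=> mr mi.
have -> : (fun x => modc (f x)) = fun x => Num.sqrt (Re (f x) ^+ 2 + Im (f x) ^+ 2).
  by apply/funext => x; rewrite /modc; case: (f x).
apply: (measurableT_comp (f := @Num.sqrt R)).
  by apply: continuous_measurable_fun; exact: sqrt_continuous.
by apply: measurable_funD; exact: measurable_funX.
Qed.

End Modulus.

Section Pointwise.
Context {R : realType} {d : nat} (mu : probability (borelRd R d) R) (K W : R -> R).
Hypothesis mu_sphere : mu (@sphere R d : set (borelRd R d)) = 1%E.
Local Notation sph := (@sphere R d : set (borelRd R d)).
Local Notation toC := (real_complex R).
Hypothesis bK : forall x : 'cV[R]_d, bounded_borel (fun y : 'cV[R]_d => toC (K (dot x y))).
Hypothesis KW : forall t, `|K t| <= W t.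
Hypothesis mW : measurable_fun [set: R] W.
Hypothesis bW : forall x : 'cV[R]_d, sphere x -> exists M, forall y, sphere y -> `|W (dot x y)| <= M.

Let mWx (x : 'cV[R]_d) : measurable_fun sph (fun y : borelRd R d => W (dot x (y : 'cV[R]_d))).
Proof.
apply: measurable_funTS; apply: (measurableT_comp mW).
exact: (measurableT_comp measurable_dot (pair1_measurable (x : borelRd R d))).
Qed.

(** The factor 2 comes from estimating the real and the imaginary part
    separately. *)
Lemma integral_operator_modulus (g : 'cV[R]_d -> R[i]) (x : 'cV[R]_d) : sphere x ->
  cintegrable mu g -> exists2 t : R, 0 <= t &
    modc (sphere_integral mu (fun y => g y * toC (K (dot x y)))) <= 2 * t /\
    (t%:E = \int[mu]_(y in sph) (W (dot x y) * modc (g y))%:E)%E.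
Proof.
move=> sx [gr gi]; have ms := @measurable_sphere R d.
have mr : measurable_fun sph (fun y : borelRd R d => Re (g y)).
  by apply/measurable_EFinP; exact: measurable_int gr.
have mi : measurable_fun sph (fun y : borelRd R d => Im (g y)).
  by apply/measurable_EFinP; exact: measurable_int gi.
have iu : mu.-integrable sph (EFin \o (fun y : borelRd R d => modc (g y))).
  apply: (@le_integrable _ _ _ mu _ ms _ (EFin \o (fun y : borelRd R d => `|Re (g y)| + `|Im (g y)|))).
  - by apply/measurable_EFinP; exact: measurable_modc.
  - move=> y _ /=; rewrite lee_fin ger0_norm ?modc_ge0 // ger0_norm ?addr_ge0 //.
    exact: modc_le.
  - have := integrableD ms (integrable_norm gr) (integrable_norm gi).
    by apply: eq_integrable.
have [M WM] := bW sx.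
have iuW : mu.-integrable sph (EFin \o (fun y : borelRd R d => W (dot x y) * modc (g y))).
  have := integrable_mul_bounded iu (mWx x) WM.
  by apply: eq_integrable => // y _ /=; rewrite mulrC.
have W0 s : 0 <= W s by exact: le_trans (KW s).
have [iR iI] := cintegrableM (conj gr gi) (bK x).
exists (\int[mu]_(y in sph) (W (dot x y) * modc (g y))).
  by apply: Rintegral_ge0 => y _; rewrite mulr_ge0 // modc_ge0.
split; last by rewrite fineK //; exact: integrable_fin_num.
have part (q : R[i] -> R) : (forall y, `|q (g y * toC (K (dot x y)))| <= `|K (dot x y)| * modc (g y)) ->
    mu.-integrable sph (EFin \o (fun y : borelRd R d => q (g y * toC (K (dot x y))))) ->
    `|\int[mu]_(y in sph) q (g y * toC (K (dot x y)))| <= \int[mu]_(y in sph) (W (dot x y) * modc (g y)).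
  move=> qle iq; apply: le_trans (le_normr_Rintegral ms iq) _.
  apply: le_Rintegral => //; first exact: integrable_norm iq.
  by move=> y _; apply: le_trans (qle y) _; rewrite ler_wpM2r // modc_ge0.
apply: le_trans (modc_le _) _; rewrite mulr2n mulrDl mul1r; apply: lerD; apply: part => //.
- move=> y; rewrite complexReM /= mulr0 subr0 normrM mulrC ler_wpM2l //; exact: Re_le_modc.
- move=> y; rewrite complexImM /= mulr0 add0r normrM mulrC ler_wpM2l //; exact: Im_le_modc.
Qed.

End Pointwise.

Section LpNorm.
Context {R : realType} {d : nat} (mu : probability (borelRd R d) R).
Hypothesis mu_sphere : mu (@sphere R d : set (borelRd R d)) = 1%E.
Local Notation sph := (@sphere R d : set (borelRd R d)).
Local Notation measurable_parts f :=
  (measurable_fun sph (fun x : borelRd R d => Re (f x)) /\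
   measurable_fun sph (fun x : borelRd R d => Im (f x))).
Implicit Types (f : 'cV[R]_d -> R[i]).

Lemma Lp_norm_fin r f : 1 <= r ->
  Lp_norm mu r%:E f = ((\int[mu]_(x in sph) (modc (f x) `^ r)%:E) `^ r^-1)%E.
Proof.
move=> r1; rewrite /Lp_norm unlock; congr (_ `^ _)%E.
rewrite [RHS]integral_mkcond; apply: eq_integral => x _; rewrite !patchE.
case: ifP => _; first by rewrite gee0_abs ?lee_fin ?modc_ge0.
by rewrite abse0 poweR_EFin powR0 // gt_eqF // (lt_le_trans _ r1).
Qed.

Lemma cintegrable_parts f : cintegrable mu f -> measurable_parts f.
Proof. by move=> [fr fi]; split; apply/measurable_EFinP; [exact: measurable_int fr|exact: measurable_int fi]. Qed.

(** On a probability space, since [a <= a^r + 1]. *)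
Lemma in_Lp_cintegrable r f : 1 <= r -> in_Lp mu r%:E f -> cintegrable mu f.
Proof.
move=> r1 [mr mi]; rewrite Lp_norm_fin // => fr; have ms := @measurable_sphere R d.
have r0 : 0 < r by exact: lt_le_trans r1.
have m : measurable_fun sph (fun x : borelRd R d => modc (f x) `^ r).
  by apply: (measurableT_comp (measurable_powR r)); exact: measurable_modc.
have ir : mu.-integrable sph (EFin \o (fun x : borelRd R d => modc (f x) `^ r + 1)).
  have i1 : mu.-integrable sph (EFin \o (fun x : borelRd R d => modc (f x) `^ r)).
    apply/integrableP; split; first exact/measurable_EFinP.
    have -> : (\int[mu]_(x in sph) `|(EFin \o (fun x : borelRd R d => modc (f x) `^ r)%R) x| =
        \int[mu]_(x in sph) (modc (f x) `^ r)%:E)%E.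
      by apply: eq_integral => x _; rewrite /= ger0_norm ?powR_ge0.
    move: fr; case: (\int[mu]_(x in _) _)%E => [s _| |_]; [by rewrite ltry| |by []].
    by rewrite poweRyr // invr_neq0 // gt_eqF.
  have i2 : mu.-integrable sph (EFin \o (fun _ : borelRd R d => 1 : R)).
    apply: (@bounded_real_integrable _ _ mu _ 1); first exact: measurable_cst.
    by move=> x _; rewrite normr1.
  by have := integrableD ms i1 i2; apply: eq_integrable.
have le1 a : 0 <= a -> a <= a `^ r + 1.
  by move=> a0; have := le_powR_split r1 a0 ltr01; rewrite powR1 mul1r.
split; apply: le_integrable ir => //.
- exact/measurable_EFinP.
- move=> x _ /=; rewrite lee_fin [leRHS]ger0_norm ?addr_ge0 ?powR_ge0 //.
  by apply: le_trans (Re_le_modc _) _; apply: le1; exact: modc_ge0.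
- exact/measurable_EFinP.
- move=> x _ /=; rewrite lee_fin [leRHS]ger0_norm ?addr_ge0 ?powR_ge0 //.
  by apply: le_trans (Im_le_modc _) _; apply: le1; exact: modc_ge0.
Qed.

Lemma measurable_within_sphere (u : 'cV[R]_d -> R) : {within @sphere R d, continuous u} ->
  measurable_fun sph (u : borelRd R d -> R).
Proof.
move=> cu; apply: (measurability _ (RGenOInfty.measurableE R)) => //.
move=> _ [_ [a ->] <-].
have oI : open (`]a, +oo[%classic : set R) by exact: interval_open.
move/continuousP: cu => /(_ _ oI) /open_subspaceP[V oV VE].
rewrite setIC -VE; apply: measurableI; first exact: sub_sigma_algebra.
exact: measurable_sphere.
Qed.

Lemma bounded_cintegrable f M : measurable_parts f ->
  (forall x, sphere x -> modc (f x) <= M) -> cintegrable mu f.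
Proof.
move=> [mr mi] fM; split; apply: (@bounded_real_integrable _ _ mu _ M) => // x sx.
- exact: le_trans (Re_le_modc _) (fM x sx).
- exact: le_trans (Im_le_modc _) (fM x sx).
Qed.

Lemma cintegrableB f f' : cintegrable mu f -> cintegrable mu f' ->
  cintegrable mu (fun x => f x - f' x).
Proof.
move=> cf cf'; have := cintegrableD cf (cintegrableM cf' (bounded_borel_cst (-1))).
by apply: cintegrable_ext => x _; rewrite mulrN1.
Qed.

End LpNorm.

Section FrameError.
Context {R : realType} {n : nat} (phi : R -> R).
Variables (mu : probability (borelRd R n.+1) R) (mu' : probability (borelRd R n) R).
Hypothesis n2 : (2 <= n)%N.
Hypothesis cphi : cutoff phi.
Hypothesis mu_rot : rotation_invariant_on_sphere mu.
Hypothesis mu'_rot : rotation_invariant_on_sphere mu'.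
Variables (g : 'cV[R]_n.+1 -> 'M[R]_n.+1) (h : 'cV[R]_n -> 'M[R]_n.+1).
Hypothesis g_rotation : pole_rotation g.
Hypothesis h_rotation : @equator_rotation R n.+1 h.
Variables (N N' : nat -> nat) (eta : nat -> nat -> 'cV[R]_n.+1) (w : nat -> nat -> R)
  (eta' : nat -> nat -> 'cV[R]_n) (w' : nat -> nat -> R).
Hypothesis rules : quadrature_rules mu N eta w.
Hypothesis rules' : quadrature_rules mu' N' eta' w'.
Variable J : nat.

Local Notation C := R[i].
Local Notation toC := (real_complex R).
Local Notation sph := (@sphere R n.+1 : set (borelRd R n.+1)).
Local Notation Lam := (@Lambda R n.+1 mu phi g h N eta w N' eta' w' J).
Local Notation W := (@majorant R n.+1 phi J).
Implicit Types (f P : 'cV[R]_n.+1 -> C).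

Let n3 : (3 <= n.+1)%N. Proof. exact: n2. Qed.

(** The convolution formula at a level whose rules are exact in degrees [2k]
    and [2l]. *)
Lemma zonal_projection k l (x u : 'cV[R]_n.+1) : sphere x -> sphere u ->
  sphere_integral mu (fun y => toC (zonal n.+1 k (dot x y)) * toC (zonal n.+1 l (dot y u))) =
  toC (zonal n.+1 k (dot x u)) *+ (k == l).
Proof.
apply: (level_convolution n2 mu_rot mu'_rot g_rotation h_rotation rules rules' (j := (k + l)%N)).
- by have := ltn_expl (k + l).+1 (isT : (1 < 2)%N); rewrite (expnS 2 (k + l).+1); lia.
- by have := ltn_expl (k + l).+1 (isT : (1 < 2)%N); rewrite (expnS 2 (k + l).+1); lia.
Qed.

Lemma zonal_mean k (x : 'cV[R]_n.+1) : sphere x ->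
  sphere_integral mu (fun y => toC (zonal n.+1 k (dot x y))) = toC (delta0 k).
Proof.
move=> sx; have := zonal_projection k 0 sx sx.
under [in X in X -> _]eq_fun do rewrite zonal0 mulr1.
by move=> ->; rewrite /delta0; case: k => [|k]; rewrite ?zonal0.
Qed.

Variables (m : R) (f P : 'cV[R]_n.+1 -> C).
Hypothesis mJ : m * 2 <= (2 ^ J)%:R.
Hypothesis polyP : spherical_poly m P.

(** Since the kernel reproduces [P], only [f - P] is averaged. *)
Lemma frame_error (x : 'cV[R]_n.+1) : cintegrable mu f -> sphere x -> exists2 t : R, 0 <= t &
  modc (f x - Lam f x) <= modc (f x - P x) + 2 * t /\
  (t%:E = \int[mu]_(y in sph) (W (dot x y) * modc (f y - P y))%:E)%E.
Proof.
move=> cf sx.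
have [cP rP] := kernel_reproduces n3 mu_rot.1 cphi zonal_projection mJ polyP.
have cfP := cintegrableB cf cP.
have bK (y : 'cV[R]_n.+1) := bounded_borel_kernel phi J y.
have bW (y : 'cV[R]_n.+1) : sphere y -> exists M, forall z, sphere z -> `|W (dot y z)| <= M.
  exact: (majorant_bounded phi mu_rot.1 zonal_mean).
have [t t0 [tle tE]] := integral_operator_modulus bK
  (kernel_le_majorant cphi J) (measurable_majorant _ _) bW sx cfP.
exists t => //; split=> //.
rewrite (Lambda_kernel n2 cphi mu_rot mu'_rot g_rotation h_rotation rules rules') //.
have -> : sphere_integral mu (fun y => f y * toC (@kernel R phi n.+1 J (dot x y))) =
    sphere_integral mu (fun y => (f y - P y) * toC (@kernel R phi n.+1 J (dot x y))) + P x.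
  rewrite -rP // -sphere_integralD; [|exact: cintegrableM|exact: cintegrableM].
  by apply: sphere_integral_ext => y _; rewrite mulrBl subrK.
move: tle; set I0 := sphere_integral _ _ => tle.
have -> : f x - (I0 + P x) = (f x - P x) - I0 by ring.
by apply: le_trans (modcB _ _) _; rewrite lerD2l.
Qed.

Variable B : R.
Hypothesis B_gt0 : 0 < B.
Hypothesis B_mass : \sum_(n0 < 2 ^ J) `|iter n.+2 fdiff (fun n1 => phi (n1%:R / (2 ^ J)%:R) ^+ 2) n0| *
     iter n.+2 psum delta0 n0 <= B.

Let W_mass (x : 'cV[R]_n.+1) : sphere x -> (\int[mu]_(y in sph) (W (dot x y))%:E <= B%:E)%E.
Proof. by move=> sx; exact: (majorant_mass mu_rot.1 zonal_mean sx B_mass). Qed.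

Definition power_const r := 2 `^ r * (1 + 2 `^ r * (2 `^ r * B `^ (r - 1)) * B).

Lemma frame_error_Lp r : 1 <= r -> in_Lp mu r%:E f ->
  (Lp_norm mu r%:E (fun x => f x - Lam f x)%R <=
   (power_const r `^ r^-1)%:E * Lp_norm mu r%:E (fun x => f x - P x)%R)%E.
Proof.
move=> r1 fLp; have cf := in_Lp_cintegrable r1 fLp.
have r0 : 0 < r by exact: lt_le_trans r1.
have [cP _] := kernel_reproduces n3 mu_rot.1 cphi zonal_projection mJ polyP.
have [mfP1 mfP2] := cintegrable_parts (cintegrableB cf cP).
have cL : cintegrable mu (Lam f).
  apply: bounded_borel_cintegrable => //.
  have := bounded_borel_Lambda n2 cphi g_rotation h_rotation rules rules' J f.
  by [].
have [mfL1 mfL2] := cintegrable_parts (cintegrableB cf cL).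
rewrite !Lp_norm_fin //.
have I0 : (0 <= \int[mu]_(x in sph) (modc (f x - P x) `^ r)%:E)%E.
  by apply: integral_ge0 => x _; rewrite lee_fin powR_ge0.
have c0 : 0 <= power_const r.
  by rewrite mulr_ge0 ?powR_ge0 // addr_ge0 // !mulr_ge0 ?powR_ge0 // ltW.
rewrite -poweR_EFin -poweRM ?lee_fin //.
apply: gt0_ler_poweR; first by rewrite invr_ge0 ltW.
- by rewrite in_itv /= leey andbT; apply: integral_ge0 => x _; rewrite lee_fin powR_ge0.
- by rewrite in_itv /= leey andbT mule_ge0.
apply: (@operator_power_integral _ _ _ mu sph (fun x y : borelRd R n.+1 => W (dot (x : 'cV[R]_n.+1) y))) => //.
- exact: measurable_sphere.
- by move=> x y; exact: majorant_ge0.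
- exact: (measurableT_comp (measurable_majorant _ _) measurable_dot).
- by move=> x y; rewrite dotC.
- by move=> x; exact: modc_ge0.
- exact: measurable_modc.
- exact: measurable_modc.
- by move=> x _; exact: modc_ge0.
- move=> x sx; have [t t0 [tle tE]] := frame_error cf sx.
  by exists t => //; split=> //; rewrite tE.
Qed.

(** If the right-hand side is infinite there is nothing to prove; otherwise [f]
    differs from a polynomial by a bounded function, hence is integrable. *)
Lemma frame_error_sup : in_Lp mu +oo%E f ->
  (Lp_norm mu +oo%E (fun x => f x - Lam f x)%R <=
   (1 + 2 * B)%:E * Lp_norm mu +oo%E (fun x => f x - P x)%R)%E.
Proof.
move=> [cr ci].
have c0 : 0 < 1 + 2 * B by rewrite addr_gt0 // mulr_gt0.
have s0 : sphere (basis_vec R n.+1 0) by exact: sphere_basis_vec.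
have [[M EM]|E|E] : [\/ exists M : R, Lp_norm mu +oo%E (fun x => f x - P x)%R = M%:E,
     Lp_norm mu +oo%E (fun x => f x - P x)%R = +oo%E |
     Lp_norm mu +oo%E (fun x => f x - P x)%R = -oo%E].
  by case: (Lp_norm _ _ _) => [M| |]; [apply: Or31; exists M|apply: Or32|apply: Or33].
- rewrite EM.
  have uM x : sphere x -> modc (f x - P x) <= M.
    by move=> sx; rewrite -lee_fin -EM; apply: ereal_sup_ubound; exists x.
  have [cP _] := kernel_reproduces n3 mu_rot.1 cphi zonal_projection mJ polyP.
  have [mP1 mP2] := cintegrable_parts cP.
  have cfP : cintegrable mu (fun x => f x - P x).
    apply: (bounded_cintegrable _ _ uM); split.
    + have -> : (fun x : borelRd R n.+1 => Re (f x - P x)) = (fun x => Re (f x) - Re (P x)).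
        by apply/funext => x; case: (f x) (P x) => [? ?] [? ?].
      by apply: measurable_funB => //; exact: measurable_within_sphere.
    + have -> : (fun x : borelRd R n.+1 => Im (f x - P x)) = (fun x => Im (f x) - Im (P x)).
        by apply/funext => x; case: (f x) (P x) => [? ?] [? ?].
      by apply: measurable_funB => //; exact: measurable_within_sphere.
  have cf : cintegrable mu f.
    have := cintegrableD cfP cP; apply: cintegrable_ext => x _; exact: subrK.
  apply: ge_ereal_sup => _ [x sx <-]; rewrite -EFinM lee_fin.
  have [t t0 [tle tE]] := frame_error cf sx.
  apply: le_trans tle _.
  suff : t <= M * B by have := uM x sx; nra.
  rewrite -lee_fin tE EFinM.
  apply: le_trans (lee_wpmul2l _ (W_mass sx)); last first.
    by rewrite lee_fin (le_trans (modc_ge0 _) (uM x sx)).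
  have M0 : 0 <= M by exact: le_trans (modc_ge0 _) (uM x sx).
  have mWx : measurable_fun sph (fun y : borelRd R n.+1 => (W (dot x (y : 'cV[R]_n.+1)))%:E).
    apply/measurable_EFinP/measurable_funTS.
    apply: (measurableT_comp (measurable_majorant (d := n.+1) phi J)).
    exact: (measurableT_comp measurable_dot (pair1_measurable (x : borelRd R n.+1))).
  rewrite -ge0_integralZl //; last 2 first.
  + exact: measurable_sphere.
  + by move=> y _; rewrite lee_fin majorant_ge0.
  apply: ge0_le_integral => //.
  + exact: measurable_sphere.
  + by move=> y _; rewrite lee_fin mulr_ge0 ?majorant_ge0 ?modc_ge0.
  + apply/measurable_EFinP; apply: measurable_funM; first exact/measurable_EFinP.
    by have [m1 m2] := cintegrable_parts cfP; exact: measurable_modc.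
  + exact: measurable_funeM.
  + by move=> y sy; rewrite lee_fin mulrC ler_wpM2r ?majorant_ge0 ?uM.
- by rewrite E gt0_muley ?lte_fin // leey.
- have : ((modc (f (basis_vec R n.+1 0) - P (basis_vec R n.+1 0)))%:E <= -oo)%E.
    by rewrite -E; apply: ereal_sup_ubound; exists (basis_vec R n.+1 0).
  by rewrite leNgt ltNyr.
Qed.

End FrameError.

Theorem proposition3p2 (R : realType) (d : nat) (p : \bar R) (phi : R -> R) :
  (3 <= d)%N -> (1 <= p)%E -> cutoff phi ->
  exists c : R, 0 < c /\
    forall (omega : probability (borelRd R d) R)
      (omega' : probability (borelRd R d.-1) R)
      (g : 'cV[R]_d -> 'M[R]_d) (h : 'cV[R]_d.-1 -> 'M[R]_d)
      (N : nat -> nat) (eta : nat -> nat -> 'cV[R]_d) (w : nat -> nat -> R)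
      (N' : nat -> nat) (eta' : nat -> nat -> 'cV[R]_d.-1)
      (w' : nat -> nat -> R),
    rotation_invariant_on_sphere omega ->
    rotation_invariant_on_sphere omega' ->
    pole_rotation g -> equator_rotation h ->
    quadrature_rules omega N eta w -> quadrature_rules omega' N' eta' w' ->
    forall (J : nat) (f : 'cV[R]_d -> R[i]), in_Lp omega p f ->
      (Lp_norm omega p
         (fun x => f x - Lambda omega phi g h N eta w N' eta' w' J f x)%R
       <= c%:E * best_error omega (2 ^ (J%:Z - 1))%R p f)%E.
Proof.
case: d => [//|n] d3 p1 cphi.
have n2 : (2 <= n)%N by [].
have [B B0 BJ] := exists_mass (d := n.+1) cphi.
have mJ J : (2 : R) ^ (J%:Z - 1) * 2 <= (2 ^ J)%:R.
  by rewrite -[X in _ * X]expr1z -expfzDr ?pnatr_eq0 // subrK natrX.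
have reduce (mu : probability (borelRd R n.+1) R) c J f (X : \bar R) : 0 < c ->
    (forall P, spherical_poly (2 ^ (J%:Z - 1)) P ->
      (X <= c%:E * Lp_norm mu p (fun x => (f x - P x)%R))%E) ->
    (X <= c%:E * best_error mu (2 ^ (J%:Z - 1)) p f)%E.
  move=> c0 H; rewrite -[c](invrK c) lee_pdivlMl ?invr_gt0 //.
  apply: le_ereal_inf_tmp => _ [P sP <-].
  by rewrite -lee_pdivlMl ?invr_gt0 // invrK; exact: H.
case: p p1 reduce => [r| |//] p1 reduce.
- have r1 : 1 <= r by rewrite -lee_fin.
  exists (power_const B r `^ r^-1); split.
    rewrite powR_gt0 // mulr_gt0 ?powR_gt0 // ltr_pwDl //.
    by rewrite !mulr_ge0 ?powR_ge0 // ltW.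
  move=> mu mu' g h N eta w N' eta' w' mr mr' gr hr ru ru' J f fLp.
  apply: reduce => [|P sP].
    rewrite powR_gt0 // mulr_gt0 ?powR_gt0 // ltr_pwDl //.
    by rewrite !mulr_ge0 ?powR_ge0 // ltW.
  exact: (frame_error_Lp n2 cphi mr mr' gr hr ru ru' (mJ J) sP B0 (BJ J) r1 fLp).
- exists (1 + 2 * B); split; first by rewrite addr_gt0 // mulr_gt0.
  move=> mu mu' g h N eta w N' eta' w' mr mr' gr hr ru ru' J f fLp.
  apply: reduce => [|P sP]; first by rewrite addr_gt0 // mulr_gt0.
  exact: (frame_error_sup n2 cphi mr mr' gr hr ru ru' (mJ J) sP B0 (BJ J) fLp).
Qed.
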